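(* Let $\mu\in\mathcal{P}_2$, $a=\operatorname{Re} m_1(\mu)$ and $b=\operatorname{Im} m_1(\mu)$, where $m_1(\mu)$ is the first complex moment of $\mu$. Then, as $N\to\infty$, the probability measures $$\mu_N^T=(D_{1/N}\mu)^{\ast N},\qquad \mu_N^F=(D_{1/N}\mu)^{\boxplus N},\qquad \mu_N^B=(D_{1/N}\mu)^{\uplus N}$$ all converge weakly to the Cauchy distribution $\mu_{a,b}$, where, if $b=0$, $\mu_{a,0}$ is understood to be $\delta_a$.
   Context: Class $\mathcal{P}_2$: a positive measure $\lambda$ on $\mathbb{R}$ satisfies property (A2) if there exist $0<r<R$ and a real analytic function $p(x)=\sum_{n=2}^\infty\frac{a_n}{x^n}$, absolutely convergent for $|x|>r$ and non-negative on $|x|\ge R$, such that $\lambda(dx)=p(x)\mathbf{1}_{\{|x|\ge R\}}(x)\,dx$. $\mathcal{P}_2$ consists of the probability measures on $\mathbb{R}$ of the form $\mu=\nu+\lambda$, where $\nu$ is a positive measure with finite second moment and $\lambda$ satisfies (A2). Complex moments: for $\lambda$ satisfying (A2), $m_n(\lambda)=\int_{\gamma_R}z^np(z)\,dz$, where $p(z)=\sum_{n\ge 2}a_nz^{-n}$ for $|z|>r$ and $\gamma_R=\{Re^{i\theta} : 0\le\theta\le\pi\}$ is oriented counterclockwise. For $\mu=\nu+\lambda\in\mathcal{P}_2$, $m_1(\mu)=\int_{\mathbb{R}}x\,\nu(dx)+m_1(\lambda)$; this does not depend on the decomposition, and $\operatorname{Im}m_1(\mu)\ge0$. Cauchy distribution: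 $\mu_{a,b}(dx)=\frac1\pi\frac{b}{(x-a)^2+b^2}dx$ for $a\in\mathbb{R}$, $b>0$. Dilation: $\int f(x)(D_c\mu)(dx)=\int f(cx)\mu(dx)$ for all bounded continuous $f$. Convolutions: let $\mathbb{C}_-=\{\operatorname{Im}z<0\}$, $G_\mu(z)=\int_{\mathbb{R}}\frac{\mu(dx)}{z-x}$ and $F_\mu=1/G_\mu$. $\ast$ is the usual (tensor) convolution. The Boolean convolution $\uplus$ is characterized by $F_{\mu_1\uplus\mu_2}(z)=F_{\mu_1}(z)+F_{\mu_2}(z)-z$ on $\mathbb{C}_-$. The free convolution $\boxplus$ is characterized by $F_{\mu_1\boxplus\mu_2}^{-1}(z)=F_{\mu_1}^{-1}(z)+F_{\mu_2}^{-1}(z)-z$ on the intersection of the domains $\Omega_1\cap\Omega_2$, where $F_{\mu_k}^{-1}$ is the right inverse of $F_{\mu_k}$ (with $F_{\mu_k}^{-1}(z)/z\to1$ as $z\to\infty$ non-tangentially) on a domain $\Omega_k\subset\mathbb{C}_-$ of the form $\bigcup_{\alpha>0}\Gamma_{\alpha,\beta_\alpha}$ for some $\beta_\alpha>0$, with $\Gamma_{\alpha,\beta}=\{z\in\mathbb{C}_- : |\operatorname{Re}z|<\alpha|\operatorname{Im}z|,\ \operatorname{Im}z<-\beta\}$. The superscripts $\ast N$, $\boxplus N$, $\uplus N$ denote $N$-fold convolution powers. *)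

(* Defs.v *)
From HB Require Import structures.
From mathcomp Require Import all_boot all_order all_algebra.
From mathcomp Require Import all_classical all_reals all_analysis.
From mathcomp Require Import measurable_realfun complex.
Set Implicit Arguments.
Unset Strict Implicit.
Unset Printing Implicit Defensive.
Import Order.TTheory GRing.Theory Num.Theory.
Import numFieldTopology.Exports numFieldNormedType.Exports.

Local Open Scope classical_set_scope.
Local Open Scope ring_scope.
Local Open Scope complex_scope.

Notation borel_measure R := {measure set (measurableTypeR R) -> \bar R}.
Notation borel_probability R := (probability (measurableTypeR R) R).

Section complex_integrals.
Context {R : realType}.

Definition Cintegral d (T : measurableType d) (mu : {measure set T -> \bar R})
    (D : set T) (f : T -> R[i]) : R[i] :=
  (\int[mu]_(x in D) complex.Re (f x)) +i* (\int[mu]_(x in D) complex.Im (f x)).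

(* The integral of f along t |-> rho * e^(i t), 0 <= t <= pi. *)
Definition arc_integral (rho : R) (f : R[i] -> R[i]) : R[i] :=
  Cintegral (@lebesgue_measure R) `[0, pi]
    (fun t => let e := cos t +i* sin t in
              f (rho%:C * e) * (rho%:C * ((0 +i* 1) * e))).

End complex_integrals.

(* The sum of the a_n / z^n over n >= 2, used both for K = R and K = R[i]. *)
Definition inv_pseries (K : numFieldType) (a : nat -> K) (z : K) : K :=
  limn (fun N => \sum_(2 <= n < N) (a n / z ^+ n) : K^o).

Section class_P2.
Context {R : realType}.
Implicit Types (mu : borel_probability R) (nu lam : borel_measure R).

Definition A2_with lam (r rho : R) (a : nat -> R) : Prop :=
  [/\ 0 < r < rho,
      forall x : R, r < `|x| ->
        cvgn (fun N => \sum_(2 <= n < N) `|a n / x ^+ n|),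
      forall x : R, rho <= `|x| -> 0 <= inv_pseries a x &
      forall A : set (measurableTypeR R), measurable A ->
        lam A = (\int[@lebesgue_measure R]_(x in A `&` [set x : R | (rho <= `|x|)%R])
                   (inv_pseries a x)%:E)%E].

Definition P2_decomposition mu nu lam (r rho : R) (a : nat -> R) : Prop :=
  [/\ (\int[nu]_x ((x : R) ^+ 2)%:E < +oo)%E,
      A2_with lam r rho a &
      forall A, measurable A -> mu A = (nu A + lam A)%E].

Definition in_P2 mu : Prop :=
  exists nu lam r rho a, P2_decomposition mu nu lam r rho a.

Definition complex_moment (rho : R) (a : nat -> R) (n : nat) : R[i] :=
  arc_integral rho (fun z => z ^+ n * inv_pseries (fun k => (a k)%:C) z).

(* m is the first complex moment of mu; the value of m is the same for all
   decompositions of mu. *)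
Definition first_complex_moment mu (m : R[i]) : Prop :=
  exists nu lam r rho a, P2_decomposition mu nu lam r rho a /\
    m = (\int[nu]_x (x : R))%:C + complex_moment rho a 1.

End class_P2.

Section cauchy.
Context {R : realType}.
Local Notation leb := (@lebesgue_measure R).

Definition cauchy_pdf (a b x : R) : R :=
  pi^-1 * (b / ((x - a) ^+ 2 + b ^+ 2)).

(* The value for b < 0 is junk; the imaginary part of a first complex moment is
   never negative. *)
Definition cauchy_prob (a b : R) : set (measurableTypeR R) -> \bar R :=
  if 0 < b then fun A => (\int[leb]_(x in A) (cauchy_pdf a b x)%:E)%E
  else @dirac _ (measurableTypeR R) a R.

Section instance.
Variables (a b : R).

Let pdf_ge0 x : 0 < b -> 0 <= cauchy_pdf a b x.
Proof.
move=> b0; rewrite mulr_ge0 ?invr_ge0 ?pi_ge0// divr_ge0 ?(ltW b0)//.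
by rewrite addr_ge0 ?sqr_ge0.
Qed.

Let std (x : R) : R := pi^-1 * (1 + x ^+ 2)^-1.

Let std_continuous : continuous std.
Proof.
move=> x; apply: cvgM; first exact: cvg_cst.
apply: cvgV; first by rewrite gt_eqF// ltr_pwDl ?sqr_ge0.
by apply: cvgD; [exact: cvg_cst|exact: exprn_continuous].
Qed.

Let std_ge0 x : 0 <= std x.
Proof. by rewrite mulr_ge0 ?invr_ge0 ?pi_ge0// addr_ge0 ?sqr_ge0. Qed.

Let dstd (x : R) : is_derive x 1 (fun y => pi^-1 * atan y) (std x).
Proof. by apply: is_deriveZ. Qed.

Let integral_std : (\int[leb]_x (std x)%:E = 1)%E.
Proof.
rewrite ge0_symfun_integralT//; last by move=> x; rewrite /std/= sqrrN.
rewrite -set_itvcy.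
rewrite (@ge0_continuous_FTC2y _ _ (fun x => pi^-1 * atan x) _ (pi^-1 * (pi / 2))).
- rewrite atan0 mulr0 sube0 -EFinM; congr EFin.
  by rewrite mulKf ?gt_eqF ?pi_gt0// divff.
- by [].
- exact: continuous_subspaceT.
- by apply: cvgM; [exact: cvg_cst|exact: cvgy_atan].
- by move=> x _; case: (dstd x).
- apply: cvg_at_right_filter; apply: cvgM; first exact: cvg_cst.
  exact: continuous_atan.
- by move=> x _; rewrite derive1E; case: (dstd x).
Qed.

Let F (x : R^o) : R^o := b^-1 * (x - a).

Let dF (x : R) : is_derive (x : R^o) 1 F b^-1.
Proof.
have h : is_derive (x : R^o) 1 (fun y : R^o => y - a) 1.
  by apply: is_derive_eq; rewrite oppr0 addr0.
have := is_deriveZ b^-1 h; rewrite /GRing.scale/= mulr1.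
exact.
Qed.

Let F'E : F^`()%classic = cst b^-1.
Proof. by apply/funext => x; rewrite derive1E; case: (dF x). Qed.

Let integral_pdf : 0 < b ->
  (\int[leb]_x (cauchy_pdf a b x)%:E = 1)%E.
Proof.
move=> b0; have b'0 : 0 < b^-1 by rewrite invr_gt0.
have bn0 : b != 0 by rewrite gt_eqF.
rewrite -[RHS]integral_std.
rewrite [RHS](@increasing_ge0_integration_by_substitutionT _ F std)//.
- apply: eq_integral => x _; congr EFin.
  rewrite F'E fctE /cauchy_pdf /std /F /= -mulrA; congr *%R.
  have h : (x - a) ^+ 2 + b ^+ 2 != 0.
    by rewrite gt_eqF// ltr_wpDl ?sqr_ge0// exprn_gt0.
  have -> : 1 + (b^-1 * (x - a)) ^+ 2 = ((x - a) ^+ 2 + b ^+ 2) / b ^+ 2.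
    by rewrite mulrDl divff ?expf_neq0// exprMn exprVn addrC [_ ^- 2 * _]mulrC.
  by rewrite invf_div expr2 -!mulrA; congr *%R; rewrite mulrCA divff// mulr1.
- by move=> x y xy; rewrite /F ltr_pM2l// ltrD2r.
- by rewrite F'E => ?; exact: cvg_cst.
- by rewrite F'E; exact: is_cvg_cst.
- by rewrite F'E; exact: is_cvg_cst.
- by apply: gt0_cvgMrNy => //; exact: cvg_addrr_Ny.
- by apply: gt0_cvgMry => //; exact: cvg_addrr.
Qed.

Let measurable_pdf : 0 < b -> measurable_fun [set: R] (cauchy_pdf a b).
Proof.
move=> b0.
apply: continuous_measurable_fun => x.
apply: cvgM; first exact: cvg_cst.
apply: cvgM; first exact: cvg_cst.
apply: cvgV.
  by rewrite gt_eqF// ltr_wpDl ?sqr_ge0// exprn_gt0.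
apply: cvgD; last exact: cvg_cst.
apply: (cvg_comp (fun z : R => z - a) (fun z => z ^+ 2)).
  by apply: cvgB; [exact: cvg_id|exact: cvg_cst].
exact: exprn_continuous.
Qed.

Let cauchy0 : cauchy_prob a b set0 = 0%E.
Proof. by rewrite /cauchy_prob; case: ifP => _; rewrite ?integral_set0 ?measure0. Qed.

Let cauchy_ge0 A : (0 <= cauchy_prob a b A)%E.
Proof.
rewrite /cauchy_prob; case: ifP => b0; last exact: measure_ge0.
by apply: integral_ge0 => x _; rewrite lee_fin pdf_ge0.
Qed.

Let cauchy_sigma_additive : semi_sigma_additive (cauchy_prob a b).
Proof.
rewrite /cauchy_prob; case: ifP => b0; last exact: measure_semi_sigma_additive.
move=> /= A mA tA mUA.
rewrite ge0_integral_bigcup//=.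
- apply: is_cvg_ereal_nneg_natsum_cond => n _ _.
  by apply: integral_ge0 => /= x ?; rewrite lee_fin pdf_ge0.
- by apply/measurable_EFinP; apply: measurable_funTS; exact: measurable_pdf.
- by move=> x _; rewrite lee_fin pdf_ge0.
Qed.

HB.instance Definition _ := isMeasure.Build _ _ _
  (cauchy_prob a b) cauchy0 cauchy_ge0 cauchy_sigma_additive.

Let cauchy_setT : cauchy_prob a b [set: _] = 1%E.
Proof.
rewrite /cauchy_prob; case: ifP => b0; first exact: integral_pdf.
exact: probability_setT.
Qed.

HB.instance Definition _ :=
  @Measure_isProbability.Build _ _ R (cauchy_prob a b) cauchy_setT.

End instance.
End cauchy.

Section dilation_convolution.
Context {R : realType}.
Local Notation B := (measurableTypeR R).
Implicit Types mu nu : borel_probability R.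

Definition scale (c : R) (x : B) : B := c * (x : R).

Let measurable_scale c : measurable_fun setT (scale c).
Proof. exact: (@mulrl_measurable R setT c). Qed.

HB.instance Definition _ c := isMeasurableFun.Build _ _ _ _ (scale c)
  (measurable_scale c).

Definition dilation (c : R) mu : borel_probability R :=
  distribution mu (scale c).

Definition add_pair (p : B * B) : B := (p.1 : R) + (p.2 : R).

Let measurable_add_pair : measurable_fun setT add_pair.
Proof. exact: (@measurable_funD _ _ R setT fst snd). Qed.

HB.instance Definition _ := isMeasurableFun.Build _ _ _ _ add_pair
  measurable_add_pair.

Definition product_prob mu nu : set (B * B) -> \bar R := (mu \x nu)%E.

HB.instance Definition _ mu nu := Measure.on (product_prob mu nu).

Let product_prob_setT mu nu : product_prob mu nu setT = 1%E.
Proof.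
rewrite /product_prob -setXTT [LHS]product_measure1E//.
by rewrite -[RHS]mule1; congr (_ * _)%E; exact: probability_setT.
Qed.

HB.instance Definition _ mu nu := Measure_isProbability.Build _ _ _
  (product_prob mu nu) (product_prob_setT mu nu).

Definition convolution mu nu : borel_probability R :=
  distribution (product_prob mu nu) add_pair.

(* The N-fold convolution power for 0 < N. *)
Definition tensor_power mu (N : nat) : borel_probability R :=
  iter N.-1 (fun rho => convolution rho mu) mu.

(* For a convolution given as the graph of an operation, conv_power conv mu N
   rho means that rho is the N-fold convolution power of mu. *)
Inductive conv_power
    (conv : borel_probability R -> borel_probability R ->
            borel_probability R -> Prop) mu : nat -> borel_probability R -> Prop :=
| conv_power1 : conv_power conv mu 1 mu
| conv_powerS N rho rho' : conv_power conv mu N rho -> conv rho mu rho' ->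
    conv_power conv mu N.+1 rho'.

End dilation_convolution.

Section transforms.
Context {R : realType}.
Implicit Types mu nu rho : borel_probability R.

Definition lower_half_plane : set R[i] := [set z | complex.Im z < 0].

Definition Gtransform mu (z : R[i]) : R[i] :=
  Cintegral mu setT (fun x => (z - (x : R)%:C)^-1).

Definition Ftransform mu (z : R[i]) : R[i] := (Gtransform mu z)^-1.

Definition boolean_conv mu nu rho : Prop :=
  forall z, lower_half_plane z ->
    Ftransform rho z = Ftransform mu z + Ftransform nu z - z.

Definition boolean_power mu N rho := conv_power boolean_conv mu N rho.

Definition Gamma (alpha beta : R) : set R[i] :=
  [set z | [/\ complex.Im z < 0,
               `|complex.Re z| < alpha * `|complex.Im z| &
               complex.Im z < - beta]].

Definition nontangential_domain (Omega : set R[i]) : Prop :=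
  exists beta : R -> R, (forall alpha, 0 < alpha -> 0 < beta alpha) /\
    Omega = \bigcup_(alpha in [set alpha | 0 < alpha]) Gamma alpha (beta alpha).

(* The last condition is H z / z --> 1 as z --> oo non-tangentially. It makes
   H z unique for z in any cone |Re z| < alpha |Im z| with |z| large. *)
Definition right_inverse_F mu (Omega : set R[i]) (H : R[i] -> R[i]) : Prop :=
  [/\ forall z, Omega z -> lower_half_plane (H z),
      forall z, Omega z -> Ftransform mu (H z) = z &
      forall alpha eps : R, 0 < alpha -> 0 < eps -> exists M : R,
        forall z, Omega z -> `|complex.Re z| < alpha * `|complex.Im z| ->
          M%:C < `|z| -> `|H z / z - 1| < eps%:C].

(* The domains are existentially quantified because on too large an
   intersection H1 z + H2 z - z may leave the lower half-plane. *)
Definition free_conv mu nu rho : Prop :=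
  exists Omega1 Omega2 H1 H2,
    [/\ nontangential_domain Omega1 /\ nontangential_domain Omega2,
        right_inverse_F mu Omega1 H1,
        right_inverse_F nu Omega2 H2 &
        right_inverse_F rho (Omega1 `&` Omega2) (fun z => H1 z + H2 z - z)].

Definition free_power mu N rho := conv_power free_conv mu N rho.

Definition weak_cvg (mu_ : nat -> borel_probability R) mu : Prop :=
  forall f : R -> R, continuous f -> (exists M, forall x, `|f x| <= M) ->
    (fun N => \int[mu_ N]_x f x) @ \oo --> \int[mu]_x f x.

End transforms.

(* Main.v *)
(* By Poisson smoothing, weak convergence to the Cauchy distribution mu_{a,b} follows
   from the pointwise convergence G_N(z) -> 1/(z - m1) of Stieltjes transforms on the
   open lower half-plane, because Im m1 >= 0. The class P2 enters only through the
   expansion v^2 G_mu(v) - v - m1 -> 0, uniform as Im v -> -oo: the finite-variance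
   part is elementary, and on the density p the term a_2/x^2 yields the principal
   value i pi a_2. Since G of the dilation at z is N G_mu(N z), the dilated measure has
   G = 1/z + m1/(N z^2) + o(1/N) and F = z - m1/N + o(1/N), uniformly for Im z <= -K.
   Boolean powers: F_N(z) - z is the N-fold sum. Tensor powers: the resolvents are
   averaged factor by factor, each step replacing z by z - m1/N with error o(1/N). Free
   powers: G_N(N w - (N-1) F(w)) = G(w) holds far out in a sector, extends to a
   half-plane by an identity theorem, and gives G_N(z) close to 1/(z - m1) when Im z is
   very negative; uniform boundedness then carries the limit to all of Im z < 0. *)
Require Import Defs.
From HB Require Import structures.
From mathcomp Require Import all_boot all_order all_algebra.
From mathcomp Require Import all_classical all_reals all_analysis.
From mathcomp Require Import measurable_realfun complex cyclic separable cyclotomic.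
From mathcomp Require Import ring lra zify.
Set Implicit Arguments.
Unset Strict Implicit.
Unset Printing Implicit Defensive.
Import Order.TTheory GRing.Theory Num.Theory.
Import numFieldTopology.Exports numFieldNormedType.Exports.

Local Open Scope classical_set_scope.
Local Open Scope ring_scope.
Local Open Scope complex_scope.

(** Two obstacles shape the proof. If a_2 > 0, the density p decays only like x^-2 and [mu] has no
    mean; the term a_2 x^-2 is therefore split off, and for it the kernels x^-1 and (v - x)^-1 are
    kept together. What remains of p decays like x^-3 and has a genuine first moment. Non-negativity
    of p forces a_2 >= 0, hence Im m1 = pi a_2 >= 0, and this sign keeps every z - m1 in the lower
    half-plane, at least as far from the real line as z. The second obstacle is that free powers
    call for an identity theorem and a Vitali-type extension. Holomorphy enters only as uniform
    approximability by polynomials on discs: a Stieltjes transform has it through the finite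
    geometric series of the resolvent, and the class is stable under products, compositions and
    inverses away from 0. Averages over roots of unity take the place of Cauchy's formula. Tightness
    is no separate step: the mass of mu_N far out is read off G_N at a point - i Y. The degenerate
    limit b = 0 shares the argument with b > 0, since in both cases smoothing by width y produces
    the Cauchy density of width b + y. *)

Local Notation cabs := (@ComplexField.Normc.normc _).
Local Notation Re := (@complex.Re _).
Local Notation Im := (@complex.Im _).

(** * Modulus on R[i] and uniform limits of polynomials on discs *)

Section complex_modulus.
Context {R : realType}.
Implicit Types (z w : R[i]) (r : R).

Lemma cabs_norm z : (cabs z)%:C = `|z|.
Proof. by []. Qed.

Lemma cabs_ge0 z : 0 <= cabs z.
Proof. by rewrite -ler0c cabs_norm. Qed.

Lemma cabs0 : cabs (0 : R[i]) = 0.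
Proof. exact: ComplexField.Normc.normc0. Qed.

Lemma cabs1 : cabs (1 : R[i]) = 1.
Proof. exact: ComplexField.Normc.normc1. Qed.

Lemma cabs_eq0 z : (cabs z == 0) = (z == 0).
Proof.
by apply/eqP/eqP => [/ComplexField.Normc.eq0_normc//|->]; exact: cabs0.
Qed.

Lemma cabs_gt0 z : (0 < cabs z) = (z != 0).
Proof. by rewrite lt_def cabs_ge0 andbT cabs_eq0. Qed.

Lemma cabsM z w : cabs (z * w) = cabs z * cabs w.
Proof. exact: ComplexField.Normc.normcM. Qed.

Lemma cabsV z : cabs z^-1 = (cabs z)^-1.
Proof. exact: ComplexField.Normc.normcV. Qed.

Lemma cabsX z n : cabs (z ^+ n) = cabs z ^+ n.
Proof. by elim: n => [|n ih]; rewrite ?expr0 ?cabs1// !exprS cabsM ih. Qed.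

Lemma cabsN z : cabs (- z) = cabs z.
Proof. exact: normcN. Qed.

Lemma cabsD z w : cabs (z + w) <= cabs z + cabs w.
Proof. exact: le_normcD. Qed.

Lemma cabsB z w : cabs (z - w) <= cabs z + cabs w.
Proof. by rewrite -(cabsN w); exact: cabsD. Qed.

Lemma cabs_distC z w : cabs (z - w) = cabs (w - z).
Proof. by rewrite -cabsN opprB. Qed.

Lemma cabs_lerB z w : cabs z - cabs w <= cabs (z - w).
Proof. by rewrite lerBlDr -{1}(subrK w z) cabsD. Qed.

Lemma cabs_sum (I : Type) (s : seq I) (P : pred I) (F : I -> R[i]) :
  cabs (\sum_(i <- s | P i) F i) <= \sum_(i <- s | P i) cabs (F i).
Proof.
elim/big_ind2: _ => [|x y z w xy zw|//]; first by rewrite cabs0.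
by apply: le_trans (cabsD _ _) _; exact: lerD.
Qed.

Lemma cabsR r : cabs r%:C = `|r|.
Proof. by rewrite /= expr0n addr0 sqrtr_sqr. Qed.

Lemma cabs_Re z : `|Re z| <= cabs z.
Proof. by rewrite -lecR cabs_norm normc_ge_Re. Qed.

Lemma cabs_Im z : `|Im z| <= cabs z.
Proof.
by case: z => a b /=; rewrite -sqrtr_sqr ler_wsqrtr// lerDr sqr_ge0.
Qed.

Lemma cabs_ReIm z : cabs z <= `|Re z| + `|Im z|.
Proof.
case: z => a b; rewrite -[leRHS]ger0_norm ?addr_ge0//= -sqrtr_sqr ler_wsqrtr//.
by rewrite sqrrD !real_normK ?num_real// lerD2r lerDl mulrn_wge0// mulr_ge0.
Qed.

Lemma sqr_cabs z : cabs z ^+ 2 = Re z ^+ 2 + Im z ^+ 2.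
Proof. by case: z => a b /=; rewrite sqr_sqrtr// addr_ge0 ?sqr_ge0. Qed.

Lemma cReD z w : Re (z + w) = Re z + Re w. Proof. by case: z; case: w. Qed.
Lemma cImD z w : Im (z + w) = Im z + Im w. Proof. by case: z; case: w. Qed.
Lemma cReN z : Re (- z) = - Re z. Proof. by case: z. Qed.
Lemma cImN z : Im (- z) = - Im z. Proof. by case: z. Qed.
Lemma cReM z w : Re (z * w) = Re z * Re w - Im z * Im w.
Proof. by case: z; case: w. Qed.
Lemma cImM z w : Im (z * w) = Re z * Im w + Im z * Re w.
Proof. by case: z => a b; case: w => c d. Qed.
Lemma cReV z : Re z^-1 = Re z / (Re z ^+ 2 + Im z ^+ 2).
Proof. by case: z. Qed.
Lemma cImV z : Im z^-1 = - (Im z / (Re z ^+ 2 + Im z ^+ 2)).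
Proof. by case: z. Qed.

Lemma complex_eqP z w : Re z = Re w -> Im z = Im w -> z = w.
Proof. by case: z => a b; case: w => c d /= -> ->. Qed.

Lemma Im_lt0_neq0 z : Im z < 0 -> z != 0.
Proof. by apply: contraTneq => ->; rewrite ltxx. Qed.

End complex_modulus.

Section disc_polynomials.
Context {R : realType}.
Local Notation C := R[i].
Implicit Types (p : {poly C}) (c : C) (r e : R) (f g h : C -> C).

(** In characteristic zero X^n - 1 is separable, so it splits into n distinct linear factors, and n
    distinct n-th roots of unity include a primitive one. *)
Lemma closed_prim_root (F : numClosedFieldType) n :
  (0 < n)%N -> exists w : F, n.-primitive_root w.
Proof.
move=> n0; have [s] := closed_field_poly_normal ('X^n - 1 : {poly F}).
rewrite (monicP (monicXnsubC 1 n0)) scale1r => sE.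
have us : uniq s.
  by rewrite -separable_prod_XsubC -sE separable_Xn_sub_1// pnatr_eq0 -lt0n.
have ss : size s = n.
  by apply: succn_inj; rewrite -(size_prod_XsubC s id) -sE size_XnsubC.
have /hasP[w _ wn] : has n.-primitive_root s.
  apply: has_prim_root; rewrite ?ss//.
  by apply/allP => w; rewrite -root_prod_XsubC -sE.
by exists w.
Qed.

Lemma cabs_unity_root n (w : C) : (0 < n)%N -> w ^+ n = 1 -> cabs w = 1.
Proof.
move=> n0 /(congr1 cabs); rewrite cabsX cabs1 => /eqP.
by rewrite pexpr_eq1 ?cabs_ge0// => /eqP.
Qed.

(* Averaging p(r w^j) w^(-jk) over the n-th roots of unity w^j isolates the
   coefficient of degree k. *)
Lemma coef_disc_bound p r e k : 0 <= r ->
  (forall s, cabs s <= r -> cabs p.[s] <= e) -> cabs p`_k * r ^+ k <= e.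
Proof.
move=> r0 pe.
have e0 : 0 <= e by apply: le_trans (pe 0 _); rewrite ?cabs_ge0 ?cabs0.
have [kp|kp] := ltnP k (size p); last by rewrite nth_default// cabs0 mul0r.
set n := size p in kp.
have n0 : (0 < n)%N by exact: leq_ltn_trans kp.
have [w prim_w] := closed_prim_root C n0.
have wn : w ^+ n = 1 := prim_expr_order prim_w.
have sumE : \sum_(j < n) p.[r%:C * w ^+ j] * w ^+ (j * (n - k)) =
    n%:R * (p`_k * r%:C ^+ k).
  under eq_bigr do rewrite horner_coef mulr_suml.
  rewrite exchange_big/= (bigD1 (Ordinal kp))//= [X in _ + X]big1 ?addr0.
    rewrite -[n in n%:R]card_ord -sumr_const mulr_suml.
    apply: eq_bigr => j _; rewrite mul1r exprMn -!mulrA -exprM -exprD -mulnDr.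
    by rewrite subnKC ?(ltnW kp)// mulnC exprM wn expr1n mulr1.
  move=> i ik.
  transitivity (\sum_(j < n) p`_i * r%:C ^+ i * (w ^+ (i + (n - k))) ^+ j).
    apply: eq_bigr => j _; rewrite exprMn -!mulrA; congr (_ * (_ * _)).
    by rewrite -!exprM -exprD [(_ * j)%N]mulnC -mulnDr.
  rewrite -mulr_sumr; apply/eqP; rewrite mulf_eq0; apply/orP; right.
  set x := w ^+ _.
  (* The exponent i + (n - k) lies strictly between 0 and 2 n, so n divides it only when i = k;
     otherwise the geometric sum of the powers of x vanishes. *)
  have x1 : x != 1.
    rewrite /x -(prim_order_dvd prim_w) addnBA ?(ltnW kp)//.
    apply: contra ik => /dvdnP[q qE]; apply/eqP/val_inj => /=.
    have i_lt := ltn_ord i.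
    have : (q == 1)%N.
      case: q qE => [|[|q]]//; lia.
    by move=> /eqP q1; rewrite q1 in qE; lia.
  have : x ^+ n - 1 = 0 by rewrite /x exprAC wn expr1n subrr.
  by rewrite subrX1 => /eqP; rewrite mulf_eq0 subr_eq0 (negbTE x1).
have : cabs (n%:R * (p`_k * r%:C ^+ k)) <= n%:R * e.
  rewrite -sumE; apply: le_trans (cabs_sum _ _ _) _.
  rewrite -[n in leRHS]card_ord -sumr_const mulr_suml; apply: ler_sum => j _.
  have w1 := cabs_unity_root n0 wn.
  rewrite mul1r cabsM cabsX w1 expr1n mulr1 pe//.
  by rewrite cabsM cabsX w1 expr1n mulr1 cabsR ger0_norm.
have -> : n%:R = (n%:R : R)%:C by rewrite rmorph_nat.
rewrite !cabsM cabsX !cabsR (ger0_norm r0) ger0_norm// ler_pM2l//.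
by rewrite ltr0n.
Qed.

(* Stands in for holomorphy on the disc: it gives the identity theorem through the
   coefficient bounds above, without any complex analysis. *)
Definition poly_approx z0 r f := forall e, 0 < e ->
  exists p, forall s, cabs (s - z0) <= r -> cabs (f s - p.[s]) <= e.

Lemma poly_approx_ext z0 r f g :
  (forall s, cabs (s - z0) <= r -> f s = g s) ->
  poly_approx z0 r f -> poly_approx z0 r g.
Proof.
by move=> fg fP e /fP[p pP]; exists p => s sr; rewrite -fg// pP.
Qed.

Lemma poly_approx_horner z0 r p : poly_approx z0 r (horner p).
Proof. by move=> e e0; exists p => s _; rewrite subrr cabs0 ltW. Qed.

Lemma poly_approx_cst z0 r c : poly_approx z0 r (fun=> c).
Proof.
apply: poly_approx_ext (poly_approx_horner z0 r c%:P) => s _.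
by rewrite hornerC.
Qed.

Lemma poly_approx_id z0 r : poly_approx z0 r id.
Proof.
by apply: poly_approx_ext (poly_approx_horner z0 r 'X) => s _; rewrite hornerX.
Qed.

Lemma poly_approx_closed z0 r f :
  (forall e, 0 < e -> exists g, poly_approx z0 r g /\
    forall s, cabs (s - z0) <= r -> cabs (f s - g s) <= e) ->
  poly_approx z0 r f.
Proof.
move=> H e e0; have e20 : 0 < e / 2 by rewrite divr_gt0.
have [g [gP fg]] := H _ e20; have [p pP] := gP _ e20; exists p => s sr.
rewrite -(subrK (g s) (f s)) -addrA (splitr e).
by apply: le_trans (cabsD _ _) _; rewrite lerD ?fg ?pP.
Qed.

Lemma horner_bounded z0 r p :
  exists M, forall s, cabs (s - z0) <= r -> cabs p.[s] <= M.
Proof.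
exists (\sum_(i < size p) cabs p`_i * (r + cabs z0) ^+ i) => s sr.
rewrite horner_coef; apply: le_trans (cabs_sum _ _ _) _.
apply: ler_sum => i _; rewrite cabsM cabsX ler_wpM2l ?cabs_ge0//.
rewrite lerXn2r ?nnegrE ?cabs_ge0//.
  by rewrite addr_ge0 ?cabs_ge0// (le_trans _ sr) ?cabs_ge0.
by rewrite -{1}(subrK z0 s); apply: le_trans (cabsD _ _) _; rewrite lerD2r.
Qed.

Lemma poly_approx_bounded z0 r f : poly_approx z0 r f ->
  exists2 M, 0 < M & forall s, cabs (s - z0) <= r -> cabs (f s) <= M.
Proof.
move=> /(_ 1 ltr01)[p pP]; have [M MP] := horner_bounded z0 r p.
exists (1 + `|M|) => [|s sr]; first by rewrite ltr_pwDl.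
rewrite -(subrK p.[s] (f s)); apply: le_trans (cabsD _ _) _.
by rewrite lerD ?pP// (le_trans (MP _ sr)) ?ler_norm.
Qed.

Lemma poly_approxD z0 r f g : poly_approx z0 r f -> poly_approx z0 r g ->
  poly_approx z0 r (fun s => f s + g s).
Proof.
move=> fP gP e e0; have e20 : 0 < e / 2 by rewrite divr_gt0.
have [p pP] := fP _ e20; have [q qP] := gP _ e20.
exists (p + q) => s sr; rewrite hornerD opprD addrACA (splitr e).
by apply: le_trans (cabsD _ _) _; rewrite lerD ?pP ?qP.
Qed.

Lemma poly_approxM z0 r f g : poly_approx z0 r f -> poly_approx z0 r g ->
  poly_approx z0 r (fun s => f s * g s).
Proof.
move=> fP gP e e0.
have [M M0 fM] := poly_approx_bounded fP.
(* [q] is chosen before [p], because the precision asked of [p] depends on the bound of [q]. *)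
have [q qP] := gP (e / 2 / M) ltac:(by rewrite !divr_gt0).
have [N N0 gN] := poly_approx_bounded (poly_approx_horner z0 r q).
have [p pP] := fP (e / 2 / N) ltac:(by rewrite !divr_gt0).
exists (p * q) => s sr; rewrite hornerM.
have -> : f s * g s - p.[s] * q.[s] =
    f s * (g s - q.[s]) + (f s - p.[s]) * q.[s] by ring.
apply: le_trans (cabsD _ _) _; rewrite !cabsM (splitr e) lerD//.
  rewrite -[leRHS](divfK (lt0r_neq0 M0)) mulrC.
  by rewrite ler_pM ?cabs_ge0 ?qP ?fM.
rewrite -[leRHS](divfK (lt0r_neq0 N0)).
by rewrite ler_pM ?cabs_ge0 ?pP ?gN.
Qed.

Lemma poly_approxN z0 r f : poly_approx z0 r f ->
  poly_approx z0 r (fun s => - f s).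
Proof.
move=> fP; apply: poly_approx_ext (poly_approxM (poly_approx_cst z0 r (-1)) fP).
by move=> s _; rewrite mulN1r.
Qed.

Lemma poly_approxB z0 r f g : poly_approx z0 r f -> poly_approx z0 r g ->
  poly_approx z0 r (fun s => f s - g s).
Proof. by move=> fP /poly_approxN; exact: poly_approxD. Qed.

Lemma poly_approx_sum z0 r n (F : nat -> C -> C) :
  (forall i, poly_approx z0 r (F i)) ->
  poly_approx z0 r (fun s => \sum_(i < n) F i s).
Proof.
move=> FP; elim: n => [|n ih].
  apply: poly_approx_ext (poly_approx_cst z0 r 0) => s _.
  by rewrite big_ord0.
apply: poly_approx_ext (poly_approxD ih (FP n)) => s _.
by rewrite big_ord_recr.
Qed.

Lemma poly_approxX z0 r f n : poly_approx z0 r f ->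
  poly_approx z0 r (fun s => f s ^+ n).
Proof.
move=> fP; elim: n => [|n ih].
  by apply: poly_approx_ext (poly_approx_cst z0 r 1) => s _; rewrite expr0.
apply: poly_approx_ext (poly_approxM fP ih) => s _.
by rewrite exprS.
Qed.

(** A polynomial in f is a finite combination of powers of f, hence approximable; h is within e of
    such a polynomial on the disc about c that receives the values of f. *)
Lemma poly_approx_comp z0 c r r' f h : poly_approx z0 r f ->
  (forall s, cabs (s - z0) <= r -> cabs (f s - c) <= r') ->
  poly_approx c r' h -> poly_approx z0 r (fun s => h (f s)).
Proof.
move=> fP fc hP; apply: poly_approx_closed => e /hP[q qP].
exists (fun s => q.[f s]); split; last by move=> s sr; rewrite qP ?fc.
apply: (@poly_approx_ext _ _
  (fun s => \sum_(i < size q) q`_i * f s ^+ i)).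
  by move=> s _; rewrite horner_coef.
apply: (@poly_approx_sum _ _ _ (fun i s => q`_i * f s ^+ i)) => i.
apply: poly_approxM; first exact: poly_approx_cst.
exact: poly_approxX.
Qed.

Lemma geometric_lt (M t e : R) : 0 <= t < 1 -> 0 < e ->
  exists n, M * t ^+ n <= e.
Proof.
move=> /andP[t0 t1] e0.
have : (fun n => M * t ^+ n) @ \oo --> (0 : R).
  rewrite -(mulr0 M); apply: cvgM; first exact: cvg_cst.
  by apply: cvg_expr; rewrite ger0_norm.
move=> /cvgrPdist_le/(_ _ e0)[n _ /(_ n (leqnn n))].
by rewrite /= sub0r normrN => H; exists n; apply: le_trans H; exact: ler_norm.
Qed.

(** The geometric series of 1 / (c - (c - s)) cut after n terms, with its exact remainder: no
    convergence has to be discussed, and the main part is a polynomial in s. *)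
Lemma inv_expand (c s : C) n : c != 0 -> s != 0 ->
  s^-1 = \sum_(k < n) (c^-1) ^+ k.+1 * (c - s) ^+ k + (c^-1 * (c - s)) ^+ n / s.
Proof.
move=> c0 s0; elim: n => [|n ih]; first by rewrite big_ord0 expr0 mul1r add0r.
rewrite {1}ih big_ord_recr/= -addrA; congr (_ + _).
rewrite !exprMn !exprSr -!mulrA; set a := c^-1 ^+ n; set b := (c - s) ^+ n.
field.
by rewrite c0 s0.
Qed.

(* A function that is small on the inner disc has small low-order coefficients; the
   bound M on the outer disc makes the remaining ones geometrically small. *)
Lemma small_disc (M rho r' r eta : R) : 0 < rho -> rho <= r' -> r' < r ->
  0 < eta -> exists2 e, 0 < e & forall z0 f, poly_approx z0 r f ->
    (forall s, cabs (s - z0) <= r -> cabs (f s) <= M) ->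
    (forall s, cabs (s - z0) <= rho -> cabs (f s) <= e) ->
  forall s, cabs (s - z0) <= r' -> cabs (f s) <= eta.
Proof.
move=> rho0 rhor' r'r eta0.
have r'0 : 0 < r' by exact: lt_le_trans rhor'.
have r0 : 0 < r by exact: lt_trans r'r.
pose t := r' / r.
have t0 : 0 <= t by rewrite divr_ge0 // ltW.
have t1 : t < 1 by rewrite ltr_pdivrMr ?mul1r.
have [n nP] := @geometric_lt ((M + 1) / (1 - t)) t (eta / 3)
  ltac:(by rewrite t0 t1) ltac:(by rewrite divr_gt0).
pose A := 1 + \sum_(k < n) (r' / rho) ^+ k.
have A0 : 0 < A.
  rewrite /A ltr_pwDl// sumr_ge0// => i _.
  by rewrite exprn_ge0// divr_ge0 ?ltW.
(* The entry 1 bounds the approximating polynomial by M + 1 on the outer disc; the other one leaves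
   eta / 3 for the n low-order terms, each at most 2 e (r' / rho)^k. *)
exists (Num.min 1 (eta / 6 / A)).
  by rewrite lt_min ltr01/= !divr_gt0.
move=> z0 f fP fM fe s sr'.
set e := Num.min _ _ in fe.
have e0 : 0 < e by rewrite lt_min ltr01/= !divr_gt0.
have e1 : e <= 1 by rewrite ge_min lexx.
have eA : e * A <= eta / 6.
  by rewrite -ler_pdivlMr// ge_min lexx orbT.
have [p pP] := fP _ e0.
pose q := p \Po ('X + z0%:P).
have qE u : q.[u] = p.[u + z0] by rewrite horner_comp !hornerE.
have qM k : cabs q`_k * r ^+ k <= M + 1.
  apply: coef_disc_bound (ltW r0) _ => u ur; rewrite qE.
  have uE : cabs (u + z0 - z0) <= r by rewrite addrK.
  rewrite -[p.[_]](subrK (f (u + z0))); apply: le_trans (cabsD _ _) _.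
  by rewrite addrC lerD ?fM// cabs_distC (le_trans (pP _ uE)).
have qe k : cabs q`_k * rho ^+ k <= 2 * e.
  apply: coef_disc_bound (ltW rho0) _ => u ur; rewrite qE.
  have uE : cabs (u + z0 - z0) <= rho by rewrite addrK.
  have uE' : cabs (u + z0 - z0) <= r.
    by apply: le_trans uE _; apply: le_trans rhor' (ltW r'r).
  rewrite -[p.[_]](subrK (f (u + z0))); apply: le_trans (cabsD _ _) _.
  by rewrite mulr_natl mulr2n lerD ?fe// cabs_distC pP.
have fs : cabs (f s) <= e + cabs q.[s - z0].
  rewrite qE subrK -{1}[f s](subrK p.[s]); apply: le_trans (cabsD _ _) _.
  by rewrite lerD2r pP// (le_trans sr')// ltW.
apply: le_trans fs _.
have qs : cabs q.[s - z0] <= \sum_(k < size q) cabs q`_k * r' ^+ k.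
  rewrite horner_coef; apply: le_trans (cabs_sum _ _ _) _.
  apply: ler_sum => i _; rewrite cabsM cabsX ler_wpM2l ?cabs_ge0//.
  by rewrite lerXn2r ?nnegrE ?cabs_ge0// ltW.
have low k : cabs q`_k * r' ^+ k <= 2 * e * (r' / rho) ^+ k.
  have -> : cabs q`_k * r' ^+ k = cabs q`_k * rho ^+ k * (r' / rho) ^+ k.
    by rewrite -mulrA -exprMn mulrCA divff ?mulr1// gt_eqF.
  by rewrite ler_wpM2r// exprn_ge0// divr_ge0// ltW.
have high k : cabs q`_k * r' ^+ k <= (M + 1) * t ^+ k.
  have -> : cabs q`_k * r' ^+ k = cabs q`_k * r ^+ k * t ^+ k.
    by rewrite -mulrA -exprMn mulrCA divff ?mulr1// gt_eqF.
  by rewrite ler_wpM2r// exprn_ge0.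
have M1 : 0 <= M + 1.
  by apply: le_trans (qM 0%N); rewrite mulr_ge0 ?cabs_ge0 ?exprn_ge0// ltW.
have bound N : \sum_(k < n + N) cabs q`_k * r' ^+ k <= eta / 3 + eta / 3.
  rewrite big_split_ord/= lerD//.
    apply: (@le_trans _ _ (\sum_(k < n) 2 * e * (r' / rho) ^+ k)).
      by apply: ler_sum => i _; exact: low.
    rewrite -mulr_sumr.
    have AA : \sum_(k < n) (r' / rho) ^+ k <= A by rewrite lerDr.
    have : 2 * (e * \sum_(k < n) (r' / rho) ^+ k) <= 2 * (eta / 6).
      by rewrite ler_pM2l// (le_trans _ eA)// ler_wpM2l// ltW.
    by rewrite mulrA => /le_trans; apply; lra.
  apply: le_trans nP.
  apply: (@le_trans _ _ (\sum_(k < N) (M + 1) * t ^+ n * t ^+ k)).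
    by apply: ler_sum => i _; rewrite -mulrA -exprD; exact: high.
  rewrite -mulr_sumr [leRHS]mulrAC ler_pdivlMr ?subr_gt0//.
  have S1 : (\sum_(k < N) t ^+ k) * (1 - t) <= 1.
    have -> : (\sum_(k < N) t ^+ k) * (1 - t) = 1 - t ^+ N.
      by rewrite -[1 - t]opprB mulrN mulrC -subrX1 opprB.
    by rewrite gerDl oppr_le0 exprn_ge0.
  by rewrite -[leLHS]mulrA ler_piMr ?mulr_ge0 ?exprn_ge0.
have : cabs q.[s - z0] <= eta / 3 + eta / 3.
  apply: le_trans qs _; apply: le_trans (bound (size q)).
  rewrite [(n + _)%N]addnC big_split_ord/= lerDl sumr_ge0// => i _.
  by rewrite mulr_ge0 ?cabs_ge0 ?exprn_ge0// ltW.
have : e <= eta / 6.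
  apply: le_trans eA; rewrite ler_peMr ?(ltW e0)// /A lerDl sumr_ge0// => i _.
  by rewrite exprn_ge0// divr_ge0 ?ltW.
lra.
Qed.

End disc_polynomials.

(** * Complex-valued integrals and Stieltjes transforms *)

Section measurable_integrable.
Context d (T : measurableType d) (R : realType).
Implicit Types (D : set T) (f g : T -> R[i]) (h k : T -> R).

(** The inverse is written as h times the power -1 of h^2, a measurable function of a non-negative
    argument. At h = 0 both sides are 0, the inverse of 0 being 0. *)
Lemma measurable_funV D h : measurable D -> measurable_fun D h ->
  measurable_fun D (fun x => (h x)^-1).
Proof.
move=> mD mh.
have -> : (fun x => (h x)^-1) = (fun x => h x * (h x ^+ 2) `^ (-1)).
  apply/funext => x; rewrite powR_inv1 ?sqr_ge0//.
  have [->|h0] := eqVneq (h x) 0; first by rewrite invr0 mul0r.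
  by rewrite expr2 invfM mulrA divff ?mul1r.
apply: measurable_funM => //.
exact: (measurableT_comp (measurable_powR (-1)) (measurable_funX 2 mh)).
Qed.

Definition Cmeasurable D f :=
  measurable_fun D (Re \o f) /\ measurable_fun D (Im \o f).

Lemma Cmeasurable_cst D c : Cmeasurable D (fun=> c).
Proof. by split; exact: measurable_cst. Qed.

Lemma Cmeasurable_real D h : measurable_fun D h ->
  Cmeasurable D (fun x => (h x)%:C).
Proof. by split => //; exact: measurable_cst. Qed.

Lemma CmeasurableD D f g : Cmeasurable D f -> Cmeasurable D g ->
  Cmeasurable D (fun x => f x + g x).
Proof.
move=> [f1 f2] [g1 g2]; split.
  by rewrite (_ : _ \o _ = (fun x => Re (f x) + Re (g x)));
    [exact: measurable_funD|apply/funext => x /=; rewrite cReD].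
by rewrite (_ : _ \o _ = (fun x => Im (f x) + Im (g x)));
  [exact: measurable_funD|apply/funext => x /=; rewrite cImD].
Qed.

Lemma CmeasurableM D f g : measurable D -> Cmeasurable D f -> Cmeasurable D g ->
  Cmeasurable D (fun x => f x * g x).
Proof.
move=> mD [f1 f2] [g1 g2]; split.
  rewrite (_ : _ \o _ = (fun x => Re (f x) * Re (g x) - Im (f x) * Im (g x))).
    by apply: measurable_funB; exact: measurable_funM.
  by apply/funext => x /=; rewrite cReM.
rewrite (_ : _ \o _ = (fun x => Re (f x) * Im (g x) + Im (f x) * Re (g x))).
  by apply: measurable_funD; exact: measurable_funM.
by apply/funext => x /=; rewrite cImM.
Qed.

Lemma CmeasurableN D f : measurable D -> Cmeasurable D f ->
  Cmeasurable D (fun x => - f x).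
Proof.
move=> mD fm; rewrite (_ : (fun x => - f x) = (fun x => (-1) * f x)).
  by apply: CmeasurableM => //; exact: Cmeasurable_cst.
by apply/funext => x; rewrite mulN1r.
Qed.

Lemma CmeasurableB D f g : measurable D -> Cmeasurable D f -> Cmeasurable D g ->
  Cmeasurable D (fun x => f x - g x).
Proof.
by move=> mD fm gm; apply: CmeasurableD => //; exact: CmeasurableN.
Qed.

Lemma CmeasurableX D f n : measurable D -> Cmeasurable D f ->
  Cmeasurable D (fun x => f x ^+ n).
Proof.
move=> mD fm; elim: n => [|n ih].
  rewrite (_ : (fun _ => _) = (fun=> 1)); first exact: Cmeasurable_cst.
  by apply/funext => x; rewrite expr0.
rewrite (_ : (fun _ => _) = (fun x => f x * f x ^+ n)).
  exact: CmeasurableM.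
by apply/funext => x; rewrite exprS.
Qed.

Lemma CmeasurableV D f : measurable D -> Cmeasurable D f ->
  Cmeasurable D (fun x => (f x)^-1).
Proof.
move=> mD [f1 f2].
have mV : measurable_fun D (fun x => (Re (f x) ^+ 2 + Im (f x) ^+ 2)^-1).
  apply: measurable_funV => //.
  by apply: measurable_funD; exact: measurable_funX.
split.
  rewrite (_ : _ \o _ =
    (fun x => Re (f x) * (Re (f x) ^+ 2 + Im (f x) ^+ 2)^-1)).
    exact: measurable_funM.
  by apply/funext => x /=; rewrite cReV.
rewrite (_ : _ \o _ = \-
  (fun x => Im (f x) * (Re (f x) ^+ 2 + Im (f x) ^+ 2)^-1)).
  by apply: measurable_funN; exact: measurable_funM.
by apply/funext => x /=; rewrite cImV.
Qed.

Lemma Cmeasurable_cabs D f : measurable D -> Cmeasurable D f ->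
  measurable_fun D (fun x => cabs (f x)).
Proof.
move=> mD [f1 f2].
rewrite (_ : (fun _ => _) =
    (fun x => (Re (f x) ^+ 2 + Im (f x) ^+ 2) `^ (2^-1))).
  exact: (measurableT_comp (measurable_powR 2^-1)
    (measurable_funD (measurable_funX 2 f1) (measurable_funX 2 f2))).
apply/funext => x; rewrite -sqr_cabs powR12_sqrt ?sqr_ge0//.
by rewrite sqrtr_sqr ger0_norm ?cabs_ge0.
Qed.

Variable mu : {measure set T -> \bar R}.

Definition Cintegrable D f :=
  mu.-integrable D (EFin \o (Re \o f)) /\ mu.-integrable D (EFin \o (Im \o f)).

Lemma le_Rintegrable D h k : measurable D -> measurable_fun D h ->
  mu.-integrable D (EFin \o k) -> (forall x, D x -> `|h x| <= k x) ->
  mu.-integrable D (EFin \o h).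
Proof.
move=> mD mh ik hk; apply: le_integrable ik => //.
  exact/measurable_EFinP.
by move=> x Dx /=; rewrite lee_fin (le_trans (hk _ Dx))// ler_norm.
Qed.

Lemma RintegrableD D h k : measurable D -> mu.-integrable D (EFin \o h) ->
  mu.-integrable D (EFin \o k) ->
  mu.-integrable D (EFin \o (fun x => h x + k x)).
Proof. by move=> mD ih ik; exact: (integrableD mD ih ik). Qed.

Lemma RintegrableB D h k : measurable D -> mu.-integrable D (EFin \o h) ->
  mu.-integrable D (EFin \o k) ->
  mu.-integrable D (EFin \o (fun x => h x - k x)).
Proof. by move=> mD ih ik; exact: (integrableB mD ih ik). Qed.

Lemma RintegrableZl D (r : R) h : measurable D ->
  mu.-integrable D (EFin \o h) ->
  mu.-integrable D (EFin \o (fun x => r * h x)).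
Proof. by move=> mD ih; exact: (integrableZl mD r ih). Qed.

Lemma Rintegrable_norm D h : mu.-integrable D (EFin \o h) ->
  mu.-integrable D (EFin \o (fun x => `|h x|)).
Proof. exact: integrable_norm. Qed.

Lemma le_Cintegrable D f k : measurable D -> Cmeasurable D f ->
  mu.-integrable D (EFin \o k) -> (forall x, D x -> cabs (f x) <= k x) ->
  Cintegrable D f.
Proof.
move=> mD [f1 f2] ik fk; split; apply: le_Rintegrable ik _ => // x Dx.
  by apply: le_trans (fk _ Dx); exact: cabs_Re.
by apply: le_trans (fk _ Dx); exact: cabs_Im.
Qed.

Lemma Cintegrable_cabs D f : measurable D -> Cintegrable D f ->
  mu.-integrable D (EFin \o (fun x => cabs (f x))).
Proof.
move=> mD [f1 f2].
have fm : Cmeasurable D f.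
  by split; apply/measurable_EFinP; apply: measurable_int; eassumption.
apply: (@le_Rintegrable _ _ (fun x => `|Re (f x)| + `|Im (f x)|)) => //.
- exact: Cmeasurable_cabs.
- by apply: RintegrableD => //; exact: Rintegrable_norm.
- by move=> x Dx; rewrite ger0_norm ?cabs_ge0// cabs_ReIm.
Qed.

Lemma CintegrableD D f g : measurable D -> Cintegrable D f -> Cintegrable D g ->
  Cintegrable D (fun x => f x + g x).
Proof.
move=> mD [f1 f2] [g1 g2]; split.
  apply: eq_integrable (RintegrableD mD f1 g1) => // x _ /=.
  by rewrite cReD.
apply: eq_integrable (RintegrableD mD f2 g2) => // x _ /=.
by rewrite cImD.
Qed.

Lemma CintegrableZl D c f : measurable D -> Cintegrable D f ->
  Cintegrable D (fun x => c * f x).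
Proof.
move=> mD fi.
have [f1 f2] := fi.
have fm : Cmeasurable D f.
  by split; apply/measurable_EFinP; apply: measurable_int; eassumption.
apply: (@le_Cintegrable _ _ (fun x => cabs c * cabs (f x))) => //.
- by apply: CmeasurableM => //; exact: Cmeasurable_cst.
- by apply: RintegrableZl => //; exact: Cintegrable_cabs.
- by move=> x _; rewrite cabsM.
Qed.

Lemma CintegralD D f g : measurable D -> Cintegrable D f -> Cintegrable D g ->
  Cintegral mu D (fun x => f x + g x) = Cintegral mu D f + Cintegral mu D g.
Proof.
move=> mD [f1 f2] [g1 g2]; apply: complex_eqP => /=.
  rewrite -RintegralD//; apply: eq_Rintegral => x _.
  by rewrite cReD.
rewrite -RintegralD//; apply: eq_Rintegral => x _.
by rewrite cImD.
Qed.

Lemma CintegralZl D c f : measurable D -> Cintegrable D f ->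
  Cintegral mu D (fun x => c * f x) = c * Cintegral mu D f.
Proof.
move=> mD [f1 f2].
have iZ (r : R) h : mu.-integrable D (EFin \o h) ->
  mu.-integrable D (EFin \o (fun x => r * h x)) by exact: RintegrableZl.
apply: complex_eqP; rewrite ?cReM ?cImM/=.
  rewrite -!RintegralZl// -RintegralB//; try exact: iZ.
  by apply: eq_Rintegral => x _; rewrite cReM.
rewrite -!RintegralZl// -RintegralD//; try exact: iZ.
by apply: eq_Rintegral => x _; rewrite cImM.
Qed.

Lemma CintegralB D f g : measurable D -> Cintegrable D f -> Cintegrable D g ->
  Cintegral mu D (fun x => f x - g x) = Cintegral mu D f - Cintegral mu D g.
Proof.
move=> mD fi gi; rewrite (_ : (fun _ => _) = (fun x => f x + (-1) * g x)).
  by rewrite CintegralD// ?CintegralZl// ?mulN1r//; exact: CintegrableZl.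
by apply/funext => x; rewrite mulN1r.
Qed.

Lemma Cintegrable0 D : Cintegrable D (fun=> 0).
Proof. by split; exact: integrable0. Qed.

Lemma Cintegral0 D : Cintegral mu D (fun=> 0) = 0.
Proof.
apply: complex_eqP => /=; rewrite /Rintegral integral0_eq//.
Qed.

Lemma Cintegrable_sum D (I : Type) (s : seq I) (F : I -> T -> R[i]) :
  measurable D -> (forall i, Cintegrable D (F i)) ->
  Cintegrable D (fun x => \sum_(i <- s) F i x).
Proof.
move=> mD Fi; elim: s => [|i s ih].
  rewrite (_ : (fun _ => _) = (fun=> 0)); first exact: Cintegrable0.
  by apply/funext => x; rewrite big_nil.
rewrite (_ : (fun _ => _) = (fun x => F i x + \sum_(i <- s) F i x)).
  exact: CintegrableD.
by apply/funext => x; rewrite big_cons.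
Qed.

Lemma Cintegral_sum D (I : Type) (s : seq I) (F : I -> T -> R[i]) :
  measurable D -> (forall i, Cintegrable D (F i)) ->
  Cintegral mu D (fun x => \sum_(i <- s) F i x) =
  \sum_(i <- s) Cintegral mu D (F i).
Proof.
move=> mD Fi; elim: s => [|i s ih].
  rewrite big_nil -[RHS](Cintegral0 D); congr Cintegral.
  by apply/funext => x; rewrite big_nil.
rewrite big_cons -ih -CintegralD//; last exact: Cintegrable_sum.
by congr Cintegral; apply/funext => x; rewrite big_cons.
Qed.

Lemma eq_Cintegral D f g : (forall x, D x -> f x = g x) ->
  Cintegral mu D f = Cintegral mu D g.
Proof.
by move=> fg; apply: complex_eqP => /=; apply: eq_Rintegral => x /set_mem/fg ->.
Qed.

(* The constant 2, instead of 1, comes from bounding the real and imaginary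
   parts separately. *)
Lemma cabs_Cintegral_le D f k : measurable D -> Cmeasurable D f ->
  mu.-integrable D (EFin \o k) -> (forall x, D x -> cabs (f x) <= k x) ->
  cabs (Cintegral mu D f) <= 2 * (\int[mu]_(x in D) k x).
Proof.
move=> mD fm ik fk; have [f1 f2] := le_Cintegrable mD fm ik fk.
apply: le_trans (cabs_ReIm _) _; rewrite mulr_natl mulr2n lerD//=.
  apply: le_trans (le_normr_Rintegral mD f1) _.
  apply: le_Rintegral => //; first exact: Rintegrable_norm.
  by move=> x Dx; apply: le_trans (cabs_Re _) _; exact: fk.
apply: le_trans (le_normr_Rintegral mD f2) _.
apply: le_Rintegral => //; first exact: Rintegrable_norm.
by move=> x Dx; apply: le_trans (cabs_Im _) _; exact: fk.
Qed.

End measurable_integrable.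

Section probability_Cintegral.
Context d (T : measurableType d) (R : realType) (P : probability T R).
Implicit Types (f g : T -> R[i]) (h : T -> R).

Lemma integrable_bounded h M : measurable_fun setT h ->
  (forall x, `|h x| <= M) -> P.-integrable setT (EFin \o h).
Proof.
move=> mh hM; apply: (@le_Rintegrable _ _ _ _ _ _ (fun=> M)) => //.
exact: finite_measure_integrable_cst.
Qed.

Lemma Cintegrable_bounded f M : Cmeasurable setT f ->
  (forall x, cabs (f x) <= M) -> Cintegrable P setT f.
Proof.
move=> mf fM; apply: (@le_Cintegrable _ _ _ _ _ _ (fun=> M)) => //.
exact: finite_measure_integrable_cst.
Qed.

Lemma Rintegral_prob_cst (r : R) : \int[P]_x r = r.
Proof. by rewrite Rintegral_cst// [X in fine X]probability_setT mulr1. Qed.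

Lemma Cintegral_prob_cst c : Cintegral P setT (fun=> c) = c.
Proof. by apply: complex_eqP => /=; exact: Rintegral_prob_cst. Qed.

Lemma cabs_Cintegral_bounded f M : Cmeasurable setT f ->
  (forall x, cabs (f x) <= M) -> cabs (Cintegral P setT f) <= 2 * M.
Proof.
move=> mf fM; rewrite -[M in leRHS]Rintegral_prob_cst.
apply: cabs_Cintegral_le => //.
exact: finite_measure_integrable_cst.
Qed.

End probability_Cintegral.

Section distribution_Cintegral.
Context d d' (T : measurableType d) (T' : measurableType d') (R : realType).
Variables (P : probability T R) (X : {mfun T >-> T'}).

Lemma Rintegral_distribution (h : T' -> R) (M : R) : measurable_fun setT h ->
  (forall y, `|h y| <= M) ->
  \int[distribution P X]_y h y = \int[P]_x h (X x).
Proof.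
move=> mh hM; rewrite /Rintegral integral_distribution//.
  exact/measurable_EFinP.
apply: (@integrable_bounded _ _ _ P (h \o X) M) => //.
  exact: measurableT_comp.
by move=> x; exact: hM.
Qed.

Lemma Cintegral_distribution (f : T' -> R[i]) M : Cmeasurable setT f ->
  (forall y, cabs (f y) <= M) ->
  Cintegral (distribution P X) setT f = Cintegral P setT (fun x => f (X x)).
Proof.
move=> [m1 m2] fM; apply: complex_eqP => /=.
  apply: (Rintegral_distribution (h := Re \o f) (M := M)) => // y.
  by rewrite (le_trans (cabs_Re _)).
apply: (Rintegral_distribution (h := Im \o f) (M := M)) => // y.
by rewrite (le_trans (cabs_Im _)).
Qed.

End distribution_Cintegral.

(** * Resolvents: bounds, resolvent identity, polynomial approximation *)

Section resolvent.
Context {R : realType}.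
Implicit Types (mu : borel_probability R) (z w : R[i]).
Local Notation B := (measurableTypeR R).

Lemma Im_resolvent z (x : R) : Im (z - x%:C) = Im z.
Proof. by rewrite cImD cImN subr0. Qed.

Lemma Im_le_resolvent z (x : R) : `|Im z| <= cabs (z - x%:C).
Proof. by rewrite -(Im_resolvent z x) cabs_Im. Qed.

Lemma resolvent_neq0 z (x : R) : Im z < 0 -> z - x%:C != 0.
Proof. by move=> z0; apply: Im_lt0_neq0; rewrite Im_resolvent. Qed.

Lemma cabs_resolvent_le z (x : R) : Im z < 0 ->
  cabs (z - x%:C)^-1 <= `|Im z|^-1.
Proof.
move=> z0; rewrite cabsV lef_pV2 ?Im_le_resolvent// posrE.
  by rewrite cabs_gt0 resolvent_neq0.
by rewrite normr_gt0 lt_eqF.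
Qed.

Lemma Cmeasurable_resolvent (D : set B) z : measurable D ->
  Cmeasurable D (fun x : B => (z - (x : R)%:C)^-1).
Proof.
move=> mD; apply: CmeasurableV => //.
apply: CmeasurableB => //; first exact: Cmeasurable_cst.
by apply: Cmeasurable_real; exact: measurable_id.
Qed.

Lemma Cintegrable_resolvent mu z : Im z < 0 ->
  Cintegrable mu setT (fun x : B => (z - (x : R)%:C)^-1).
Proof.
move=> z0; apply: (@Cintegrable_bounded _ _ _ _ _ (`|Im z|^-1)).
  exact: Cmeasurable_resolvent.
by move=> x; exact: cabs_resolvent_le.
Qed.

Lemma cabs_Gtransform_le mu z : Im z < 0 ->
  cabs (Gtransform mu z) <= 2 / `|Im z|.
Proof.
move=> z0; apply: cabs_Cintegral_bounded; first exact: Cmeasurable_resolvent.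
by move=> x; exact: cabs_resolvent_le.
Qed.

(** The resolvent identity under the integral. The integral on the right gives the Lipschitz bound
    below, and its size far out in a sector gives injectivity of F there. *)
Lemma GtransformB mu z w : Im z < 0 -> Im w < 0 ->
  Gtransform mu z - Gtransform mu w = (w - z) * Cintegral mu setT
    (fun x : B => (z - (x : R)%:C)^-1 * (w - (x : R)%:C)^-1).
Proof.
move=> z0 w0; rewrite -CintegralB//; try exact: Cintegrable_resolvent.
rewrite -CintegralZl//; last first.
  apply: (@Cintegrable_bounded _ _ _ _ _ (`|Im z|^-1 * `|Im w|^-1)).
    by apply: CmeasurableM => //; exact: Cmeasurable_resolvent.
  by move=> x; rewrite cabsM ler_pM ?cabs_ge0 ?cabs_resolvent_le.
apply: eq_Cintegral => x _.
have zx := resolvent_neq0 x z0; have wx := resolvent_neq0 x w0.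
by field; rewrite zx wx.
Qed.

Lemma Gtransform_lipschitz mu z w : Im z < 0 -> Im w < 0 ->
  cabs (Gtransform mu z - Gtransform mu w) <=
  2 * cabs (z - w) / (`|Im z| * `|Im w|).
Proof.
move=> z0 w0; rewrite GtransformB// cabsM cabs_distC -mulrA mulrCA.
rewrite ler_wpM2l ?cabs_ge0//; apply: cabs_Cintegral_bounded.
  by apply: CmeasurableM => //; exact: Cmeasurable_resolvent.
by move=> x; rewrite invfM cabsM ler_pM ?cabs_ge0 ?cabs_resolvent_le.
Qed.

(** Each resolvent is expanded about c by [inv_expand]. The ratio of the geometric series is at most
    r / |Im c| whatever x is, so the remainder is small uniformly in x, and the coefficients are
    integrals of powers of the resolvent at c. *)
Lemma Gtransform_poly_approx mu (c : R[i]) (r : R) : Im c < 0 -> r < `|Im c| ->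
  poly_approx c r (Gtransform mu).
Proof.
move=> c0 rc e e0.
have [r0|r0] := ltP r 0.
  by exists 0 => s /(le_trans (cabs_ge0 _)); rewrite leNgt r0.
have Ic : 0 < `|Im c| by exact: le_lt_trans rc.
pose t := r / `|Im c|.
have [n nP] := @geometric_lt R (2 / (`|Im c| - r)) t e
  ltac:(by rewrite divr_ge0 ?normr_ge0// ltr_pdivrMr ?mul1r) e0.
pose m k := Cintegral mu setT (fun x : B => ((c - (x : R)%:C)^-1) ^+ k.+1).
exists (\sum_(k < n) (m k)%:P * (c%:P - 'X) ^+ k) => s sr.
have Is : Im s < 0.
  have : `|Im s - Im c| <= r.
    by apply: le_trans sr; rewrite -cImN -cImD cabs_Im.
  rewrite ltr0_norm// in rc *.
  rewrite ler_norml => /andP[_]; lra.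
have Isr : `|Im c| - r <= `|Im s|.
  have : `|Im s - Im c| <= r.
    by apply: le_trans sr; rewrite -cImN -cImD cabs_Im.
  rewrite distrC => /(le_trans (lerB_dist _ _)); lra.
have mres k : Cmeasurable setT (fun x : B => ((c - (x : R)%:C)^-1) ^+ k).
  by apply: CmeasurableX => //; exact: Cmeasurable_resolvent.
have ires k : Cintegrable mu setT (fun x : B => ((c - (x : R)%:C)^-1) ^+ k).
  apply: (@Cintegrable_bounded _ _ _ _ _ (`|Im c|^-1 ^+ k)) => //.
  move=> x; rewrite cabsX lerXn2r ?nnegrE ?cabs_ge0 ?invr_ge0//.
  exact: cabs_resolvent_le.
have -> : (\sum_(k < n) (m k)%:P * (c%:P - 'X) ^+ k).[s] =
    Cintegral mu setT (fun x : B => \sum_(k < n)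
      (c - s) ^+ k * (c - (x : R)%:C)^-1 ^+ k.+1).
  rewrite Cintegral_sum//; last by move=> k; exact: CintegrableZl.
  rewrite horner_sum; apply: eq_bigr => k _.
  by rewrite CintegralZl// hornerM horner_exp !hornerE mulrC.
rewrite -CintegralB//; last first.
- by apply: Cintegrable_sum => // k; exact: CintegrableZl.
- exact: Cintegrable_resolvent.
apply: le_trans nP; rewrite -mulrA; apply: cabs_Cintegral_bounded.
  apply: CmeasurableB => //; first exact: Cmeasurable_resolvent.
  have [] : Cintegrable mu setT (fun x : B => \sum_(k < n)
      (c - s) ^+ k * (c - (x : R)%:C)^-1 ^+ k.+1).
    by apply: Cintegrable_sum => // k; exact: CintegrableZl.
  by move=> i1 i2; split; apply/measurable_EFinP;
    apply: measurable_int; eassumption.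
move=> x; have cx := resolvent_neq0 x c0; have sx := resolvent_neq0 x Is.
rewrite {1}(inv_expand n cx sx).
have -> : c - x%:C - (s - x%:C) = c - s by ring.
under eq_bigr do rewrite mulrC.
rewrite addrAC subrr add0r !cabsM cabsX cabsM mulrC.
apply: ler_pM; rewrite ?cabs_ge0 ?exprn_ge0 ?mulr_ge0 ?cabs_ge0//.
  apply: le_trans (cabs_resolvent_le _ Is) _.
  by rewrite lef_pV2 ?posrE ?subr_gt0// (lt_le_trans _ Isr) ?subr_gt0.
rewrite lerXn2r ?nnegrE ?mulr_ge0 ?cabs_ge0 ?invr_ge0//.
rewrite /t mulrC ler_pM ?cabs_ge0//; first by rewrite cabs_distC.
exact: cabs_resolvent_le.
Qed.

(** The same expansion with ratio r / |c|: the disc does not reach 0. *)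
Lemma inv_poly_approx (c : R[i]) (r : R) : r < cabs c ->
  poly_approx c r (fun s => s^-1).
Proof.
move=> rc e e0.
have [r0|r0] := ltP r 0.
  by exists 0 => s /(le_trans (cabs_ge0 _)); rewrite leNgt r0.
have c_gt0 : 0 < cabs c by exact: le_lt_trans rc.
have c0 : c != 0 by rewrite -cabs_gt0.
pose t := r / cabs c.
have [n nP] := @geometric_lt R ((cabs c - r)^-1) t e
  ltac:(by rewrite divr_ge0 ?cabs_ge0// ltr_pdivrMr ?mul1r) e0.
exists (\sum_(k < n) (c^-1 ^+ k.+1)%:P * (c%:P - 'X) ^+ k) => s sr.
have cs : cabs c - r <= cabs s.
  have := cabs_lerB c s; rewrite cabs_distC; lra.
have s0 : s != 0 by rewrite -cabs_gt0 (lt_le_trans _ cs)// subr_gt0.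
rewrite {1}(inv_expand n c0 s0) horner_sum.
under [X in _ - X]eq_bigr do rewrite hornerM horner_exp !hornerE.
rewrite addrAC subrr add0r; apply: le_trans nP.
rewrite cabsM cabsX cabsM mulrC !cabsV.
apply: ler_pM; rewrite ?invr_ge0 ?cabs_ge0 ?exprn_ge0 ?mulr_ge0 ?invr_ge0 ?cabs_ge0//.
  by rewrite lef_pV2 ?posrE ?subr_gt0// (lt_le_trans _ cs) ?subr_gt0.
rewrite lerXn2r ?nnegrE ?mulr_ge0 ?cabs_ge0 ?invr_ge0 ?cabs_ge0//.
by rewrite /t mulrC ler_pM ?cabs_ge0 ?invr_ge0 ?cabs_ge0// cabs_distC.
Qed.

End resolvent.

(** * Integrals against a measure with a density *)

Section density.
Context d (T : measurableType d) (R : realType).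
Variables (mu m : {measure set T -> \bar R}) (p : T -> R).
Hypotheses (mp : measurable_fun setT p) (p0 : forall x, 0 <= p x).
Hypothesis mE : forall A, measurable A ->
  m A = (\int[mu]_(x in A) (p x)%:E)%E.

Import HBNNSimple.

Let integral_density_nnsfun (h : {nnsfun T >-> R}) :
  (\int[m]_x (h x)%:E = \int[mu]_x ((h x)%:E * (p x)%:E))%E.
Proof.
under eq_integral do rewrite fimfunE -fsumEFin//.
rewrite ge0_integral_fsum//; last 2 first.
- by move=> r; exact/measurable_EFinP/measurableT_comp.
- by move=> n x _; rewrite EFinM nnfun_muleindic_ge0.
under [RHS]eq_integral.
  move=> x _; rewrite fimfunE -fsumEFin// ge0_mule_fsuml; last first.
    by move=> r; rewrite EFinM nnfun_muleindic_ge0.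
  over.
rewrite [RHS]ge0_integral_fsum//; last 2 first.
- move=> r; apply: emeasurable_funM; apply/measurable_EFinP => //.
  exact/measurableT_comp.
- move=> n x _; apply: mule_ge0; last by rewrite lee_fin.
  by rewrite EFinM nnfun_muleindic_ge0.
apply: eq_fsbigr => r _.
rewrite (integralZl_indic_nnsfun _ _ _) ?integral_indic//.
under [RHS]eq_integral do rewrite EFinM -muleA.
have [r0|r0] := ltP r 0.
  rewrite preimage_nnfun0// set0I measure0 mule0 integral0_eq// => x _.
  by rewrite indicE in_set0 mul0e mule0.
rewrite ge0_integralZl//; last 2 first.
- apply: emeasurable_funM; apply/measurable_EFinP => //.
- by move=> x _; rewrite mule_ge0 ?lee_fin.
rewrite setIT mE//; congr (_ * _)%E.
rewrite [LHS]integral_mkcond; apply: eq_integral => x _.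
by rewrite epatch_indic muleC.
Qed.

(** By definition for indicators, by linearity for simple functions, then by monotone convergence on
    both sides. *)
Lemma ge0_integral_density (f : T -> \bar R) : measurable_fun setT f ->
  (forall x, (0 <= f x)%E) ->
  (\int[m]_x f x = \int[mu]_x (f x * (p x)%:E))%E.
Proof.
move=> mf f0; pose f_ := nnsfun_approx measurableT mf.
transitivity (limn (fun n => (\int[m]_x (f_ n x)%:E)%E)).
  rewrite -monotone_convergence//=.
  - apply: eq_integral => x _; apply/esym/cvg_lim => //=.
    exact: cvg_nnsfun_approx.
  - by move=> n; apply/measurable_EFinP.
  - by move=> n x _; rewrite lee_fin.
  - by move=> x _ a b ab; rewrite lee_fin//; exact/lefP/nd_nnsfun_approx.
under eq_fun do rewrite integral_density_nnsfun.
rewrite -monotone_convergence//=.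
- apply: eq_integral => x _; apply/cvg_lim => //=.
  by apply: cvgeZr => //; exact: cvg_nnsfun_approx.
- by move=> n; apply: emeasurable_funM; apply/measurable_EFinP.
- by move=> n x _; rewrite mule_ge0 ?lee_fin.
- move=> x _ a b ab; rewrite lee_wpmul2r ?lee_fin//.
  exact/lefP/nd_nnsfun_approx.
Qed.

Lemma Rintegral_density (f : T -> R) : measurable_fun setT f ->
  mu.-integrable setT (EFin \o (fun x => f x * p x)) ->
  \int[m]_x f x = \int[mu]_x (f x * p x).
Proof.
move=> mf fp; rewrite /Rintegral; congr fine.
have mfE : measurable_fun setT (EFin \o f) by exact/measurable_EFinP.
rewrite integralE [RHS]integralE; congr (_ - _)%E.
  rewrite ge0_integral_density//; last exact: measurable_funepos.
  apply: eq_integral => x _; rewrite !funeposE/= -!EFin_max -EFinM.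
  by rewrite maxr_pMl// mul0r.
rewrite ge0_integral_density//; last exact: measurable_funeneg.
apply: eq_integral => x _; rewrite !funenegE/= -!EFin_max -EFinM.
by rewrite maxr_pMl// mul0r mulNr.
Qed.

End density.

Section Rdominated_convergence.
Context d (T : measurableType d) (R : realType).
Variables (mu : {measure set T -> \bar R}).

Lemma Rdominated_convergence D (h_ : nat -> T -> R) (h k : T -> R) :
  measurable D -> (forall n, measurable_fun D (h_ n)) ->
  measurable_fun D h ->
  (forall x, D x -> h_ ^~ x @ \oo --> h x) ->
  mu.-integrable D (EFin \o k) ->
  (forall n x, D x -> `|h_ n x| <= k x) ->
  (fun n => \int[mu]_(x in D) h_ n x) @ \oo --> \int[mu]_(x in D) h x.
Proof.
move=> mD mh_ mh hh ik hk.
have [] := @dominated_convergence _ _ _ mu D mD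
  (fun n => EFin \o h_ n) (EFin \o h) (EFin \o k).
- by move=> n; exact/measurable_EFinP.
- exact/measurable_EFinP.
- by apply: aeW => x Dx; apply: cvg_EFin; [exact: nearW|exact: hh].
- exact: ik.
- by apply: aeW => x n Dx /=; rewrite lee_fin hk.
move=> ih _ H; apply: fine_cvg; rewrite fineK//.
exact: integrable_fin_num.
Qed.

End Rdominated_convergence.

(** * A smooth substitute for the mass outside an interval *)

Section tail.
Context {R : realType}.
Local Notation B := (measurableTypeR R).
Implicit Types (mu : borel_probability R) (x A e : R).

(* 1 - tail A x is pi A times the Cauchy density with centre x and width A at 0, so
   the integral of tail A is read off the Stieltjes transform; this gives tightness. *)
Definition tail A x : R := x ^+ 2 / (x ^+ 2 + A ^+ 2).

Lemma tail_ge0 A x : 0 <= tail A x.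
Proof. by rewrite divr_ge0// ?addr_ge0 ?sqr_ge0. Qed.

Lemma tail_le1 A x : tail A x <= 1.
Proof.
rewrite /tail; have [->|] := eqVneq (x ^+ 2 + A ^+ 2) 0.
  by rewrite invr0 mulr0.
move=> h; rewrite ler_pdivrMr; first by rewrite mul1r lerDl sqr_ge0.
by rewrite lt_def h addr_ge0 ?sqr_ge0.
Qed.

(** This is how the integral of [tail] controls the mass outside [-A, A], at the cost of a factor
    2. *)
Lemma tail_ge_half A x : 0 < A -> A <= `|x| -> 1 <= 2 * tail A x.
Proof.
move=> A0 Ax; have A2 : A ^+ 2 <= x ^+ 2.
  by rewrite -[x ^+ 2]real_normK ?num_real// lerXn2r// nnegrE ltW.
have p : 0 < x ^+ 2 + A ^+ 2 by rewrite ltr_wpDl ?sqr_ge0// exprn_gt0.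
by rewrite mulrA ler_pdivlMr// mul1r; lra.
Qed.

Lemma tail_anti A A' x : 0 < A -> A <= A' -> tail A' x <= tail A x.
Proof.
move=> A0 AA'; rewrite ler_wpM2l ?sqr_ge0// lef_pV2 ?posrE; last 2 first.
- by rewrite ltr_wpDl ?sqr_ge0// exprn_gt0// (lt_le_trans A0).
- by rewrite ltr_wpDl ?sqr_ge0// exprn_gt0.
by rewrite lerD2l lerXn2r// nnegrE ltW// (lt_le_trans A0).
Qed.

Lemma measurable_tail A : measurable_fun setT (tail A : B -> R).
Proof.
apply: measurable_funM; first exact: exprn_measurable.
by apply: measurable_funV => //; apply: measurable_funD.
Qed.

Lemma integrable_tail mu A : mu.-integrable setT (EFin \o (tail A : B -> R)).
Proof.
apply: (@integrable_bounded _ _ _ _ _ 1); first exact: measurable_tail.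
by move=> x; rewrite ger0_norm ?tail_ge0 ?tail_le1.
Qed.

Lemma tail_small mu e : 0 < e -> exists2 A0, 0 < A0 &
  forall A, A0 <= A -> \int[mu]_x tail A x <= e.
Proof.
move=> e0.
have : (fun n => \int[mu]_x tail n.+1%:R x) @ \oo --> \int[mu]_(x in setT) 0.
  apply: (@Rdominated_convergence _ _ _ _ _ _ _ (fun=> 1)) => //.
  - by move=> n; exact: measurable_tail.
  - move=> x _; apply: (@squeeze_cvgr _ _ _ _ (fun=> 0)
      (fun n => (`|x| ^+ 2) * (n.+1%:R^-1))); last 2 first.
    + exact: cvg_cst.
    + rewrite -(mulr0 (`|x| ^+ 2)); apply: cvgM; first exact: cvg_cst.
      exact: cvg_harmonic.
    + apply: nearW => n; rewrite tail_ge0/= real_normK ?num_real//.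
      rewrite ler_wpM2l ?sqr_ge0// lef_pV2 ?posrE//.
        apply: (@le_trans _ _ (n.+1%:R ^+ 2)); last by rewrite lerDr sqr_ge0.
        by rewrite expr2 ler_peMl// ler1n.
      by rewrite ltr_wpDl ?sqr_ge0// exprn_gt0.
  - exact: finite_measure_integrable_cst.
  - by move=> n x _; rewrite ger0_norm ?tail_ge0 ?tail_le1.
rewrite Rintegral_prob_cst => /cvgrPdist_le/(_ _ e0)[n _ /(_ n (leqnn n))] /=.
rewrite sub0r normrN => H; exists n.+1%:R => // A nA.
apply: le_trans H; apply: le_trans (ler_norm _).
apply: le_Rintegral => //; try exact: integrable_tail.
by move=> x _; exact: tail_anti.
Qed.

End tail.

(** * Weak convergence from Stieltjes transforms *)

Section poisson.
Context {R : realType}.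
Local Notation B := (measurableTypeR R).
Local Notation leb := (@lebesgue_measure R).
Implicit Types (mu : borel_probability R) (a b t x y e M : R) (f : R -> R).

Lemma cauchy_den_gt0 b x : 0 < b -> 0 < x ^+ 2 + b ^+ 2.
Proof. by move=> b0; rewrite ltr_wpDl ?sqr_ge0// exprn_gt0. Qed.

Lemma cauchy_pdfC a b x : cauchy_pdf a b x = cauchy_pdf x b a.
Proof. by rewrite /cauchy_pdf -sqrrN opprB. Qed.

Lemma cauchy_pdf_ge0 a b x : 0 < b -> 0 <= cauchy_pdf a b x.
Proof.
move=> b0; rewrite mulr_ge0 ?invr_ge0 ?pi_ge0// divr_ge0 ?(ltW b0)//.
exact: ltW (cauchy_den_gt0 _ b0).
Qed.

Lemma cauchy_pdf_le a b x : 0 < b -> cauchy_pdf a b x <= (pi * b)^-1.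
Proof.
move=> b0; rewrite invfM ler_wpM2l ?invr_ge0 ?pi_ge0//.
rewrite ler_pdivrMr ?cauchy_den_gt0// mulrDr expr2 [b^-1 * (b * b)]mulrA.
by rewrite mulVf ?gt_eqF// mul1r lerDr mulr_ge0 ?sqr_ge0// invr_ge0 ltW.
Qed.

Lemma measurable_cauchy_pdf d (T : measurableType d) (u v : T -> R) b :
  measurable_fun setT u -> measurable_fun setT v ->
  measurable_fun setT (fun s => cauchy_pdf (u s) b (v s)).
Proof.
move=> mu_ mv; apply: measurable_funM; first exact: measurable_cst.
apply: measurable_funM; first exact: measurable_cst.
apply: measurable_funV => //; apply: measurable_funD => //.
by apply: measurable_funX; exact: measurable_funB.
Qed.

Lemma measurable_cauchy_pdf1 a b : measurable_fun setT (cauchy_pdf a b).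
Proof. by apply: measurable_cauchy_pdf => //; exact: measurable_cst. Qed.

Lemma cauchy_probE a b A : 0 < b ->
  cauchy_prob a b A = (\int[leb]_(x in A) (cauchy_pdf a b x)%:E)%E.
Proof. by move=> b0; rewrite /cauchy_prob b0. Qed.

Lemma cauchy_prob0E a (A : set B) :
  cauchy_prob a 0 A = @dirac _ B a R A.
Proof. by rewrite /cauchy_prob ltxx. Qed.

Lemma integral_cauchy_pdf a b : 0 < b ->
  (\int[leb]_x (cauchy_pdf a b x)%:E = 1)%E.
Proof.
move=> b0; rewrite -[RHS](@probability_setT _ _ _ (@cauchy_prob R a b)).
by rewrite -cauchy_probE.
Qed.

Lemma integrable_cauchy_pdf a b : 0 < b ->
  leb.-integrable setT (EFin \o cauchy_pdf a b).
Proof.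
move=> b0; apply/integrableP; split.
  by apply/measurable_EFinP; exact: measurable_cauchy_pdf1.
under eq_integral do rewrite /= ger0_norm ?cauchy_pdf_ge0//.
by rewrite integral_cauchy_pdf// ltry.
Qed.

Lemma Rintegral_cauchy_pdf a b : 0 < b -> \int[leb]_x cauchy_pdf a b x = 1.
Proof. by move=> b0; rewrite /Rintegral integral_cauchy_pdf. Qed.

Lemma integrable_Zcauchy (c a b : R) : 0 < b ->
  leb.-integrable setT (EFin \o (fun x => c * cauchy_pdf a b x)).
Proof.
by move=> b0; apply: RintegrableZl => //; exact: integrable_cauchy_pdf.
Qed.

Lemma Rintegral_Zcauchy (c a b : R) : 0 < b ->
  \int[leb]_x (c * cauchy_pdf a b x) = c.
Proof.
move=> b0; have ic := integrable_cauchy_pdf a b0.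
by rewrite (RintegralZl c _ ic)// Rintegral_cauchy_pdf// mulr1.
Qed.

Lemma integrable_bounded_cauchy a b f M : 0 < b -> measurable_fun setT f ->
  (forall x, `|f x| <= M) ->
  leb.-integrable setT (EFin \o (fun x => f x * cauchy_pdf a b x)).
Proof.
move=> b0 mf fM.
refine (@le_Rintegrable _ _ _ leb setT (fun x => f x * cauchy_pdf a b x)
  (fun x => M * cauchy_pdf a b x) _ _ _ _) => //.
- by apply: measurable_funM => //; exact: measurable_cauchy_pdf1.
- exact: integrable_Zcauchy.
- move=> x _; rewrite normrM (ger0_norm (cauchy_pdf_ge0 _ _ _))//.
  by rewrite ler_wpM2r ?cauchy_pdf_ge0.
Qed.

Lemma Rintegral_bounded_cauchy_le a b f M : 0 < b -> measurable_fun setT f ->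
  (forall x, `|f x| <= M) -> `|\int[leb]_x (f x * cauchy_pdf a b x)| <= M.
Proof.
move=> b0 mf fM; have fi := integrable_bounded_cauchy a b0 mf fM.
apply: le_trans (le_normr_Rintegral _ fi) _ => //.
rewrite -[leRHS](Rintegral_Zcauchy M a b0).
apply: le_Rintegral => //; first exact: Rintegrable_norm.
  exact: integrable_Zcauchy.
move=> x _; rewrite normrM (ger0_norm (cauchy_pdf_ge0 _ _ _))//.
by rewrite ler_wpM2r ?cauchy_pdf_ge0.
Qed.

Definition poisson y f t : R := \int[leb]_x (f x * cauchy_pdf t y x).

Lemma poisson_distE y f t M : 0 < y -> measurable_fun setT f ->
  (forall x, `|f x| <= M) ->
  poisson y f t - f t = \int[leb]_x ((f x - f t) * cauchy_pdf t y x).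
Proof.
move=> y0 mf fM.
rewrite -[in LHS](Rintegral_Zcauchy (f t) t y0).
rewrite -RintegralB//.
- by apply: eq_Rintegral => x _; rewrite mulrBl.
- exact: (integrable_bounded_cauchy _ _ mf fM).
- exact: integrable_Zcauchy.
Qed.

(** Away from its centre the kernel of width y is of order y. It is compared with the kernel of
    width 1, so that the bound is integrable with integral y (1 + e^-2). *)
Lemma cauchy_pdf_far t x y e : 0 < e -> 0 < y -> y <= 1 -> e <= `|x - t| ->
  cauchy_pdf t y x <= y * (1 + e ^- 2) * cauchy_pdf t 1 x.
Proof.
move=> e0 y0 y1 ex; rewrite /cauchy_pdf [leRHS]mulrCA ler_wpM2l ?invr_ge0 ?pi_ge0//.
rewrite mul1r expr1n -mulrA ler_pM2l//.
have e2 : e ^+ 2 <= (x - t) ^+ 2.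
  by rewrite -[(x - t) ^+ 2]real_normK ?num_real// lerXn2r// nnegrE ltW.
set s := (x - t) ^+ 2 in e2 *.
have e20 : 0 < e ^+ 2 by rewrite exprn_gt0.
have s0 : 0 < s by rewrite (lt_le_trans _ e2).
have h : 1 <= e ^- 2 * s by rewrite mulrC ler_pdivlMr// mul1r.
have h2 : 0 <= e ^- 2 * y ^+ 2 by rewrite mulr_ge0 ?invr_ge0 ?sqr_ge0.
have y2 := sqr_ge0 y.
have s1 : 0 < s + 1 by rewrite ltr_wpDl// ltW.
have sy : 0 < s + y ^+ 2 by rewrite ltr_wpDr.
rewrite -[leLHS]mul1r ler_pdivrMr// mulrAC ler_pdivlMr// mul1r mulrDl mul1r.
by rewrite mulrDr; lra.
Qed.

(** The majorant adds the near contribution e and the far contribution 2 M y (1 + d^-2) over the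
    whole line, which spares a splitting of the integral at |x - t| = d. *)
Lemma poisson_near y f t e (d : R) M : 0 < y -> y <= 1 -> 0 <= e -> 0 < d ->
  measurable_fun setT f -> (forall x, `|f x| <= M) ->
  (forall x, `|x - t| < d -> `|f x - f t| <= e) ->
  `|poisson y f t - f t| <= e + 2 * M * (y * (1 + d ^- 2)).
Proof.
move=> y0 y1 e0 d0 mf fM fe; rewrite (poisson_distE _ y0 mf fM).
have M0 : 0 <= M by exact: le_trans (fM 0).
have M2 x : `|f x - f t| <= 2 * M.
  by rewrite (le_trans (ler_normB _ _))// mulr_natl mulr2n lerD.
have mft : measurable_fun setT (fun x => f x - f t).
  by apply: measurable_funB => //; exact: measurable_cst.
have i1 := integrable_bounded_cauchy t y0 mft M2.
have c0 : 0 <= 1 + d ^- 2 by rewrite addr_ge0// invr_ge0 sqr_ge0.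
apply: le_trans (le_normr_Rintegral _ i1) _ => //.
have -> : e + 2 * M * (y * (1 + d ^- 2)) =
    \int[leb]_x (e * cauchy_pdf t y x +
      2 * M * (y * (1 + d ^- 2)) * cauchy_pdf t 1 x).
  by rewrite RintegralD ?Rintegral_Zcauchy//; exact: integrable_Zcauchy.
apply: le_Rintegral => //; first exact: Rintegrable_norm.
  exact: (RintegrableD measurableT (integrable_Zcauchy _ t y0)
    (integrable_Zcauchy _ t ltr01)).
move=> x _; rewrite normrM (ger0_norm (cauchy_pdf_ge0 _ _ _))//.
have [xd|dx] := ltP `|x - t| d.
  apply: (@le_trans _ _ (e * cauchy_pdf t y x)).
    by rewrite ler_wpM2r ?cauchy_pdf_ge0// fe.
  rewrite lerDl; apply: mulr_ge0; last exact: cauchy_pdf_ge0.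
  by apply: mulr_ge0; apply: mulr_ge0 => //; exact: ltW.
apply: (@le_trans _ _ (2 * M * cauchy_pdf t y x)).
  by rewrite ler_wpM2r ?cauchy_pdf_ge0.
have far := cauchy_pdf_far d0 y0 y1 dx.
rewrite -(mulrA (2 * M)) -[leLHS]add0r; apply: lerD.
  by apply: mulr_ge0 => //; exact: cauchy_pdf_ge0.
by apply: ler_wpM2l => //; rewrite mulr_ge0.
Qed.

(** Heine's theorem in which only t is confined to the segment while x may leave it; the covering
    form of compactness supplies one d for all t. *)
Lemma continuous_segment_uniform f (Y e : R) : continuous f -> 0 < e ->
  exists2 d, 0 < d & forall t x, `|t| <= Y -> `|x - t| < d -> `|f x - f t| <= e.
Proof.
move=> cf e0; have e20 : 0 < e / 2 by rewrite divr_gt0.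
have /compact_near_coveringP cov := @segment_compact R (- Y) Y.
have := cov R (nbhs 0^'+) (fun d t => forall x, `|x - t| < d -> `|f x - f t| <= e) _.
case.
  move=> t _; have /cvgrPdist_le/(_ _ e20)/nbhs_ballP[d /= d0 dP] := cf t.
  exists (ball t (d / 2), [set s | s < d / 2]) => /=.
    split; first by apply: nbhsx_ballx; rewrite divr_gt0.
    by exists (d / 2) => /=; [rewrite divr_gt0|
      move=> z /=; rewrite sub0r normrN => /(le_lt_trans (ler_norm _))].
  move=> [t' s] /= [tt' sd] x xt'.
  rewrite (splitr e) -(subrK (f t) (f x)) -addrA.
  apply: le_trans (ler_normD _ _) _; rewrite lerD// ?(distrC (f x)).
    apply: dP; rewrite /ball/= distrC -(subrK t' x) -addrA (splitr d).
    apply: le_lt_trans (ler_normD _ _) _; rewrite ltrD ?(lt_trans xt')//.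
    by rewrite distrC.
  apply: dP; apply: lt_le_trans tt' _.
  by rewrite ler_pdivrMr// ler_peMr ?(ltW d0)// ler1n.
move=> d /= d0 dP; exists (d / 2); first by rewrite divr_gt0.
move=> t x tY xt; apply: (dP (d / 2)) => //=.
- rewrite sub0r normrN gtr0_norm ?divr_gt0// ltr_pdivrMr// ltr_pMr//.
  by rewrite ltr1n.
- by rewrite divr_gt0.
- by rewrite in_itv/= -ler_norml.
Qed.

Let kern y f (s : B * B) : \bar R := (f s.2 * cauchy_pdf s.1 y s.2)%:E.

Let measurable_kern y f : measurable_fun setT f ->
  measurable_fun setT (kern y f).
Proof.
move=> mf; apply/measurable_EFinP; apply: measurable_funM.
  exact: (measurableT_comp mf measurable_snd).
exact: (measurable_cauchy_pdf _ measurable_fst measurable_snd).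
Qed.

(** The density of [mu] convolved with the centred Cauchy law of width y; it equals Im G / pi at the
    point x - i y. *)
Definition poisson_density mu y x : R := \int[mu]_t cauchy_pdf t y x.

Lemma integrable_cauchy_pdfC mu y x : 0 < y ->
  mu.-integrable setT (EFin \o (fun t : B => cauchy_pdf t y x)).
Proof.
move=> y0; apply: (@integrable_bounded _ _ _ _ _ (pi * y)^-1).
  by apply: measurable_cauchy_pdf => //; exact: measurable_cst.
by move=> t; rewrite ger0_norm ?cauchy_pdf_ge0 ?cauchy_pdf_le.
Qed.

Lemma poisson_density_ge0 mu y x : 0 < y -> 0 <= poisson_density mu y x.
Proof. by move=> y0; apply: Rintegral_ge0 => t _; exact: cauchy_pdf_ge0. Qed.

Lemma poisson_density_le mu y x : 0 < y ->
  poisson_density mu y x <= (pi * y)^-1.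
Proof.
move=> y0; rewrite -[leRHS](Rintegral_prob_cst mu).
apply: le_Rintegral => //; first exact: integrable_cauchy_pdfC.
  exact: finite_measure_integrable_cst.
by move=> t _; exact: cauchy_pdf_le.
Qed.

Lemma measurable_poisson_density mu y : 0 < y ->
  measurable_fun setT (poisson_density mu y).
Proof.
move=> y0.
have m1 : measurable_fun setT (fun _ : R => 1 : R) by exact: measurable_cst.
have -> : poisson_density mu y =
    fine \o (fun x => (\int[mu]_t kern y (fun=> 1%R) (t, x))%E).
  apply/funext => x; congr fine; apply: eq_integral => t _.
  by rewrite /kern/= mul1r.
apply: measurableT_comp; first exact: fine_measurable.
apply: measurable_fun_fubini_tonelli_G; first exact: measurable_kern.
by move=> s; rewrite /kern lee_fin mul1r cauchy_pdf_ge0.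
Qed.

Let integrable_kern mu y f M : 0 < y -> measurable_fun setT f ->
  (forall x, `|f x| <= M) -> (mu \x leb)%E.-integrable setT (kern y f).
Proof.
move=> y0 mf fM; apply/integrable12ltyP; first exact: measurable_kern.
apply: (@le_lt_trans _ _ (\int[mu]_(t in setT) M%:E)%E); last first.
  by rewrite integral_cst// [X in (_ * X)%E]probability_setT mule1 ltry.
apply: ge0_le_integral => //.
- by move=> t _; exact: integral_ge0.
- apply: (@measurable_fun_fubini_tonelli_F _ _ _ _ _ leb (abse \o kern y f)) => //.
  + by apply: measurableT_comp => //; exact: measurable_kern.
  + by move=> s; exact: abse_ge0.
move=> t _; rewrite -(Rintegral_Zcauchy M t y0).
have iM := integrable_Zcauchy M t y0.
rewrite /Rintegral fineK; last exact: integrable_fin_num.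
apply: ge0_le_integral => //.
- by apply/measurable_EFinP; apply: measurableT_comp => //;
    apply: measurable_funM => //; exact: measurable_cauchy_pdf1.
- exact: measurable_int iM.
- move=> x _; rewrite lee_fin normrM (ger0_norm (cauchy_pdf_ge0 _ _ _))//.
  by rewrite ler_wpM2r ?cauchy_pdf_ge0.
Qed.

Lemma measurable_poisson y f M : 0 < y -> measurable_fun setT f ->
  (forall x, `|f x| <= M) -> measurable_fun setT (poisson y f : B -> R).
Proof.
move=> y0 mf fM.
(* Any probability would do as first factor: only the measurability of the inner integral is
   kept. *)
have := measurable_fubini_F
  (integrable_kern (@cauchy_prob R 0 1) y0 mf fM).
by move=> /(measurableT_comp (@fine_measurable R _ measurableT)).
Qed.

(** Moves the smoothing from the test function to the measure, whose smoothed density is known from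
    its Stieltjes transform. *)
Lemma poisson_fubini mu y f M : 0 < y -> measurable_fun setT f ->
  (forall x, `|f x| <= M) ->
  \int[mu]_t poisson y f t = \int[leb]_x (f x * poisson_density mu y x).
Proof.
move=> y0 mf fM; have := Fubini (integrable_kern mu y0 mf fM).
rewrite /kern/= => FE; rewrite /Rintegral /poisson.
under eq_integral.
  move=> t _; rewrite /Rintegral fineK; last first.
    apply: integrable_fin_num => //.
    exact: (integrable_bounded_cauchy t y0 mf fM).
  over.
rewrite FE; congr fine; apply: eq_integral => x _.
rewrite -(RintegralZl (f x) measurableT (integrable_cauchy_pdfC mu x y0)).
rewrite /Rintegral fineK//; apply: integrable_fin_num => //.
apply: RintegrableZl => //; exact: integrable_cauchy_pdfC.
Qed.

End poisson.

(** * Weak convergence from pointwise convergence of the smoothed densities *)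

Section weak_convergence_criterion.
Context {R : realType}.
Local Notation B := (measurableTypeR R).
Local Notation leb := (@lebesgue_measure R).
Implicit Types (mu : borel_probability R) (a b t x y e M : R) (f : R -> R).

Lemma Rintegral_cauchy_prob a b f M : 0 < b -> measurable_fun setT f ->
  (forall x, `|f x| <= M) ->
  \int[cauchy_prob a b]_x f x = \int[leb]_x (f x * cauchy_pdf a b x).
Proof.
move=> b0 mf fM; apply: Rintegral_density => //.
- exact: measurable_cauchy_pdf1.
- by move=> x; exact: cauchy_pdf_ge0.
- by move=> A mA; rewrite -cauchy_probE.
- exact: (integrable_bounded_cauchy _ _ mf fM).
Qed.

Lemma Rintegral_dirac a f : measurable_fun setT f ->
  \int[@dirac _ B a R]_x f x = f a.
Proof.
move=> mf; rewrite /Rintegral integral_dirac//; last exact/measurable_EFinP.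
by rewrite /dirac indicT mul1e.
Qed.

Lemma tail_cauchy_pdf Y x : 0 < Y -> tail Y x = 1 - pi * Y * cauchy_pdf x Y 0.
Proof.
move=> Y0; rewrite /tail /cauchy_pdf sub0r sqrrN.
have p0 : pi != 0 :> R by rewrite gt_eqF ?pi_gt0.
have d0 : x ^+ 2 + Y ^+ 2 != 0 by rewrite gt_eqF ?cauchy_den_gt0.
rewrite [_ * (pi^-1 * _)]mulrACA divff// mul1r mulrA.
by rewrite -[X in X - _](divff d0) -mulrBl expr2 [Y ^+ 2]expr2 addrK.
Qed.

(** Pointwise, the densities of widths b + y and b differ by at most y / b times the density of
    width b + y, which integrates to 1. *)
Lemma Rintegral_cauchy_pdf_near a b f M : 0 < b -> measurable_fun setT f ->
  (forall x, `|f x| <= M) -> forall y, 0 < y ->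
  `|\int[leb]_x (f x * cauchy_pdf a (b + y) x) -
    \int[leb]_x (f x * cauchy_pdf a b x)| <= M * (y / b).
Proof.
move=> b0 mf fM y y0; have by0 : 0 < b + y by rewrite addr_gt0.
have M0 : 0 <= M by exact: le_trans (fM 0).
have i1 := integrable_bounded_cauchy a by0 mf fM.
have i2 := integrable_bounded_cauchy a b0 mf fM.
rewrite -RintegralB//; have i3 := RintegrableB measurableT i1 i2.
apply: le_trans (le_normr_Rintegral _ i3) _ => //.
rewrite -[leRHS](Rintegral_Zcauchy _ a by0).
apply: le_Rintegral => //; first exact: Rintegrable_norm.
  exact: integrable_Zcauchy.
move=> x _; rewrite -mulrBr normrM -mulrA ler_pM//.
rewrite /cauchy_pdf -mulrBr normrM (ger0_norm (_ : 0 <= pi^-1)) ?invr_ge0 ?pi_ge0//.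
rewrite [leRHS]mulrCA ler_wpM2l ?invr_ge0 ?pi_ge0//.
set s := (x - a) ^+ 2; have s0 : 0 <= s by exact: sqr_ge0.
have d1 : 0 < s + b ^+ 2 by rewrite ltr_wpDl// exprn_gt0.
have d2 : 0 < s + (b + y) ^+ 2 by rewrite ltr_wpDl// exprn_gt0.
have -> : (b + y) / (s + (b + y) ^+ 2) - b / (s + b ^+ 2) =
    y * (s - b * (b + y)) / ((s + b ^+ 2) * (s + (b + y) ^+ 2)).
  by field; rewrite !gt_eqF.
rewrite normrM normrV ?unitfE ?mulf_neq0 ?gt_eqF//.
rewrite (ger0_norm (_ : 0 <= (s + b ^+ 2) * _)); last by rewrite mulr_ge0 ?ltW.
rewrite ler_pdivrMr ?mulr_gt0//.
have -> : y / b * ((b + y) / (s + (b + y) ^+ 2)) *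
    ((s + b ^+ 2) * (s + (b + y) ^+ 2)) = y * ((1 + y / b) * (s + b ^+ 2)).
  by field; rewrite !gt_eqF.
rewrite normrM (gtr0_norm y0) ler_pM2l//.
have yb : 0 <= y / b by rewrite divr_ge0 ?ltW.
have -> : (1 + y / b) * (s + b ^+ 2) = s + b * (b + y) + y / b * s.
  by field; rewrite gt_eqF.
have h1 : 0 <= y / b * s by rewrite mulr_ge0.
have h2 : 0 <= b * (b + y) by rewrite mulr_ge0 ?ltW.
by rewrite ler_norml; apply/andP; split; lra.
Qed.

(** For |t| <= Y uniform continuity gives eta. For |t| > Y the trivial bound 2 M is absorbed by the
    second term, since [tail] is at least 1/2 there. *)
Lemma poisson_uniform f (M eta Y : R) : continuous f -> (forall x, `|f x| <= M) ->
  0 < eta -> 0 < Y -> exists2 y0, 0 < y0 & forall y, 0 < y -> y <= y0 ->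
  forall t, `|poisson y f t - f t| <= eta + 4 * M * tail Y t.
Proof.
move=> cf fM eta0 Y0; have eta20 : 0 < eta / 2 by rewrite divr_gt0.
have mf := continuous_measurable_fun cf.
have M0 : 0 <= M by exact: le_trans (fM 0).
have [d d0 dP] := continuous_segment_uniform Y cf eta20.
have c0 : 0 < 1 + d ^- 2 by rewrite ltr_pwDl// invr_ge0 sqr_ge0.
have M1 : 0 < 2 * M + 1 by rewrite ltr_wpDl// mulr_ge0.
(* The second entry makes the far contribution at most eta / 2; 2 M + 1 instead of 2 M avoids a
   division by zero. *)
exists (Num.min 1 (eta / 2 / (2 * M + 1) / (1 + d ^- 2))).
  by rewrite lt_min ltr01/= !divr_gt0.
move=> y y0; rewrite le_min => /andP[y1]; rewrite ler_pdivlMr// ler_pdivlMr// => yy t.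
have t0 : 0 <= 4 * M * tail Y t by rewrite mulr_ge0 ?tail_ge0// mulr_ge0.
have [tY|Yt] := leP `|t| Y.
  apply: (@le_trans _ _ eta); last by rewrite lerDl.
  apply: le_trans (poisson_near y0 y1 (ltW eta20) d0 mf fM (fun x => dP t x tY)) _.
  have : 2 * M * (y * (1 + d ^- 2)) <= (2 * M + 1) * (y * (1 + d ^- 2)).
    by rewrite ler_wpM2r ?lerDl// mulr_ge0 ?ltW.
  by rewrite mulrC in yy; lra.
apply: (@le_trans _ _ (2 * M)).
  rewrite (le_trans (ler_normB _ _))// mulr_natl mulr2n lerD//.
  exact: Rintegral_bounded_cauchy_le.
have := tail_ge_half Y0 (ltW Yt) => /(ler_wpM2l M0); lra.
Qed.

(** For b > 0 passing from width b to b + y costs at most M y / b. For b = 0 the law is the Dirac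
    mass at a, and the first integral is the Poisson integral of f at a. *)
Lemma cauchy_prob_smoothing a b f (M eta Y : R) : 0 <= b -> continuous f ->
  (forall x, `|f x| <= M) -> 0 < eta -> 0 < Y ->
  exists2 y0, 0 < y0 & forall y, 0 < y -> y <= y0 ->
  `|\int[leb]_x (f x * cauchy_pdf a (b + y) x) - \int[cauchy_prob a b]_x f x|
  <= eta + 4 * M * \int[cauchy_prob a b]_x tail Y x.
Proof.
move=> b0 cf fM eta0 Y0; have mf := continuous_measurable_fun cf.
have M0 : 0 <= M by exact: le_trans (fM 0).
have [b_gt0|b_le0] := ltP 0 b.
  exists (eta * b / (M + 1)).
    by rewrite divr_gt0 ?mulr_gt0// ltr_wpDl.
  move=> y y0; rewrite ler_pdivlMr ?ltr_wpDl// => yb.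
  rewrite (@Rintegral_cauchy_prob _ _ _ M)//.
  apply: le_trans (Rintegral_cauchy_pdf_near a b_gt0 mf fM y0) _.
  apply: (@le_trans _ _ eta).
    rewrite mulrA ler_pdivrMr//; apply: le_trans yb.
    by rewrite [M * y]mulrC ler_wpM2l ?(ltW y0)// lerDl.
  rewrite lerDl mulr_ge0 ?mulr_ge0//; apply: Rintegral_ge0 => x _.
  exact: tail_ge0.
have -> : b = 0 by apply/eqP; rewrite eq_le b0 b_le0.
have dirE (h : R -> R) : measurable_fun setT h ->
    \int[cauchy_prob a 0]_x h x = h a.
  move=> mh; rewrite -[RHS](Rintegral_dirac a mh); congr fine.
  by apply: eq_measure_integral => A mA _; exact: cauchy_prob0E.
have [y0 y00 yP] := poisson_uniform cf fM eta0 Y0.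
exists y0 => // y yp yy0; rewrite add0r !dirE//; last exact: measurable_tail.
exact: yP.
Qed.

(** The left side is (a^2 + b^2 + b Y) / (a^2 + (b + Y)^2). For Y >= 1 the numerator is at most (a^2
    + b^2 + b) Y, and the denominator is at least Y^2. *)
Let cauchy_tail_limit a b d Y : 0 <= b -> 1 <= Y ->
  a ^+ 2 + b ^+ 2 + b <= d * Y -> 1 - pi * Y * cauchy_pdf a (b + Y) 0 <= d.
Proof.
move=> b0 Y1 Yc; have Y0 : 0 < Y by rewrite (lt_le_trans _ Y1).
have d_ge0 : 0 <= d.
  by rewrite -(pmulr_lge0 _ Y0) (le_trans _ Yc)// !addr_ge0 ?sqr_ge0.
have bY : 0 < b + Y by rewrite ltr_wpDl.
have d0 : 0 < a ^+ 2 + (b + Y) ^+ 2 by rewrite cauchy_den_gt0.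
have p0 : pi != 0 :> R by rewrite gt_eqF ?pi_gt0.
rewrite /cauchy_pdf sub0r sqrrN [_ * (pi^-1 * _)]mulrACA divff// mul1r mulrA.
rewrite -[X in X - _](divff (lt0r_neq0 d0)) -mulrBl ler_pdivrMr//.
apply: (@le_trans _ _ ((a ^+ 2 + b ^+ 2 + b) * Y)).
  have -> : a ^+ 2 + (b + Y) ^+ 2 - Y * (b + Y) = a ^+ 2 + b ^+ 2 + b * Y.
    by ring.
  by rewrite [leRHS]mulrDl lerD2r ler_peMr// addr_ge0 ?sqr_ge0.
apply: (@le_trans _ _ (d * Y * Y)); first by rewrite ler_wpM2r// ltW.
rewrite -mulrA ler_wpM2l//.
have : 0 <= b * (b + 2 * Y) by rewrite mulr_ge0 ?addr_ge0 ?mulr_ge0 ?(ltW Y0).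
by have := sqr_ge0 a; rewrite expr2; lra.
Qed.

Let tail_bound (u v d : R) : u <= d -> `|u - v| <= d -> v <= 2 * d.
Proof. by move=> h; rewrite ler_norml => /andP[]; lra. Qed.

(** The error budget of the next lemma: three terms e / 6 and 2 + 8 + 4 + 1 = 15 times M d. This is
    why d is taken to be e / (30 M). *)
Let five_terms (u u1 p q v1 v s s' d e M : R) : `|u - u1| <= M * s ->
  M * s <= 2 * (M * d) -> `|p - u1| <= e / 6 + 4 * (M * s) ->
  `|q - p| <= e / 6 -> `|q - v1| <= e / 6 + 4 * (M * s') ->
  `|v - v1| <= M * s' -> M * s' <= M * d -> M * d = e / 30 ->
  `|v - u| <= e.
Proof.
rewrite !ler_norml => /andP[? ?] ? /andP[? ?] /andP[? ?] /andP[? ?] /andP[? ?].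
by move=> ? ?; apply/andP; split; lra.
Qed.

(** A bounded f need not be Lebesgue integrable, so it is first multiplied by chi = 1 - [tail] Y. As
    chi is a multiple of a Cauchy density, the product is integrable and dominated convergence
    applies to its smoothed integrals. The error of the cut is governed by the integral of [tail] Y,
    which for mu_N is again a smoothed density, taken at the point 0 with width Y, and converges by
    hypothesis. *)
Lemma weak_cvg_cauchy_prob (mu_ : nat -> borel_probability R) a b : 0 <= b ->
  (forall x y, 0 < y ->
    (fun N => poisson_density (mu_ N) y x) @ \oo --> cauchy_pdf a (b + y) x) ->
  weak_cvg mu_ (cauchy_prob a b).
Proof.
move=> b0 H f cf [M' fM'].
pose M := `|M'| + 1.
have fM x : `|f x| <= M.
  by apply: le_trans (fM' x) _; apply: le_trans (ler_norm _) _; rewrite lerDl.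
have M0 : 0 < M by rewrite ltr_wpDl.
have mf := continuous_measurable_fun cf.
apply/cvgrPdist_le => e e0.
pose dl := e / (30 * M).
have dl0 : 0 < dl by rewrite divr_gt0 ?mulr_gt0.
have [A0 A00 A0P] := tail_small (cauchy_prob a b) dl0.
pose c := a ^+ 2 + b ^+ 2 + b.
have c0 : 0 <= c by rewrite !addr_ge0 ?sqr_ge0.
(* [A0] makes the tail of the limit law small; 1 and c / dl make the limit of the tails of mu_N
   small. *)
pose Y := Num.max A0 (Num.max 1 (c / dl)).
have Y0 : 0 < Y by rewrite lt_max A00.
have Y1 : 1 <= Y by rewrite !le_max lexx orbT.
have Yc : c <= dl * Y.
  by rewrite mulrC -ler_pdivrMr// !le_max lexx !orbT.
have tailC : \int[cauchy_prob a b]_x tail Y x <= dl.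
  by apply: A0P; rewrite le_max lexx.
have tailC0 : 0 <= \int[cauchy_prob a b]_x tail Y x.
  by apply: Rintegral_ge0 => x _; exact: tail_ge0.
pose chi x := 1 - tail Y x.
have chi01 x : 0 <= chi x <= 1.
  by rewrite subr_ge0 tail_le1 lerBlDr lerDl tail_ge0.
have chiE x : chi x = pi * Y * cauchy_pdf x Y 0.
  by rewrite /chi tail_cauchy_pdf// opprB addrC subrK.
have cchi : continuous chi.
  move=> x; apply: cvgB; first exact: cvg_cst.
  apply: cvgM; first exact: exprn_continuous.
  apply: cvgV; first by rewrite gt_eqF ?cauchy_den_gt0.
  by apply: cvgD; [exact: exprn_continuous|exact: cvg_cst].
pose f1 x := f x * chi x.
have cf1 : continuous f1 by move=> x; apply: cvgM; [exact: cf|exact: cchi].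
have mf1 := continuous_measurable_fun cf1.
have f1M x : `|f1 x| <= M.
  have /andP[h0 h1] := chi01 x.
  by rewrite normrM (ger0_norm h0) -[M]mulr1 ler_pM.
have f1B x : f x - f1 x = f x * tail Y x by rewrite /f1 /chi; ring.
have cut mu : `|\int[mu]_x f x - \int[mu]_x f1 x| <= M * \int[mu]_x tail Y x.
  have i1 : mu.-integrable setT (EFin \o (f : B -> R)).
    exact: (@integrable_bounded _ _ _ mu f M mf fM).
  have i2 : mu.-integrable setT (EFin \o (f1 : B -> R)).
    exact: (@integrable_bounded _ _ _ mu f1 M mf1 f1M).
  have i3 := RintegrableB measurableT i1 i2.
  have it := integrable_tail mu Y.
  rewrite -RintegralB// -RintegralZl//.
  apply: le_trans (le_normr_Rintegral _ i3) _ => //.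
  apply: le_Rintegral => //; first exact: Rintegrable_norm.
    exact: RintegrableZl.
  move=> x _; rewrite f1B normrM (ger0_norm (tail_ge0 _ _)).
  by rewrite ler_wpM2r ?tail_ge0.
have eta0 : 0 < e / 6 by rewrite divr_gt0.
have [y1 y10 y1P] := poisson_uniform cf1 f1M eta0 Y0.
have [y2 y20 y2P] := cauchy_prob_smoothing a b0 cf1 f1M eta0 Y0.
pose y := Num.min y1 y2.
have y0 : 0 < y by rewrite lt_min y10.
have {}y1P := y1P _ y0 (_ : y <= y1).
have {}y2P := y2P _ y0 (_ : y <= y2).
have := y2P ltac:(by rewrite ge_min lexx orbT) => {}y2P.
have {}y1P : forall t, `|poisson y f1 t - f1 t| <= e / 6 + 4 * M * tail Y t.
  by apply: y1P; rewrite ge_min lexx.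
have cvg1 : (fun N => \int[mu_ N]_t poisson y f1 t) @ \oo -->
    \int[leb]_x (f1 x * cauchy_pdf a (b + y) x).
  under eq_fun do rewrite (poisson_fubini _ y0 mf1 f1M).
  have if1 : leb.-integrable setT (EFin \o (fun x => `|f1 x|)).
    apply: Rintegrable_norm.
    refine (@le_Rintegrable _ _ _ leb setT f1
      (fun x => M * (pi * Y) * cauchy_pdf 0 Y x) _ _ _ _) => //.
      exact: integrable_Zcauchy.
    move=> x _; have /andP[h0 h1] := chi01 x.
    rewrite normrM (ger0_norm h0) cauchy_pdfC -mulrA -chiE.
    exact: ler_wpM2r.
  apply: (@Rdominated_convergence _ _ _ leb setT _ _
    (fun x => (pi * y)^-1 * `|f1 x|)) => //.
  - move=> n; apply: measurable_funM => //.
    exact: measurable_poisson_density.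
  - apply: measurable_funM => //; exact: measurable_cauchy_pdf1.
  - by move=> x _; apply: cvgM; [exact: cvg_cst|exact: H].
  - exact: RintegrableZl.
  - move=> n x _; rewrite normrM mulrC ler_wpM2r//.
    by rewrite ger0_norm ?poisson_density_ge0 ?poisson_density_le.
have tailN N : \int[mu_ N]_x tail Y x = 1 - pi * Y * poisson_density (mu_ N) Y 0.
  under eq_Rintegral do rewrite tail_cauchy_pdf//.
  have ic := integrable_cauchy_pdfC (mu_ N) 0 Y0.
  rewrite RintegralB//; last 2 first.
  - exact: finite_measure_integrable_cst.
  - exact: RintegrableZl.
  by rewrite Rintegral_prob_cst RintegralZl.
have cvg2 : (fun N => \int[mu_ N]_x tail Y x) @ \oo -->
    1 - pi * Y * cauchy_pdf a (b + Y) 0.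
  under eq_fun do rewrite tailN.
  apply: cvgB; first exact: cvg_cst.
  by apply: cvgM; [exact: cvg_cst|exact: H].
have lim2 : 1 - pi * Y * cauchy_pdf a (b + Y) 0 <= dl.
  exact: cauchy_tail_limit.
have /cvgrPdist_le/(_ _ eta0) near1 := cvg1.
have /cvgrPdist_le/(_ _ dl0) near2 := cvg2.
near=> N.
have n1 : `|\int[leb]_x (f1 x * cauchy_pdf a (b + y) x) -
  \int[mu_ N]_t poisson y f1 t| <= e / 6.
  by near: N; exact: near1.
have n2 : `|1 - pi * Y * cauchy_pdf a (b + Y) 0 - \int[mu_ N]_x tail Y x| <= dl.
  by near: N; exact: near2.
have tN : \int[mu_ N]_x tail Y x <= 2 * dl.
  exact: tail_bound lim2 n2.
have n3 : `|\int[mu_ N]_t poisson y f1 t - \int[mu_ N]_t f1 t| <=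
    e / 6 + 4 * M * \int[mu_ N]_x tail Y x.
  have i1 : (mu_ N).-integrable setT (EFin \o (poisson y f1 : B -> R)).
    apply: (@integrable_bounded _ _ _ _ _ M).
      exact: measurable_poisson f1M.
    by move=> t; exact: Rintegral_bounded_cauchy_le.
  have i2 : (mu_ N).-integrable setT (EFin \o (f1 : B -> R)).
    exact: (@integrable_bounded _ _ _ (mu_ N) f1 M mf1 f1M).
  have i3 := RintegrableB measurableT i1 i2.
  have it := integrable_tail (mu_ N) Y.
  rewrite -RintegralB//.
  apply: le_trans (le_normr_Rintegral _ i3) _ => //.
  rewrite -[X in X + _](Rintegral_prob_cst (mu_ N)) -RintegralZl//.
  have ie : (mu_ N).-integrable setT (EFin \o (fun=> e / 6)).
    exact: finite_measure_integrable_cst.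
  have iz := RintegrableZl (4 * M) measurableT it.
  rewrite -RintegralD//.
  apply: le_Rintegral => //; first exact: Rintegrable_norm.
  exact: RintegrableD.
have c1 := cut (mu_ N); have c2 := cut (cauchy_prob a b).
have Mdl : M * dl = e / 30.
  by rewrite /dl; field; rewrite gt_eqF.
have h1 : M * \int[mu_ N]_x tail Y x <= 2 * (M * dl).
  by rewrite mulrCA ler_pM2l.
have h2 : M * \int[cauchy_prob a b]_x tail Y x <= M * dl by rewrite ler_pM2l.
rewrite -!(mulrA 4 M) in n3 y2P.
exact: five_terms c1 h1 n3 n1 y2P c2 h2 Mdl.
Unshelve. all: by end_near.
Qed.

End weak_convergence_criterion.

(** * Boolean, tensor and free powers *)

Section Gtransform_convergence.
Context {R : realType}.
Local Notation B := (measurableTypeR R).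
Implicit Types (mu nu rho : borel_probability R) (z w m : R[i]) (x y t : R).

Lemma Im_inv_cauchy_pdf t y x b :
  pi^-1 * Im ((x -i* y) - (t +i* b))^-1 = cauchy_pdf t (b + y) x.
Proof.
rewrite cImV cReD cImD cReN cImN/= /cauchy_pdf.
have -> : - y - b = - (b + y) by rewrite opprD addrC.
by rewrite sqrrN mulNr opprK.
Qed.

Lemma poisson_density_Im mu y x : 0 < y ->
  poisson_density mu y x = pi^-1 * Im (Gtransform mu (x -i* y)).
Proof.
move=> y0; have z0 : Im (x -i* y) < 0 by rewrite /= oppr_lt0.
have [_ i2] := Cintegrable_resolvent mu z0.
rewrite /= -RintegralZl//; apply: eq_Rintegral => t _.
by rewrite -[y in LHS]add0r -Im_inv_cauchy_pdf.
Qed.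

Lemma weak_cvg_Gtransform (mu_ : nat -> borel_probability R) m : 0 <= Im m ->
  (forall z, Im z < 0 -> forall e : R, 0 < e -> exists N0, forall N, (N0 <= N)%N ->
    cabs (Gtransform (mu_ N) z - (z - m)^-1) <= e) ->
  weak_cvg mu_ (cauchy_prob (Re m) (Im m)).
Proof.
case: m => a b /= b0 H; apply: weak_cvg_cauchy_prob => // x y y0.
have z0 : Im (x -i* y) < 0 by rewrite /= oppr_lt0.
apply/cvgrPdist_le => e e0.
have pe0 : 0 < pi * e by rewrite mulr_gt0 ?pi_gt0.
have [N0 N0P] := H _ z0 _ pe0.
exists N0 => // N /= /N0P h.
rewrite poisson_density_Im// -Im_inv_cauchy_pdf -mulrBr normrM.
rewrite gtr0_norm ?invr_gt0 ?pi_gt0//.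
rewrite ler_pdivrMl ?pi_gt0// distrC -cImN -cImD.
by apply: le_trans h; exact: cabs_Im.
Qed.

Lemma Im_mulrn z (N : R) : Im (N%:C * z) = N * Im z.
Proof. by rewrite cImM/= mul0r addr0. Qed.

Lemma Gtransform_dilation mu (N : R) z : 0 < N -> Im z < 0 ->
  Gtransform (dilation N^-1 mu) z = N%:C * Gtransform mu (N%:C * z).
Proof.
move=> N0 z0.
have Nz : Im (N%:C * z) < 0 by rewrite Im_mulrn pmulr_rlt0.
rewrite -CintegralZl//; last exact: Cintegrable_resolvent.
rewrite /Gtransform (@Cintegral_distribution _ _ _ _ _ _ _ _ (`|Im z|^-1)).
- apply: eq_Cintegral => x _; rewrite /scale.
  have N1 : N%:C != 0 :> R[i] by rewrite -cabs_gt0 cabsR normr_gt0 gt_eqF.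
  have h1 := resolvent_neq0 x Nz.
  rewrite rmorphM/= rmorphV ?unitfE ?gt_eqF//=.
  have h2 : z - N%:C^-1 * x%:C != 0.
    by apply: contraNneq h1 => E; rewrite -[x%:C](mulVKf N1) -mulrBr E mulr0.
  have -> : N%:C * z - x%:C = N%:C * (z - N%:C^-1 * x%:C).
    by rewrite mulrBr mulVKf.
  by rewrite invfM mulVKf.
- exact: Cmeasurable_resolvent.
- by move=> x; exact: cabs_resolvent_le.
Qed.

(** The bound is uniform in Re v because, for tensor powers, averaging over a factor shifts the
    argument by every real number. *)
Definition Gtransform_expansion mu m := forall e : R, 0 < e ->
  exists2 K : R, 0 < K & forall v, Im v <= - K ->
    cabs (v ^+ 2 * Gtransform mu v - v - m) <= e.

(** Put v = N w in the expansion and divide by N; N >= K1 / K brings N w below the threshold -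
    K1. *)
Lemma Gtransform_dilation_expansion mu m (e K : R) :
  Gtransform_expansion mu m -> 0 < e -> 0 < K ->
  exists2 N0 : nat, (0 < N0)%N & forall N, (N0 <= N)%N -> forall w, Im w <= - K ->
    cabs (w ^+ 2 * Gtransform (dilation N%:R^-1 mu) w - w - m / (N%:R)%:C)
    <= e / N%:R.
Proof.
move=> E e0 K0; have [K1 K10 K1P] := E _ e0.
exists (Num.trunc (K1 / K)).+1 => // N N0 w wK.
have Np : 0 < N%:R :> R by rewrite ltr0n (leq_trans _ N0).
have w0 : Im w < 0 by rewrite (le_lt_trans wK)// oppr_lt0.
have NK : K1 <= N%:R * K.
  rewrite -ler_pdivrMr// ltW// (lt_le_trans (truncnS_gt _))//.
  by rewrite ler_nat.
have Nw : Im ((N%:R)%:C * w) <= - K1.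
  rewrite Im_mulrn; apply: le_trans (_ : N%:R * - K <= _).
    by rewrite ler_pM2l.
  by rewrite mulrN lerN2.
have := K1P _ Nw; set n := (N%:R)%:C => h.
have n0 : n != 0 by rewrite -cabs_gt0 cabsR normr_gt0 gt_eqF.
rewrite ler_pdivlMr// mulrC -[X in X * _](ger0_norm (ltW Np)) -cabsR -cabsM.
rewrite Gtransform_dilation//.
suff -> : n * (w ^+ 2 * (n * Gtransform mu (n * w)) - w - m / n) =
  (n * w) ^+ 2 * Gtransform mu (n * w) - n * w - m by [].
by field; rewrite pnatr_eq0 -lt0n -(@ltr0n R).
Qed.

Lemma cabs_inv_close (A B' : R[i]) (d : R) : B' != 0 -> cabs (A - B') <= d ->
  2 * d <= cabs B' -> cabs (A^-1 - B'^-1) <= 2 * d / cabs B' ^+ 2.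
Proof.
move=> B0 AB dB.
have Bp : 0 < cabs B' by rewrite cabs_gt0.
have d0 : 0 <= d by apply: le_trans AB; exact: cabs_ge0.
have Ab : cabs B' / 2 <= cabs A.
  have := cabs_lerB B' A; rewrite cabs_distC; lra.
have Ap : 0 < cabs A by rewrite (lt_le_trans _ Ab)// divr_gt0.
have A0 : A != 0 by rewrite -cabs_gt0.
have -> : A^-1 - B'^-1 = (B' - A) / (A * B') by field; rewrite A0 B0.
rewrite cabsM cabsV cabsM cabs_distC ler_pdivrMr ?mulr_gt0//.
have -> : 2 * d / cabs B' ^+ 2 * (cabs A * cabs B') = d * (cabs A / (cabs B' / 2)).
  by field; rewrite gt_eqF.
apply: le_trans AB _; rewrite ler_peMr//.
by rewrite ler_pdivlMr ?divr_gt0// mul1r.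
Qed.

(** With q = w^2 G - w, s = m / N and r = q - s one has F = w^2 / (w + q) and F - w + s = (s q - w
    r) / (w + q). Here q is of order 1 / N and r is o(1 / N), so the numerator is a second-order
    term plus w times o(1 / N). *)
Lemma Ftransform_dilation_expansion mu m (e K : R) :
  Gtransform_expansion mu m -> 0 < e -> 0 < K ->
  exists2 N0 : nat, (0 < N0)%N & forall N, (N0 <= N)%N -> forall w, Im w <= - K ->
    Gtransform (dilation N%:R^-1 mu) w != 0 /\
    cabs (Ftransform (dilation N%:R^-1 mu) w - w + m / (N%:R)%:C) <= e / N%:R.
Proof.
move=> E e0 K0.
pose c := cabs m; have c0 : 0 <= c by exact: cabs_ge0.
pose e1 := Num.min 1 (e / 4).
have e10 : 0 < e1 by rewrite lt_min ltr01 divr_gt0.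
have [N1 N10 N1P] := Gtransform_dilation_expansion E e10 K0.
(* N >= A yields both 4 (c + 1) <= N K, so that q is at most half of w, and 4 c (c + 1) <= N K e, so
   that s q is negligible. *)
pose A := (c + 1) * (1 + c / e) * 4 / K.
exists (maxn N1 (Num.trunc A).+1); first by rewrite leq_max N10.
move=> N; rewrite geq_max => /andP[N1N AN] w wK.
have h1 := N1P _ N1N _ wK.
have {}AN : A <= N%:R.
  by rewrite ltW// (lt_le_trans (truncnS_gt _))// ler_nat.
have Np : 0 < N%:R :> R by rewrite ltr0n (leq_trans N10).
have w0 : Im w < 0 by rewrite (le_lt_trans wK)// oppr_lt0.
have Kw : K <= cabs w.
  apply: le_trans (cabs_Im w); rewrite ltr0_norm//; lra.
have wp : 0 < cabs w by exact: lt_le_trans Kw.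
have wn0 : w != 0 by rewrite -cabs_gt0.
set G := Gtransform _ w in h1 *; set n : R := N%:R in Np h1 AN *.
pose q := w ^+ 2 * G - w; pose r := q - m / n%:C.
have rE : cabs r <= e1 / n by exact: h1.
have e11 : e1 <= 1 by rewrite ge_min lexx.
have e1e : e1 <= e / 4 by rewrite ge_min lexx orbT.
have cmn : cabs (m / n%:C) = c / n by rewrite cabsM cabsV cabsR gtr0_norm.
have qE : cabs q <= (c + 1) / n.
  rewrite -(subrK (m / n%:C) q); apply: le_trans (cabsD _ _) _.
  rewrite cmn addrC mulrDl lerD2l; apply: le_trans rE _.
  by rewrite ler_pM2r ?invr_gt0.
have AE : A = 4 * (c + 1) / K + 4 * (c * (c + 1)) / (K * e).
  by rewrite /A; field; rewrite !gt_eqF.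
have A1 : 4 * (c + 1) <= n * K.
  rewrite -ler_pdivrMr//; apply: le_trans AN.
  by rewrite AE lerDl divr_ge0 ?mulr_ge0 ?addr_ge0// ltW// mulr_gt0.
have A2 : 4 * (c * (c + 1)) <= n * (K * e).
  rewrite -ler_pdivrMr ?mulr_gt0//; apply: le_trans AN.
  by rewrite AE lerDr divr_ge0 ?mulr_ge0 ?addr_ge0// ltW.
have qw : 2 * cabs q <= cabs w.
  apply: le_trans Kw.
  apply: (@le_trans _ _ (2 * ((c + 1) / n))); first by rewrite ler_pM2l.
  by rewrite mulrA ler_pdivrMr// mulrC [K * n]mulrC; lra.
have wq : cabs w / 2 <= cabs (w + q).
  by have := cabs_lerB w (- q); rewrite opprK cabsN; lra.
have wq0 : w + q != 0.
  by rewrite -cabs_gt0 (lt_le_trans _ wq)// divr_gt0.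
have GE : G = (w + q) / w ^+ 2.
  by rewrite /q addrC subrK mulrAC divff ?mul1r// expf_neq0.
have nC0 : n%:C != 0 :> R[i] by rewrite -cabs_gt0 cabsR normr_gt0 gt_eqF.
split; first by rewrite GE mulf_neq0 ?invr_eq0 ?expf_neq0.
rewrite /Ftransform -/G GE invf_div.
set s := m / n%:C in r rE cmn *.
have -> : w ^+ 2 / (w + q) - w + s = (s * q - w * r) / (w + q).
  by rewrite /r; field.
rewrite cabsM cabsV ler_pdivrMr; last by rewrite (lt_le_trans _ wq)// divr_gt0.
apply: (@le_trans _ _ (e / n * (cabs w / 2))); last first.
  by rewrite ler_wpM2l// divr_ge0// ltW.
apply: le_trans (cabsB _ _) _; rewrite (cabsM s) (cabsM w) cmn.
have h2 : c / n * cabs q <= e / 4 / n * cabs w.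
  apply: (@le_trans _ _ (c / n * ((c + 1) / n))).
    by rewrite ler_wpM2l// divr_ge0// ltW.
  apply: (@le_trans _ _ (e / 4 / n * K)); last first.
    by rewrite ler_wpM2l// !divr_ge0// ltW.
  rewrite [leLHS]mulrACA [leRHS]mulrAC -invfM.
  rewrite ler_pdivrMr ?mulr_gt0// mulrA.
  rewrite (_ : e / 4 * K / n * n * n = n * (K * e) / 4); last first.
    by field; rewrite gt_eqF.
  by rewrite ler_pdivlMr//; lra.
have h3 : cabs w * cabs r <= e / 4 / n * cabs w.
  rewrite mulrC ler_wpM2r ?cabs_ge0//; apply: le_trans rE _.
  by rewrite ler_wpM2r// invr_ge0 ltW.
apply: le_trans (lerD h2 h3) _; rewrite le_eqVlt; apply/orP; left; apply/eqP.
by field; rewrite gt_eqF.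
Qed.

Lemma boolean_powerE mu N rho : boolean_power mu N rho -> (0 < N)%N /\
  forall z, Im z < 0 ->
  Ftransform rho z = (N%:R)%:C * Ftransform mu z - (N.-1%:R)%:C * z.
Proof.
elim=> [|{}N nu rho' _ [N0 ih] cv]; split=> // z z0.
  by rewrite !rmorph1 mul1r rmorph0 mul0r subr0.
rewrite cv// ih// -(prednK N0)/= -!natr1 !rmorphD/= rmorph1.
by ring.
Qed.

Lemma Im_le_cabs_shift z m : Im z < 0 -> 0 <= Im m -> - Im z <= cabs (z - m).
Proof.
move=> z0 m0; apply: le_trans (cabs_Im _).
rewrite cImD cImN ltr0_norm; lra.
Qed.

Lemma boolean_Gtransform_cvg mu m (muB : nat -> borel_probability R) :
  0 <= Im m -> Gtransform_expansion mu m ->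
  (forall N, (0 < N)%N -> boolean_power (dilation N%:R^-1 mu) N (muB N)) ->
  forall z, Im z < 0 -> forall e : R, 0 < e -> exists N0, forall N, (N0 <= N)%N ->
    cabs (Gtransform (muB N) z - (z - m)^-1) <= e.
Proof.
move=> m0 E H z z0 e e0.
have zp : 0 < - Im z by rewrite oppr_gt0.
have zm := Im_le_cabs_shift z0 m0.
have p : 0 < cabs (z - m) by exact: lt_le_trans zm.
pose d := Num.min (cabs (z - m) / 2) (e * cabs (z - m) ^+ 2 / 2).
have d0 : 0 < d by rewrite lt_min !divr_gt0// mulr_gt0// exprn_gt0.
have [N0 N00 N0P] := Ftransform_dilation_expansion E d0 zp.
exists N0 => N N0N.
have N_gt0 : (0 < N)%N by exact: leq_trans N0N.
have [_ h] := N0P _ N0N z ltac:(by rewrite opprK).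
have [_ /(_ z z0) FE] := boolean_powerE (H N N_gt0).
have n0 : (N%:R)%:C != 0 :> R[i].
  by rewrite -cabs_gt0 cabsR normr_gt0 pnatr_eq0 -lt0n.
rewrite -[Gtransform _ z]invrK -/(Ftransform _ z) FE.
set A := _ - _ * z.
(* The N-fold power multiplies the error of F by N, which the precision d / N absorbs. *)
have AE : A - (z - m) =
    (N%:R)%:C * (Ftransform (dilation N%:R^-1 mu) z - z + m / (N%:R)%:C).
  rewrite /A; have -> : (N.-1%:R)%:C = (N%:R)%:C - 1 :> R[i].
    by rewrite -[in RHS](prednK N_gt0) -natr1 rmorphD/= rmorph1 addrK.
  move: n0; set n := (N%:R)%:C; move: n => n n0.
  by field.
have Ad : cabs (A - (z - m)) <= d.
  rewrite AE cabsM cabsR ger0_norm//.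
  by rewrite mulrC -ler_pdivlMr// ltr0n.
have zm0 : z - m != 0 by rewrite -cabs_gt0.
apply: le_trans (cabs_inv_close zm0 Ad _) _.
  by rewrite mulrC -ler_pdivlMr// ge_min lexx.
rewrite ler_pdivrMr ?exprn_gt0// mulrC -ler_pdivlMr//.
by rewrite ge_min lexx orbT.
Qed.

End Gtransform_convergence.

(** * Tensor powers *)

Section tensor.
Context {R : realType}.
Local Notation B := (measurableTypeR R).
Implicit Types (mu nu rho : borel_probability R) (z w m : R[i]) (x y t : R).

Let kern z (s : B * B) : R[i] := (z - (s.1 : R)%:C - (s.2 : R)%:C)^-1.

Let kern_measurable z : Cmeasurable setT (kern z).
Proof.
apply: CmeasurableV => //; apply: CmeasurableB => //; last first.
  by apply: Cmeasurable_real; exact: measurable_snd.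
apply: CmeasurableB => //; first exact: Cmeasurable_cst.
by apply: Cmeasurable_real; exact: measurable_fst.
Qed.

Let kern_le z s : Im z < 0 -> cabs (kern z s) <= `|Im z|^-1.
Proof.
move=> z0; rewrite /kern -(Im_resolvent z s.1); apply: cabs_resolvent_le.
by rewrite Im_resolvent.
Qed.

Let kern_integrable mu nu z : Im z < 0 ->
  (mu \x nu)%E.-integrable setT (EFin \o (Re \o kern z)) /\
  (mu \x nu)%E.-integrable setT (EFin \o (Im \o kern z)).
Proof.
move=> z0; exact: (@Cintegrable_bounded _ _ _ (product_prob mu nu) _ _
  (kern_measurable z) (fun s => kern_le s z0)).
Qed.

(** The function is the inner integral of the kernel (z - x - t)^-1 on the product of [mu] with
    itself, and Fubini's theorem makes it measurable. *)
Lemma Cmeasurable_Gtransform_shift mu z : Im z < 0 ->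
  Cmeasurable setT (fun x : B => Gtransform mu (z - (x : R)%:C)).
Proof.
move=> z0; have [i1 i2] := kern_integrable mu mu z0; split.
  exact: (measurableT_comp (@fine_measurable R _ measurableT)
    (measurable_fubini_F i1)).
exact: (measurableT_comp (@fine_measurable R _ measurableT)
  (measurable_fubini_F i2)).
Qed.

Lemma Gtransform_convolution mu nu z : Im z < 0 ->
  Gtransform (convolution mu nu) z =
  Cintegral mu setT (fun x : B => Gtransform nu (z - (x : R)%:C)).
Proof.
move=> z0; have [i1 i2] := kern_integrable mu nu z0.
have x0 (x : B) : Im (z - (x : R)%:C) < 0 by rewrite Im_resolvent.
rewrite /Gtransform (@Cintegral_distribution _ _ _ _ _ _ _ _ (`|Im z|^-1)); last 2 first.
- exact: Cmeasurable_resolvent.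
- by move=> x; exact: cabs_resolvent_le.
have kE (s : B * B) : (z - (Defs.add_pair s : R)%:C)^-1 = kern z s.
  by rewrite /kern /Defs.add_pair rmorphD/= opprD addrA.
under eq_Cintegral do rewrite kE.
apply: complex_eqP => /=; rewrite /Rintegral.
  rewrite -(integral12_prod_meas1 i1); congr fine.
  apply: eq_integral => x _; rewrite /Rintegral fineK//.
  by apply: integrable_fin_num => //; have [] := Cintegrable_resolvent nu (x0 x).
rewrite -(integral12_prod_meas1 i2); congr fine.
apply: eq_integral => x _; rewrite /Rintegral fineK//.
by apply: integrable_fin_num => //; have [] := Cintegrable_resolvent nu (x0 x).
Qed.

(* Peel off one factor: averaging the resolvent over it replaces z by z - m up to
   2 d, and Im m >= 0 keeps the argument below - K. *)
Lemma tensor_power_error mu m (K d : R) : 0 <= Im m ->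
  (forall w, Im w <= - K -> cabs (Gtransform mu w - (w - m)^-1) <= d) -> 0 < K ->
  forall N z, (0 < N)%N -> Im z <= - K ->
    cabs (Gtransform (tensor_power mu N) z - (z - m *+ N)^-1) <= 2 * d *+ N.
Proof.
move=> m0 H K0 [//|N] z _.
elim: N z => [|N ih] z zK.
  rewrite mulr1n [leRHS]mulr1n; apply: le_trans (H _ zK) _.
  have := le_trans (cabs_ge0 _) (H _ zK); lra.
have z0 : Im z < 0 by rewrite (le_lt_trans zK)// oppr_lt0.
have zmK : Im (z - m) <= - K by rewrite cImD cImN; lra.
have zm0 : Im (z - m) < 0 by rewrite (le_lt_trans zmK)// oppr_lt0.
rewrite [tensor_power mu N.+2]iterS.
have := ih _ zmK; set rho := tensor_power mu N.+1 => hN.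
rewrite Gtransform_convolution//.
rewrite -(subrK (Gtransform rho (z - m)) (Cintegral _ _ _)) -addrA.
apply: le_trans (cabsD _ _) _; rewrite [leRHS]mulrS; apply: lerD; last first.
  suff -> : z - m *+ N.+2 = z - m - m *+ N.+1 by [].
  by rewrite mulrS opprD addrA.
rewrite -CintegralB//; last 2 first.
- apply: (@Cintegrable_bounded _ _ _ _ _ (2 / `|Im z|)).
    exact: Cmeasurable_Gtransform_shift.
  move=> x; rewrite -[in leRHS](Im_resolvent z x).
  by apply: cabs_Gtransform_le; rewrite Im_resolvent.
- exact: Cintegrable_resolvent.
apply: cabs_Cintegral_bounded.
  apply: CmeasurableB => //; first exact: Cmeasurable_Gtransform_shift.
  exact: Cmeasurable_resolvent.
(* Since (z - m) - x = (z - x) - m, this is the bound for one factor at the shifted point z - x. *)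
move=> x; rewrite addrAC; apply: H.
by rewrite Im_resolvent.
Qed.

(** The expression is exactly - m^2 / (w^2 (w - m)), and Im m >= 0 keeps |w - m| >= K. For m / N in
    place of m the error is of order 1 / N^2. *)
Lemma inv_shift_le w m (K : R) : Im w <= - K -> 0 < K -> 0 <= Im m ->
  cabs (w^-1 + m / w ^+ 2 - (w - m)^-1) <= cabs m ^+ 2 / K ^+ 3.
Proof.
move=> wK K0 m0.
have w0 : Im w < 0 by rewrite (le_lt_trans wK)// oppr_lt0.
have Kw : K <= cabs w by apply: le_trans (cabs_Im w); rewrite ltr0_norm//; lra.
have Kwm : K <= cabs (w - m).
  by apply: le_trans (Im_le_cabs_shift w0 m0); lra.
have wn0 : w != 0 by rewrite -cabs_gt0 (lt_le_trans _ Kw).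
have wmn0 : w - m != 0 by rewrite -cabs_gt0 (lt_le_trans _ Kwm).
have -> : w^-1 + m / w ^+ 2 - (w - m)^-1 = - m ^+ 2 / (w ^+ 2 * (w - m)).
  by field; rewrite wn0 wmn0.
rewrite mulNr cabsN cabsM cabsX cabsV cabsM cabsX ler_wpM2l ?sqr_ge0//.
rewrite lef_pV2 ?posrE ?mulr_gt0 ?exprn_gt0 ?cabs_gt0//.
rewrite exprSr; apply: ler_pM => //; rewrite ?sqr_ge0 ?(ltW K0)//.
by rewrite lerXn2r// nnegrE ltW// cabs_gt0.
Qed.

Lemma tensor_Gtransform_cvg mu m : 0 <= Im m -> Gtransform_expansion mu m ->
  forall z, Im z < 0 -> forall e : R, 0 < e -> exists N0, forall N, (N0 <= N)%N ->
    cabs (Gtransform (tensor_power (dilation N%:R^-1 mu) N) z - (z - m)^-1) <= e.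
Proof.
move=> m0 E z z0 e e0.
pose K := - Im z; have K0 : 0 < K by rewrite oppr_gt0.
(* N steps of cost 2 d leave d = e / (2 N). Half of d pays for the expansion of G, which fixes [e1];
   the other half pays for the remainder of 1 / (w - m / N), which fixes [A]. *)
pose e1 := e * K ^+ 2 / 4.
have e10 : 0 < e1 by rewrite divr_gt0// mulr_gt0// exprn_gt0.
have [N1 N10 N1P] := Gtransform_dilation_expansion E e10 K0.
pose A := 4 * cabs m ^+ 2 / (K ^+ 3 * e).
exists (maxn N1 (Num.trunc A).+1) => N; rewrite geq_max => /andP[N1N AN].
have N0 : (0 < N)%N by exact: leq_trans N1N.
have Np : 0 < N%:R :> R by rewrite ltr0n.
have {}AN : A <= N%:R.
  by rewrite ltW// (lt_le_trans (truncnS_gt _))// ler_nat.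
set n : R := N%:R in Np AN *.
have nC0 : n%:C != 0 :> R[i] by rewrite -cabs_gt0 cabsR normr_gt0 gt_eqF.
have mE : m = (m / n%:C) *+ N.
  by rewrite -mulr_natr -[N%:R](rmorph_nat (real_complex R)) divfK.
have mn0 : 0 <= Im (m / n%:C).
  have -> : m / n%:C = (n^-1)%:C * m by rewrite rmorphV ?unitfE ?gt_eqF//= mulrC.
  by rewrite Im_mulrn mulr_ge0// invr_ge0 ltW.
pose d := e / 2 / n.
have H w : Im w <= - K ->
    cabs (Gtransform (dilation n^-1 mu) w - (w - m / n%:C)^-1) <= d.
  move=> wK; have h1 := N1P _ N1N _ wK; have h2 := inv_shift_le wK K0 mn0.
  have w0 : Im w < 0 by rewrite (le_lt_trans wK)// oppr_lt0.
  have Kw : K <= cabs w by apply: le_trans (cabs_Im w); rewrite ltr0_norm//; lra.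
  have wn0 : w != 0 by rewrite -cabs_gt0 (lt_le_trans _ Kw).
  rewrite -/n in h1; set G := Gtransform _ w in h1 *.
  have -> : G - (w - m / n%:C)^-1 = (w ^+ 2 * G - w - m / n%:C) / w ^+ 2 +
      (w^-1 + m / n%:C / w ^+ 2 - (w - m / n%:C)^-1).
    rewrite addrA; congr (_ - _).
    by move: (m / n%:C) => u; field.
  apply: le_trans (cabsD _ _) _.
  have -> : d = e / 4 / n + e / 4 / n by rewrite /d; field; rewrite gt_eqF.
  apply: lerD.
    rewrite cabsM cabsV cabsX ler_pdivrMr ?exprn_gt0 ?(lt_le_trans _ Kw)//.
    apply: le_trans h1 _.
    have -> : e1 / n = e / 4 / n * K ^+ 2 by rewrite /e1; field; rewrite gt_eqF.
    apply: ler_wpM2l; first by rewrite !divr_ge0// ltW.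
    by rewrite lerXn2r// nnegrE ltW// (lt_le_trans _ Kw).
  apply: le_trans h2 _.
  rewrite cabsM cabsV cabsR gtr0_norm// exprMn exprVn.
  rewrite ler_pdivrMr ?exprn_gt0// ler_pdivrMr ?exprn_gt0//.
  have -> : e / 4 / n * K ^+ 3 * n ^+ 2 = n * (K ^+ 3 * e) / 4.
    by field; rewrite gt_eqF.
  rewrite ler_pdivlMr// mulrC -ler_pdivrMr//.
  by rewrite mulr_gt0// exprn_gt0.
have := tensor_power_error mn0 H K0 (z := z) N0 ltac:(by rewrite /K opprK).
rewrite -mE => /le_trans; apply.
rewrite -[leLHS]mulr_natr -/n /d le_eqVlt; apply/orP; left; apply/eqP.
by field; rewrite gt_eqF.
Qed.

End tensor.

(** * G, F and the right inverses of F far out in a sector *)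

Section sectors.
Context {R : realType}.
Local Notation B := (measurableTypeR R).
Implicit Types (mu nu rho : borel_probability R) (z w u m : R[i]) (C M : R).

(** Below |x| = A the second bound on g is small, and beyond A the bound D is weighted by a small
    tail. The threshold M depends on D and e but not on g, which will depend on points of a
    sector. *)
Lemma cabs_Cintegral_small rho (D e : R) : 0 <= D -> 0 < e ->
  exists2 M : R, 0 < M & forall (M' : R) (g : B -> R[i]), M <= M' ->
    Cmeasurable setT g -> (forall x, cabs (g x) <= D) ->
    (forall x : B, cabs (g x) <= D * (`|x : R| / M')) ->
    cabs (Cintegral rho setT g) <= e.
Proof.
move=> D0 e0; have e10 : 0 < e / (8 * (D + 1)).
  by rewrite divr_gt0// mulr_gt0// ltr_wpDl.
have [A A0 /(_ A (lexx A)) At] := tail_small rho e10.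
exists (4 * (D * A + 1) / e).
  by rewrite divr_gt0// mulr_gt0// ltr_wpDl// mulr_ge0// ltW.
move=> M' g MM mg gD gM.
have M'0 : 0 < M'.
  by rewrite (lt_le_trans _ MM)// divr_gt0// mulr_gt0// ltr_wpDl// mulr_ge0// ltW.
have it := integrable_tail rho A.
have iz := RintegrableZl (2 * D) measurableT it.
have ie : rho.-integrable setT (EFin \o (fun=> e / 4)).
  exact: finite_measure_integrable_cst.
apply: le_trans (cabs_Cintegral_le measurableT mg
  (RintegrableD measurableT ie iz) _) _.
  move=> x _; have [xA|Ax] := leP `|x : R| A.
    apply: (@le_trans _ _ (e / 4)).
      apply: le_trans (gM x) _.
      rewrite mulrA ler_pdivrMr//.
      apply: (@le_trans _ _ (D * A)); first by rewrite ler_wpM2l.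
      move: MM; rewrite ler_pdivrMr//; lra.
    by rewrite lerDl mulr_ge0 ?tail_ge0// mulr_ge0.
  apply: le_trans (gD x) _.
  have := tail_ge_half A0 (ltW Ax) => /(ler_wpM2l D0); lra.
rewrite (RintegralD measurableT ie iz) (RintegralZl (2 * D) measurableT it).
rewrite Rintegral_prob_cst.
have : 2 * D * \int[rho]_x tail A x <= 2 * D * (e / (8 * (D + 1))).
  by rewrite ler_wpM2l// mulr_ge0.
have : 2 * D * (e / (8 * (D + 1))) <= e / 4.
  rewrite mulrA ler_pdivrMr ?mulr_gt0 ?ltr_wpDl//.
  have := mulr_ge0 D0 (ltW e0); lra.
lra.
Qed.

(** A cone about the negative imaginary axis, in the form that bounds z / (z - x) by C for every
    real x. *)
Definition sector C z := Im z < 0 /\ cabs z <= C * `|Im z|.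

Lemma sectorS C C' z : C <= C' -> sector C z -> sector C' z.
Proof.
by move=> CC [z0 zC]; split => //; apply: le_trans zC _; rewrite ler_wpM2r.
Qed.

Lemma sector_resolvent_le C z (x : R) : 0 < C -> sector C z ->
  cabs (z / (z - x%:C)) <= C.
Proof.
move=> C0 [z0 zC]; have h := resolvent_neq0 x z0.
rewrite cabsM cabsV ler_pdivrMr ?cabs_gt0//; apply: le_trans zC _.
by rewrite ler_pM2l// Im_le_resolvent.
Qed.

Lemma sector_resolvent_le2 C M z (x : R) : 0 < C -> 0 < M -> M <= cabs z ->
  sector C z -> cabs (x%:C / (z - x%:C)) <= C * (`|x| / M).
Proof.
move=> C0 M0 Mz sz; have [z0 zC] := sz; have h := resolvent_neq0 x z0.
have zn0 := Im_lt0_neq0 z0.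
have -> : x%:C / (z - x%:C) = z / (z - x%:C) * (x%:C / z).
  by move: (x%:C) h => q h; field; rewrite h zn0.
rewrite cabsM ler_pM ?cabs_ge0 ?sector_resolvent_le//.
rewrite cabsM cabsV cabsR ler_wpM2l// lef_pV2// posrE//.
exact: lt_le_trans Mz.
Qed.

(** The perturbation is at most |Im u| / 2, so half of Im u survives while the modulus grows at most
    by 3/2; the aperture is thus at most tripled. *)
Lemma sector_near C z u : 1 <= C -> sector C u ->
  cabs (z - u) <= cabs u / (2 * C) -> sector (3 * C) z /\ cabs u <= 2 * cabs z.
Proof.
move=> C1 [u0 uC] zu; have C0 : 0 < C by exact: lt_le_trans C1.
have up : 0 < cabs u by rewrite cabs_gt0 Im_lt0_neq0.
rewrite ltr0_norm// in uC.
have h1 : cabs (z - u) <= cabs u / 2.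
  apply: le_trans zu _; rewrite ler_wpM2l ?cabs_ge0// lef_pV2 ?posrE ?mulr_gt0//.
  by rewrite ler_peMr.
have h2 : cabs (z - u) <= - Im u / 2.
  apply: le_trans zu _; rewrite ler_pdivrMr ?mulr_gt0//; lra.
have h3 : Im z - Im u <= - Im u / 2.
  apply: le_trans h2; apply: le_trans (cabs_Im _).
  by rewrite -cImN -cImD ler_norm.
have h4 : cabs z <= cabs u + cabs u / 2.
  by rewrite -[z](subrK u) addrC (le_trans (cabsD _ _))// lerD2l.
have h5 : cabs u - cabs z <= cabs u / 2.
  by apply: le_trans (cabs_lerB _ _) _; rewrite cabs_distC.
have z0 : Im z < 0 by lra.
split; last by lra.
split=> //; rewrite ltr0_norm//.
have : 3 * C * - Im z >= 3 * C * (- Im u / 2) by rewrite ler_pM2l ?mulr_gt0//; lra.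
lra.
Qed.

(** The integrand of z G - 1 is x / (z - x), bounded in the sector and of order |x| / |z|. *)
Lemma Gtransform_sector rho C (e : R) : 1 <= C -> 0 < e ->
  exists2 M : R, 0 < M & forall z, sector C z -> M <= cabs z ->
    cabs (z * Gtransform rho z - 1) <= e.
Proof.
move=> C1 e0; have C0 : 0 < C by exact: lt_le_trans C1.
have [M M0 MP] := @cabs_Cintegral_small rho (C + 1) e ltac:(lra) e0.
exists M => // z sz Mz; have [z0 _] := sz.
rewrite -CintegralZl//; last exact: Cintegrable_resolvent.
rewrite -[X in _ - X](Cintegral_prob_cst rho) -CintegralB//; last 2 first.
- by apply: CintegrableZl => //; exact: Cintegrable_resolvent.
- by apply: (@Cintegrable_bounded _ _ _ _ _ (cabs 1)) => //; exact: Cmeasurable_cst.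
apply: (MP M) => //.
- apply: CmeasurableB => //; last exact: Cmeasurable_cst.
  apply: CmeasurableM => //; first exact: Cmeasurable_cst.
  exact: Cmeasurable_resolvent.
- move=> x; apply: le_trans (cabsB _ _) _.
  by rewrite cabs1 lerD2r sector_resolvent_le.
- move=> x; have h := resolvent_neq0 x z0.
  have -> : z * (z - x%:C)^-1 - 1 = x%:C / (z - x%:C).
    by move: (x%:C) h => q h; field.
  apply: le_trans (sector_resolvent_le2 x C0 M0 Mz sz) _.
  by rewrite ler_wpM2r ?lerDl// divr_ge0// ltW.
Qed.

Lemma Ftransform_sector rho C (e : R) : 1 <= C -> 0 < e ->
  exists2 M : R, 0 < M & forall z, sector C z -> M <= cabs z ->
    Gtransform rho z != 0 /\ cabs (Ftransform rho z - z) <= e * cabs z.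
Proof.
move=> C1 e0; have e10 : 0 < Num.min (e / 2) (1 / 2) by rewrite lt_min !divr_gt0.
have [M M0 MP] := Gtransform_sector rho C1 e10.
exists M => // z sz Mz; have [z0 _] := sz.
have := MP _ sz Mz; rewrite le_min => /andP[].
set G := Gtransform _ _; set q := z * G - 1 => h1 h2.
have zn0 := Im_lt0_neq0 z0.
have zG : z * G = 1 + q by rewrite /q addrC subrK.
have q1 : 1 / 2 <= cabs (1 + q).
  by have := cabs_lerB 1 (- q); rewrite opprK cabsN cabs1; lra.
have q0 : 1 + q != 0 by rewrite -cabs_gt0 (lt_le_trans _ q1).
have G0 : G != 0 by apply: contraNneq q0 => G0; rewrite -zG G0 mulr0.
split=> //; rewrite /Ftransform -/G.
have -> : G^-1 - z = - (q / (1 + q)) * z.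
  by rewrite -zG /q; field; rewrite zn0 G0.
rewrite cabsM cabsN ler_wpM2r ?cabs_ge0// cabsM cabsV ler_pdivrMr; last first.
  by rewrite (lt_le_trans _ q1).
apply: le_trans h1 _; rewrite ler_pM2l//; lra.
Qed.

(** If F takes equal values, the resolvent identity makes (w - z) times the integral of 1 / ((z - x)
    (w - x)) vanish; but z w times this integral is within 1/2 of 1. *)
Lemma Ftransform_sector_inj rho C : 1 <= C ->
  exists2 M : R, 0 < M & forall z w, sector C z -> sector C w ->
    M <= cabs z -> M <= cabs w -> Ftransform rho z = Ftransform rho w -> z = w.
Proof.
move=> C1; have C0 : 0 < C by exact: lt_le_trans C1.
(* The integrand minus 1 is bounded by C^2 + 1, and by (C^2 + C) |x| / M; the constant covers
   both. *)
have [M M0 MP] := @cabs_Cintegral_small rho (C * C + C + 1) (1 / 2)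
  ltac:(by rewrite !addr_ge0// ?mulr_ge0// ltW) ltac:(by rewrite divr_gt0).
exists M => // z w sz sw Mz Mw /invr_inj GE; have [z0 _] := sz; have [w0 _] := sw.
have := GtransformB rho z0 w0; rewrite GE subrr => /esym/eqP.
rewrite mulf_eq0 subr_eq0 => /orP[/eqP//|/eqP I0].
pose k (x : B) := (z - (x : R)%:C)^-1 * (w - (x : R)%:C)^-1.
have mk : Cmeasurable setT k by apply: CmeasurableM => //; exact: Cmeasurable_resolvent.
have ik : Cintegrable rho setT k.
  apply: (@Cintegrable_bounded _ _ _ _ _ (`|Im z|^-1 * `|Im w|^-1)) => //.
  by move=> x; rewrite cabsM ler_pM ?cabs_ge0 ?cabs_resolvent_le.
have : cabs (Cintegral rho setT (fun x => z * w * k x - 1)) <= 1 / 2.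
  apply: (MP M) => //.
  - apply: CmeasurableB => //; last exact: Cmeasurable_cst.
    by apply: CmeasurableM => //; exact: Cmeasurable_cst.
  - move=> x; apply: le_trans (cabsB _ _) _; rewrite cabs1 lerD2r.
    rewrite /k mulrACA cabsM; apply: le_trans (_ : C * C <= _).
      by rewrite ler_pM ?cabs_ge0 ?sector_resolvent_le.
    by rewrite lerDl ltW.
  - move=> x; have hz := resolvent_neq0 x z0; have hw := resolvent_neq0 x w0.
    have -> : z * w * k x - 1 = x%:C / (z - x%:C) * (w / (w - x%:C)) +
        x%:C / (w - x%:C).
      by rewrite /k; move: (x%:C) hz hw => q hz hw; field; rewrite hz hw.
    have bz := sector_resolvent_le2 x C0 M0 Mz sz.
    have bw := sector_resolvent_le2 x C0 M0 Mw sw.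
    have bw' := sector_resolvent_le x C0 sw.
    set t := `|x| / M in bz bw *; have t0 : 0 <= t by rewrite divr_ge0// ltW.
    apply: le_trans (cabsD _ _) _; rewrite cabsM.
    apply: le_trans (lerD (ler_pM (cabs_ge0 _) (cabs_ge0 _) bz bw') bw) _.
    have -> : (C * C + C + 1) * t = C * t * C + C * t + t by ring.
    by rewrite lerDl.
rewrite CintegralB//; last 2 first.
- exact: CintegrableZl.
- by apply: (@Cintegrable_bounded _ _ _ _ _ (cabs 1)) => //; exact: Cmeasurable_cst.
rewrite CintegralZl// I0 mulr0 sub0r Cintegral_prob_cst cabsN cabs1 => h.
exfalso; lra.
Qed.

Lemma nontangential_domain_sector (Omega : set R[i]) C : 1 <= C ->
  nontangential_domain Omega ->
  exists2 M : R, 0 < M & forall z, sector C z -> M <= cabs z -> Omega z.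
Proof.
move=> C1 [beta [beta0 ->]]; have C0 : 0 < C by exact: lt_le_trans C1.
have a0 : 0 < C + 1 by rewrite ltr_wpDl// ltW.
have b0 := beta0 _ a0.
exists (C * (beta (C + 1) + 1)); first by rewrite mulr_gt0// addr_gt0.
move=> z [z0 zC] Mz; exists (C + 1) => //=; split=> //.
  apply: le_lt_trans (cabs_Re z) _; apply: le_lt_trans zC _.
  by rewrite ltr_pM2r ?ltrDl// normr_gt0 lt_eqF.
have := le_trans Mz zC; rewrite ler_pM2l// ltr0_norm//; lra.
Qed.

Lemma right_inverse_F_sector rho Omega H C (e : R) : 1 <= C -> 0 < e ->
  right_inverse_F rho Omega H ->
  exists2 M : R, 0 < M & forall z, sector C z -> M <= cabs z -> Omega z ->
    cabs (H z - z) <= e * cabs z.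
Proof.
move=> C1 e0 [_ _ HH]; have C0 : 0 < C by exact: lt_le_trans C1.
have a0 : 0 < C + 1 by rewrite ltr_wpDl// ltW.
have [M MP] := HH _ _ a0 e0.
exists (`|M| + 1); first by rewrite ltr_wpDl.
move=> z [z0 zC] Mz Oz; have zn0 := Im_lt0_neq0 z0.
have zp : 0 < cabs z by rewrite cabs_gt0.
have h1 : `|complex.Re z| < (C + 1) * `|complex.Im z|.
  apply: le_lt_trans (cabs_Re z) _; apply: le_lt_trans zC _.
  by rewrite ltr_pM2r ?ltrDl// normr_gt0 lt_eqF.
have h2 : (M%:C < `|z|)%R.
  rewrite -cabs_norm ltcR (lt_le_trans _ Mz)//.
  by rewrite (le_lt_trans (ler_norm _))// ltrDl.
have := MP z Oz h1 h2; rewrite -cabs_norm ltcR => /ltW h.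
have -> : H z - z = (H z / z - 1) * z by field.
by rewrite cabsM ler_wpM2r ?cabs_ge0.
Qed.

End sectors.

(** * Subordination for free powers *)

Section free.
Context {R : realType}.
Local Notation B := (measurableTypeR R).
Implicit Types (mu nu rho : borel_probability R) (z w u m : R[i]) (C M : R).

(* For z = F_mu u far out in a sector, the right inverses at z are u for mu and, by
   induction, N u - (N - 1) z for the N-th power: both are close to z, where F is
   injective. *)
Lemma free_power_subordination mu N rho : free_power mu N rho -> (0 < N)%N /\
  forall C, 1 <= C -> exists2 M : R, 0 < M & forall u, sector C u -> M <= cabs u ->
    Ftransform rho (u *+ N - Ftransform mu u *+ N.-1) = Ftransform mu u.
Proof.
elim=> [|{}N nu rho' _ [N0 ih] cv]; split=> // C C1.
  by exists 1 => // u _ _; rewrite mulr1n mulr0n subr0.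
have C0 : 0 < C by exact: lt_le_trans C1.
have C31 : 1 <= 3 * C by lra.
have C91 : 1 <= 3 * (3 * C) by lra.
have [Om1 [Om2 [H1 [H2 [ [nO1 nO2] rH1 rH2 [_ rH _] ]]]]] := cv.
have Np : 0 < N%:R :> R by rewrite ltr0n.
have N1 : 1 <= N%:R :> R by rewrite ler1n.
(* The inverse at z for the N-th power should be w with w - z = N (u - z). As |u| <= 2 |z|, this
   precision makes |w - z| at most |z| / (6 C), the closeness required by [sector_near] with
   aperture 3 C. *)
have eps0 : 0 < (12 * C * N%:R)^-1 by rewrite invr_gt0 !mulr_gt0.
have eps20 : 0 < (6 * C)^-1 by rewrite invr_gt0 mulr_gt0.
have [M0 M00 M0P] := ih C C1.
have [M1 M10 M1P] := Ftransform_sector mu C1 eps0.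
have [M2 M20 M2P] := nontangential_domain_sector C31 nO1.
have [M3 M30 M3P] := nontangential_domain_sector C31 nO2.
have [M4 M40 M4P] := right_inverse_F_sector C31 eps20 rH1.
have [M5 M50 M5P] := right_inverse_F_sector C31 eps20 rH2.
have [M6 M60 M6P] := Ftransform_sector_inj mu C91.
have [M7 M70 M7P] := Ftransform_sector_inj nu C91.
(* Since |u| <= 2 |z| and |z| is at most twice the modulus of each inverse, thresholds on z are
   doubled and thresholds on the inverses quadrupled. *)
pose M := M0 + M1 + 2 * M2 + 2 * M3 + 2 * M4 + 2 * M5 + 4 * M6 + 4 * M7.
exists M; first by rewrite /M; lra.
move=> u su Mu; set z := Ftransform mu u.
have [_ zu] := M1P u su ltac:(rewrite /M in Mu; lra).
have up : 0 <= cabs u by exact: cabs_ge0.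
have zuC : cabs (z - u) <= cabs u / (2 * C).
  apply: le_trans zu _; rewrite mulrC ler_wpM2l// lef_pV2 ?posrE ?mulr_gt0//.
  rewrite -mulrA; have := ler_peMr (ltW C0) N1; lra.
have [sz uz] := sector_near C1 su zuC.
have zp : 0 <= cabs z by exact: cabs_ge0.
have O1z : Om1 z by apply: M2P => //; rewrite /M in Mu; lra.
have O2z : Om2 z by apply: M3P => //; rewrite /M in Mu; lra.
have inv6 t : t <= (6 * C)^-1 * cabs z -> t <= cabs z / (2 * (3 * C)).
  by rewrite mulrC mulrA (_ : 2 * 3 = 6) //; ring.
have h1 : cabs (H1 z - z) <= cabs z / (2 * (3 * C)).
  by apply: inv6; apply: M4P => //; rewrite /M in Mu; lra.
have h2 : cabs (H2 z - z) <= cabs z / (2 * (3 * C)).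
  by apply: inv6; apply: M5P => //; rewrite /M in Mu; lra.
have [s1 z1] := sector_near C31 sz h1.
have [s2 z2] := sector_near C31 sz h2.
pose w := u *+ N - z *+ N.-1.
have wz : w - z = (u - z) *+ N.
  by rewrite /w -addrA -opprD -mulrSr prednK// mulrnBl.
have h3 : cabs (w - z) <= cabs z / (2 * (3 * C)).
  apply: inv6; rewrite wz -[X in cabs X <= _]mulr_natr cabsM.
  rewrite -[N%:R](rmorph_nat (real_complex R)) cabsR ger0_norm// cabs_distC.
  apply: le_trans (_ : (12 * C * N%:R)^-1 * cabs u * N%:R <= _).
    by rewrite ler_wpM2r.
  rewrite (_ : _ * N%:R = (12 * C)^-1 * cabs u); last by field; rewrite !gt_eqF.
  apply: le_trans (_ : (12 * C)^-1 * (2 * cabs z) <= _).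
    by rewrite ler_wpM2l// invr_ge0 mulr_ge0// ltW.
  rewrite le_eqVlt; apply/orP; left; apply/eqP.
  by field; rewrite gt_eqF.
have [s3 z3] := sector_near C31 sz h3.
have [m0 m6 m6' m7 m7'] : [/\ M0 <= cabs u, M6 <= cabs u, M6 <= cabs (H2 z),
    M7 <= cabs (H1 z) & M7 <= cabs w].
  by rewrite /M in Mu; split; lra.
have H2u : H2 z = u.
  apply: M6P => //; last by case: rH2 => _ /(_ _ O2z).
  by apply: sectorS su; lra.
have H1w : H1 z = w.
  apply: M7P => //.
  by case: rH1 => _ /(_ _ O1z) -> _; apply/esym/M0P.
have := rH z (conj O1z O2z); rewrite H1w H2u.
suff -> : u *+ N.+1 - z *+ N.+1.-1 = w + u - z by [].
have zN : z *+ N = z *+ N.-1 + z by rewrite -mulrSr prednK.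
by rewrite /w [u *+ N.+1]mulrSr zN; ring.
Qed.

(** A function that vanishes on the inner disc satisfies the smallness hypothesis of [small_disc]
    for every eta. *)
Lemma poly_approx_identity z0 (rho r : R) (f : R[i] -> R[i]) : 0 < rho ->
  poly_approx z0 r f -> (forall s, cabs (s - z0) <= rho -> f s = 0) ->
  forall s, cabs (s - z0) < r -> f s = 0.
Proof.
move=> rho0 fP f0 s sr; apply/eqP; rewrite -cabs_eq0.
have [M _ fM] := poly_approx_bounded fP.
have [srho|rhos] := leP (cabs (s - z0)) rho; first by rewrite f0// cabs0.
rewrite eq_le cabs_ge0 andbT; apply/ler_addgt0Pr => e e0; rewrite add0r.
have [d d0 H] := small_disc M rho0 (ltW rhos) sr e0.
apply: (H _ _ fP fM _ _ (lexx _)) => t tr.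
by rewrite f0// cabs0 ltW.
Qed.

Lemma disc_Im_le z0 (r : R) s : cabs (s - z0) <= r -> Im s <= Im z0 + r.
Proof.
move=> h; rewrite -lerBlDl -cImN -cImD.
by rewrite (le_trans (ler_norm _))// (le_trans (cabs_Im _)).
Qed.

(* The subordination identity is known only far out in a sector; a large disc centred
   on the negative imaginary axis contains both w and a disc inside that sector. *)
Lemma free_subordination_halfplane mu N rho (c : R) :
  free_power mu N rho -> 0 <= c ->
  (forall w, Im w <= - 1 -> Gtransform mu w != 0 /\
    cabs (Ftransform mu w - w) <= c / N%:R) ->
  forall w, Im w < - (3 * c + 2) ->
    Gtransform rho (w *+ N - Ftransform mu w *+ N.-1) = Gtransform mu w.
Proof.
move=> fp c0 Fc w wK; have [N0 sub] := free_power_subordination fp.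
(* On the disc of radius T / 2 about - i T the modulus is at most 3 T / 2 and |Im s| is at least T /
   2, hence the aperture 3. *)
have [M M0 MP] := sub 3 ltac:(lra).
have Np : 0 < N%:R :> R by rewrite ltr0n.
have N1 : 1 <= N%:R :> R by rewrite ler1n.
(* On Im s <= - K one has |s - F s| <= c and |F s| >= 2 c + 2, so s G(s) is within 1/2 of 1.
   Moreover K > c keeps the image of the disc under [Phi] in the lower half-plane. *)
pose K := 3 * c + 2; pose y := - Im w; pose x := Re w.
have yK : K < y by rewrite /y /K; lra.
have K0 : 0 < K by rewrite /K; lra.
have yK0 : 0 < y - K by lra.
(* 2 M puts the inner disc of radius T / 2 beyond the threshold M; the other summands place w in the
   disc of radius T - (y + K) / 2, strictly inside the disc of radius T - K. *)
pose T := 2 * M + 2 * y + K + 2 * x ^+ 2 / (y - K).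
have q0 : 0 <= 2 * x ^+ 2 / (y - K).
  by rewrite divr_ge0 ?(ltW yK0)// mulr_ge0// sqr_ge0.
have TM : 2 * M <= T by rewrite /T; lra.
have TyK : y + K <= T by rewrite /T; lra.
have T0 : 0 < T by lra.
have Tx : 2 * x ^+ 2 <= T * (y - K).
  rewrite -ler_pdivrMr// /T; lra.
pose u0 : R[i] := 0 -i* T; pose r := T - K.
have Iu0 : Im u0 = - T by [].
have r0 : 0 < r by rewrite /r; lra.
have Im_le s : cabs (s - u0) <= r -> Im s <= - K.
  by move=> /disc_Im_le; rewrite Iu0 /r; lra.
have c_cN : c / N%:R <= c by rewrite ler_pdivrMr// ler_peMr.
pose Phi s := s *+ N - Ftransform mu s *+ N.-1.
have PhiE s : Phi s - s = - ((Ftransform mu s - s) *+ N.-1).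
  by rewrite /Phi mulrnBl -[in s *+ N](prednK N0) mulrSr; ring.
have Phic s : Im s <= - 1 -> cabs (Phi s - s) <= c.
  move=> /Fc[_ h]; rewrite PhiE cabsN -[X in cabs X <= _]mulr_natr cabsM.
  rewrite -[(N.-1)%:R](rmorph_nat (real_complex R)) cabsR ger0_norm//.
  apply: le_trans (_ : c / N%:R * N%:R <= _); last by rewrite divfK ?gt_eqF.
  by rewrite ler_pM ?cabs_ge0// ler_nat leq_pred.
have GP : poly_approx u0 r (Gtransform mu).
  apply: Gtransform_poly_approx; rewrite Iu0 ?oppr_lt0//.
  by rewrite normrN gtr0_norm// /r; lra.
(* F s is written as s (s G(s))^-1: the product s G(s) stays in the disc of radius 1/2 about 1,
   where inversion is a uniform limit of polynomials. *)
have FP : poly_approx u0 r (Ftransform mu).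
  have uGP := poly_approxM (poly_approx_id u0 r) GP.
  have iP : poly_approx 1 (1 / 2) (fun s : R[i] => s^-1).
    by apply: inv_poly_approx; rewrite cabs1; lra.
  have uG s : cabs (s - u0) <= r -> cabs (s * Gtransform mu s - 1) <= 1 / 2.
    move=> /Im_le sK; have [G0 h] := Fc s ltac:(rewrite /K in sK; lra).
    have sn0 : s != 0 by apply: Im_lt0_neq0; lra.
    have Ks : K <= cabs s.
      apply: le_trans (cabs_Im s); rewrite ltr0_norm; lra.
    have -> : s * Gtransform mu s - 1 =
        (s - Ftransform mu s) * Gtransform mu s.
      by rewrite /Ftransform; field.
    have F0 : Ftransform mu s != 0 by rewrite invr_eq0.
    rewrite -[X in _ * X]invrK -/(Ftransform mu s) cabsM cabsV cabs_distC.
    rewrite ler_pdivrMr ?cabs_gt0//.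
    have := cabs_lerB s (s - Ftransform mu s).
    have -> : s - (s - Ftransform mu s) = Ftransform mu s by ring.
    rewrite (cabs_distC s); rewrite /K in Ks; lra.
  apply: poly_approx_ext (poly_approxM (poly_approx_id u0 r)
    (poly_approx_comp uGP uG iP)) => s /Im_le sK.
  have sn0 : s != 0 by apply: Im_lt0_neq0; lra.
  by rewrite invfM mulrA divff// mul1r.
have PhiP : poly_approx u0 r Phi.
  have cst n : poly_approx u0 r (fun=> n%:R) by exact: poly_approx_cst.
  apply: poly_approx_ext (poly_approxB (poly_approxM (poly_approx_id u0 r) (cst N))
    (poly_approxM FP (cst N.-1))) => s _.
  by rewrite !mulr_natr.
have GPhi : poly_approx u0 r (fun s => Gtransform rho (Phi s)).
  apply: (poly_approx_comp (c := u0) (r' := r + c) PhiP).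
    move=> s sr; rewrite -(subrK s (Phi s)) -addrA.
    apply: le_trans (cabsD _ _) _; rewrite [r + c]addrC lerD//.
    by apply: Phic; have := Im_le _ sr; rewrite /K; lra.
  apply: Gtransform_poly_approx; rewrite Iu0 ?oppr_lt0//.
  by rewrite normrN gtr0_norm// /r /K; lra.
have T20 : 0 < T / 2 by lra.
apply/eqP; rewrite -subr_eq0; apply/eqP.
apply: (poly_approx_identity T20 (poly_approxB GPhi GP)).
  move=> s sT; apply/eqP; rewrite subr_eq0; apply/eqP/invr_inj.
  have Is : Im s <= - (T / 2) by have := disc_Im_le sT; rewrite Iu0; lra.
  have cs : T / 2 <= cabs s.
    by apply: le_trans (cabs_Im s); rewrite ltr0_norm; lra.
  apply: MP; last by lra.
  split; first lra.
  rewrite ltr0_norm; last lra.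
  have cu0 : cabs u0 = T by rewrite /= expr0n/= add0r sqrrN sqrtr_sqr gtr0_norm.
  have := cabsD (s - u0) u0; rewrite subrK cu0; lra.
suff h : cabs (w - u0) <= T - (y + K) / 2.
  by apply: le_lt_trans h _; rewrite /r; lra.
have ry : 0 <= T - (y + K) / 2 by lra.
rewrite -(ler_pXn2r (n := 2)) ?nnegrE ?cabs_ge0//.
rewrite sqr_cabs cReD cImD cReN cImN/= oppr0 addr0 opprK -/x.
have -> : Im w = - y by rewrite /y opprK.
have yK2 : 0 <= (y - K) * (y + K).
  by rewrite mulr_ge0 ?(ltW yK0)//; lra.
have : 0 <= (y - K) * (T - (2 * y + K)).
  by rewrite mulr_ge0 ?(ltW yK0)// subr_ge0 /T; lra.
rewrite !expr2 in Tx *; lra.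
Qed.

End free.

(** * Free powers: convergence far down and its extension *)

Section free_convergence.
Context {R : realType}.
Implicit Types (mu nu rho : borel_probability R) (z w u m : R[i]).

(** A quantitative Vitali theorem on discs centred below z at height - T. The inner disc of radius 1
    lies in the region of known convergence; the outer one stays at distance y / 2 from the real
    line, where the difference is at most 4 / y + 2 / y for every N. [small_disc] then carries
    smallness to z, at distance K + 1 from the centre. *)
Lemma Gtransform_cvg_extend (mu_ : nat -> borel_probability R) m (K : R) :
  0 < K -> 0 <= Im m ->
  (forall e : R, 0 < e -> exists N0, forall N, (N0 <= N)%N ->
    forall z, Im z <= - K -> cabs (Gtransform (mu_ N) z - (z - m)^-1) <= e) ->
  forall z, Im z < 0 -> forall e : R, 0 < e -> exists N0, forall N, (N0 <= N)%N ->
    cabs (Gtransform (mu_ N) z - (z - m)^-1) <= e.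
Proof.
move=> K0 m0 H z z0 e e0.
pose y := - Im z; have y0 : 0 < y by rewrite oppr_gt0.
pose T := K + 1 + y; pose r := T - y / 2.
pose u0 : R[i] := Re z -i* T.
have Iu0 : Im u0 = - T by [].
have T0 : 0 < T by rewrite /T; lra.
have rT : r < T by rewrite /r; lra.
have Im_le s : cabs (s - u0) <= r -> Im s <= - (y / 2).
  by move=> /disc_Im_le; rewrite Iu0 /r; lra.
have [d d0 small] := @small_disc R (6 / y) 1 (K + 1) r e ltr01
  ltac:(lra) ltac:(rewrite /r /T; lra) e0.
have [N0 N0P] := H _ d0; exists N0 => N /N0P {}N0P.
have fP : poly_approx u0 r (fun s => Gtransform (mu_ N) s - (s - m)^-1).
  apply: poly_approxB.
    by apply: Gtransform_poly_approx; rewrite Iu0 ?oppr_lt0// normrN gtr0_norm.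
  apply: (poly_approx_comp (c := u0 - m) (r' := r) (h := fun s => s^-1)).
  - by apply: poly_approxB; [exact: poly_approx_id|exact: poly_approx_cst].
  - by move=> s; rewrite opprB addrA subrK.
  apply: inv_poly_approx; apply: lt_le_trans (cabs_Im _).
  by rewrite cImD cImN Iu0 ltr0_norm; lra.
apply: (small u0 _ fP).
- move=> s /Im_le sy; have s0 : Im s < 0 by lra.
  have ys : y / 2 <= `|Im s| by rewrite ltr0_norm//; lra.
  apply: le_trans (cabsB _ _) _.
  have h1 : cabs (Gtransform (mu_ N) s) <= 2 / (y / 2).
    apply: le_trans (cabs_Gtransform_le _ s0) _.
    by rewrite ler_wpM2l// lef_pV2 ?posrE//; lra.
  have h2 : cabs (s - m)^-1 <= (y / 2)^-1.
    have ym : y / 2 <= cabs (s - m).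
      by apply: le_trans (Im_le_cabs_shift s0 m0); lra.
    by rewrite cabsV lef_pV2 ?posrE; lra.
  have -> : 6 / y = 2 / (y / 2) + (y / 2)^-1 by field; rewrite gt_eqF.
  exact: lerD.
- move=> s /disc_Im_le; rewrite Iu0 => sT; apply: N0P.
  by rewrite /T in sT; lra.
have -> : z - u0 = 0 +i* (K + 1).
  apply: complex_eqP; rewrite ?cReD ?cReN ?cImD ?cImN/= ?subrr//.
  by rewrite /T /y; lra.
by rewrite /= expr0n/= add0r sqrtr_sqr gtr0_norm//; lra.
Qed.

(** The subordination identity is used at w = z - m. There P = N w - (N - 1) F(w) is close to z
    because F(w) is w - m / N up to o(1 / N), while G of the dilated measure at w is close to 1 / w
    = 1 / (z - m). The Lipschitz bound replaces P by z. *)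
Lemma free_Gtransform_cvg mu m (muF : nat -> borel_probability R) :
  0 <= Im m -> Gtransform_expansion mu m ->
  (forall N, (0 < N)%N -> free_power (dilation N%:R^-1 mu) N (muF N)) ->
  forall z, Im z < 0 -> forall e : R, 0 < e -> exists N0, forall N, (N0 <= N)%N ->
    cabs (Gtransform (muF N) z - (z - m)^-1) <= e.
Proof.
move=> m0 E fp.
pose c := cabs m + 1; have cm : 0 <= cabs m by exact: cabs_ge0.
have c0 : 0 < c by rewrite /c; lra.
(* Im w <= - K lies below the level - (3 c + 2) of the subordination identity, and |P - w| <= c
   still leaves Im P <= - 1. *)
pose K := 4 * c + 3.
apply: (@Gtransform_cvg_extend _ _ K) => //; first by rewrite /K; lra.
move=> e e0.
pose e1 := Num.min 1 (e / 8).
have e10 : 0 < e1 by rewrite lt_min ltr01 divr_gt0.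
have [N1 N10 N1P] := Ftransform_dilation_expansion E e10 ltr01.
have [N2 N20 N2P] := Gtransform_dilation_expansion E ltr01 ltr01.
pose A := 8 * c / e.
exists (maxn (maxn N1 N2) (Num.trunc A).+1) => N.
rewrite !geq_max => /andP[/andP[/[dup] N1N /N1P F1 /N2P G1] AN] z zK.
have N0 : (0 < N)%N by exact: leq_trans N1N.
have Np : 0 < N%:R :> R by rewrite ltr0n.
have {}AN : A <= N%:R.
  by rewrite ltW// (lt_le_trans (truncnS_gt _))// ler_nat.
set D := dilation _ mu in F1 G1.
have cmN : cabs (m / (N%:R)%:C) = cabs m / N%:R.
  by rewrite cabsM cabsV cabsR gtr0_norm.
have FD w : Im w <= - 1 ->
    Gtransform D w != 0 /\ cabs (Ftransform D w - w) <= c / N%:R.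
  move=> /F1[G0 h]; split=> //.
  rewrite -[X in cabs X](addrK (m / (N%:R)%:C)); apply: le_trans (cabsB _ _) _.
  rewrite cmN /c [leRHS]mulrDl addrC lerD2l; apply: le_trans h _.
  by rewrite ler_wpM2r ?invr_ge0 ?(ltW Np)// ge_min lexx.
have sub := free_subordination_halfplane (fp N N0) (ltW c0) FD.
have [w wE] : exists w, w = z - m by exists (z - m).
have wK : Im w <= - K by rewrite wE cImD cImN; lra.
have wK2 : Im w < - (3 * c + 2) by rewrite /K in wK; lra.
have w1 : Im w <= - 1 by lra.
have {}sub := sub w wK2.
set P := w *+ N - _ in sub.
have [_ Fw] := F1 w w1; have Gw := G1 w w1.
have mulN (t : R[i]) k : t *+ k = (k%:R)%:C * t.
  by rewrite rmorph_nat mulr_natl.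
have nC0 : (N%:R)%:C != 0 :> R[i].
  by rewrite -cabs_gt0 cabsR normr_gt0 gt_eqF.
have PE : P - z = - ((Ftransform D w - w + m / (N%:R)%:C) *+ N.-1) - m / (N%:R)%:C.
  have mE : m = (m / (N%:R)%:C) *+ N.-1 + m / (N%:R)%:C.
    by rewrite -mulrSr prednK// mulN mulrCA divff// mulr1.
  have zE : z = w + ((m / (N%:R)%:C) *+ N.-1 + m / (N%:R)%:C).
    by rewrite -mE wE subrK.
  rewrite zE /P -[in w *+ N](prednK N0) mulrSr.
  rewrite !mulrnDl mulNrn -/D.
  by ring.
have Pz : cabs (P - z) <= e / 4.
  rewrite PE; apply: le_trans (cabsB _ _) _; rewrite cabsN cmN.
  have -> : e / 4 = e / 8 + e / 8 by lra.
  apply: lerD.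
    rewrite mulN cabsM cabsR ger0_norm//.
    apply: le_trans (_ : N%:R * (e / 8 / N%:R) <= _); last first.
      by rewrite mulrC divfK// gt_eqF.
    apply: ler_pM; rewrite ?cabs_ge0 ?ler_nat ?leq_pred//.
    apply: le_trans Fw _; rewrite ler_wpM2r ?invr_ge0 ?(ltW Np)//.
    by rewrite ge_min lexx orbT.
  rewrite ler_pdivrMr//.
  by move: AN; rewrite /A ler_pdivrMr// /c; lra.
have zK1 : 1 <= `|Im z| by rewrite ltr0_norm; rewrite /K in zK; lra.
have Pw : cabs (P - w) <= c.
  have -> : P - w = - ((Ftransform D w - w) *+ N.-1).
    by rewrite /P -[in w *+ N](prednK N0) mulrSr mulrnDl mulNrn -/D; ring.
  rewrite cabsN mulN cabsM cabsR ger0_norm//.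
  have [_ h] := FD w w1.
  apply: le_trans (_ : N%:R * (c / N%:R) <= _); last first.
    by rewrite mulrC divfK// gt_eqF.
  by apply: ler_pM; rewrite ?cabs_ge0 ?ler_nat ?leq_pred.
have P1 : Im P <= - 1.
  by have := disc_Im_le Pw; rewrite /K in wK; lra.
have P0 : Im P < 0 by lra.
have z0 : Im z < 0 by rewrite /K in zK; lra.
have PK1 : 1 <= `|Im P| by rewrite ltr0_norm; lra.
have h1 : cabs (Gtransform (muF N) z - Gtransform (muF N) P) <= e / 2.
  apply: le_trans (Gtransform_lipschitz _ z0 P0) _.
  rewrite ler_pdivrMr ?mulr_gt0 ?normr_gt0 ?lt_eqF// cabs_distC.
  apply: (@le_trans _ _ (e / 2)); first lra.
  rewrite ler_peMr ?divr_ge0 ?(ltW e0)//.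
  by rewrite -[1]mulr1 ler_pM.
have h2 : cabs (Gtransform D w - w^-1) <= e / 2.
  have cw : 1 <= cabs w.
    by apply: le_trans (cabs_Im w); rewrite ltr0_norm; lra.
  have wn0 : w != 0 by apply: Im_lt0_neq0; lra.
  have -> : Gtransform D w - w^-1 =
      ((w ^+ 2 * Gtransform D w - w - m / (N%:R)%:C) + m / (N%:R)%:C) / w ^+ 2.
    by rewrite subrK; field.
  rewrite cabsM cabsV cabsX ler_pdivrMr ?exprn_gt0 ?(lt_le_trans _ cw)//.
  apply: (@le_trans _ _ (e / 2)); last first.
    by rewrite ler_peMr ?divr_ge0 ?(ltW e0)// exprn_ege1.
  apply: le_trans (cabsD _ _) _; rewrite cmN.
  apply: (@le_trans _ _ (c / N%:R)).
    by rewrite /c [leRHS]mulrDl addrC lerD2l.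
  rewrite ler_pdivrMr//.
  by move: AN; rewrite /A ler_pdivrMr// /c; lra.
rewrite -sub in h2; rewrite -wE.
rewrite -(subrK (Gtransform (muF N) P) (Gtransform (muF N) z)) -addrA.
by apply: le_trans (cabsD _ _) _; rewrite (splitr e) lerD.
Qed.

End free_convergence.

(** * Expansion of the Stieltjes transform in the class P2 *)

Section outer_integrals.
Context {R : realType}.
Local Notation leb := (@lebesgue_measure R).
Implicit Types (f F : R -> R) (rho x y u l : R).

(** The indicator is kept as a real factor so that all integrals run over the whole line. *)
Definition outer rho x : R := if rho <= `|x| then 1 else 0.

Lemma measurable_outer rho : measurable_fun setT (outer rho).
Proof.
apply: measurable_fun_ifT => //.
by apply: measurable_fun_ler => //; exact: normr_measurable.
Qed.

Lemma outer_ge0 rho x : 0 <= outer rho x.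
Proof. by rewrite /outer; case: ifP. Qed.

Lemma continuous_FTC2_Rintegral f F x y : x < y ->
  (forall t, x <= t <= y -> {for t, continuous f}) ->
  (forall t, x <= t <= y -> is_derive t 1 F (f t)) ->
  leb.-integrable `[x, y] (EFin \o f) /\ \int[leb]_(t in `[x, y]) f t = F y - F x.
Proof.
move=> xy cf dF.
have cw : {within `[x, y], continuous f}.
  apply: continuous_in_subspaceT => t; rewrite inE/= in_itv/=; exact: cf.
have cF t : x <= t <= y -> {for t, continuous F}.
  move=> /dF h; apply: differentiable_continuous.
  by apply/derivable1_diffP; exact: ex_derive.
split.
  by apply: continuous_compact_integrable => //; exact: segment_compact.
rewrite /Rintegral (continuous_FTC2 (F := F) xy cw)//.
  split.
  - by move=> t; rewrite in_itv/= => /andP[/ltW xt /ltW ty];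
      have := dF t; rewrite xt ty => /(_ isT) h; exact: ex_derive.
  - by apply: cvg_at_right_filter; apply: cF; rewrite lexx ltW.
  - by apply: cvg_at_left_filter; apply: cF; rewrite lexx ltW.
move=> t; rewrite in_itv/= => /andP[/ltW xt /ltW ty].
by have := dF t; rewrite xt ty => /(_ isT) h; rewrite derive1E derive_val.
Qed.

(** Both half-lines are cut together, at n and - n, so that only the limit of F(n) - F(-n) has to be
    found; dominated convergence passes from the cut integrals to the full one. *)
Lemma FTC_outer f F rho l : 0 < rho ->
  (forall x, rho <= `|x| -> {for x, continuous f}) ->
  (forall x, rho <= `|x| -> is_derive x 1 F (f x)) ->
  leb.-integrable setT (EFin \o (fun x => outer rho x * f x)) ->
  (fun n => F n%:R - F (- n%:R)) @ \oo --> l ->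
  \int[leb]_x (outer rho x * f x) = l + F (- rho) - F rho.
Proof.
move=> rho0 cf dF fi Fl.
pose D n : set R := `[- n%:R, - rho]%classic `|` `[rho, n%:R]%classic.
have mD n : measurable (D n) by exact: measurableU.
have mf : measurable_fun setT (fun x => outer rho x * f x).
  by apply/measurable_EFinP; exact: measurable_int fi.
have DE n x : (x \in D n) = (rho <= `|x|) && (`|x| <= n%:R).
  apply/idP/idP; rewrite inE /D /= !in_itv/=.
    move=> [/andP[h1 h2]|/andP[h1 h2]].
      by rewrite ler0_norm; [apply/andP; split; lra|lra].
    by rewrite ger0_norm; [apply/andP; split; lra|lra].
  move=> /andP[h1 h2]; have [x0|x0] := leP 0 x.
    by right; rewrite ger0_norm// in h1 h2; rewrite h1.
  by left; rewrite ltr0_norm// in h1 h2; apply/andP; split; lra.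
have cvgI : (fun n => \int[leb]_x (fun x => (outer rho x * f x) * \1_(D n) x) x)
    @ \oo --> \int[leb]_x (outer rho x * f x).
  apply: (@Rdominated_convergence _ _ _ leb setT _ _
    (fun x => `|outer rho x * f x|)) => //.
  - move=> n; by apply: measurable_funM => //; apply: measurable_indic; exact: mD.
  - move=> x _; apply: cvg_near_cst; exists (Num.trunc `|x|).+1 => // n /= xn.
    rewrite indicE DE; have [rx|rx] := boolP (rho <= `|x|); last first.
      by rewrite /outer (negbTE rx) !mul0r.
    rewrite (_ : `|x| <= n%:R) ?mulr1//.
    by rewrite ltW// (lt_le_trans (truncnS_gt _))// ler_nat.
  - exact: Rintegrable_norm.
  - move=> n x _; rewrite normrM ler_piMr// indicE.
    by case: (_ \in _); rewrite ?normr1 ?normr0.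
have E : \forall n \near \oo, F n%:R - F (- n%:R) + (F (- rho) - F rho) =
    \int[leb]_x (fun x => (outer rho x * f x) * \1_(D n) x) x.
  exists (Num.trunc rho).+1 => // n /= rn.
  have {}rn : rho < n%:R by rewrite (lt_le_trans (truncnS_gt _))// ler_nat.
  have [i1 e1] := @continuous_FTC2_Rintegral f F (- n%:R) (- rho)
    ltac:(by rewrite ltrN2)
    ltac:(by move=> t /andP[t1 t2]; apply: cf; rewrite ler0_norm; lra)
    ltac:(by move=> t /andP[t1 t2]; apply: dF; rewrite ler0_norm; lra).
  have [i2 e2] := @continuous_FTC2_Rintegral f F rho n%:R rn
    ltac:(by move=> t /andP[t1 t2]; apply: cf; rewrite ger0_norm; lra)
    ltac:(by move=> t /andP[t1 t2]; apply: dF; rewrite ger0_norm; lra).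
  rewrite (_ : (fun _ => _) = f \_ (D n)); last first.
    apply/funext => x; rewrite patchE indicE; case: ifPn => xD.
      by move: xD; rewrite DE => /andP[h _]; rewrite /outer h mul1r mulr1.
    by rewrite mulr0.
  rewrite -Rintegral_mkcond /D Rintegral_setU//.
  - by rewrite e1 e2; ring.
  - have iD : leb.-integrable (D n) (EFin \o (fun x => outer rho x * f x)).
      by apply: integrableS fi => //; exact: mD.
    apply: eq_integrable iD => //; first exact: mD.
    by move=> x; rewrite DE => /andP[h _]; rewrite /= /outer h mul1r.
  - apply/disj_setPS => x [] /=; rewrite !in_itv/= => /andP[_ h1] /andP[h2 _].
    lra.
have Fl' : (fun n => F n%:R - F (- n%:R) + (F (- rho) - F rho)) @ \oo -->
    l + (F (- rho) - F rho) by apply: cvgD => //; exact: cvg_cst.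
have cvgI' := cvg_trans (near_eq_cvg E) Fl'.
rewrite -addrA.
exact: (cvg_unique (@norm_hausdorff _ R^o) cvgI (cvgI' _)).
Qed.

(** Integrability of x^-2 outside an interval is borrowed from the standard Cauchy density. *)
Lemma outer_sqr_le rho x : 0 < rho ->
  outer rho x * x ^- 2 <= (pi * (1 + rho ^- 2)) * cauchy_pdf 0 1 x.
Proof.
move=> rho0; rewrite /outer; case: ifPn => [rx|_]; last first.
  rewrite mul0r mulr_ge0 ?cauchy_pdf_ge0// mulr_ge0 ?pi_ge0 ?addr_ge0//.
  by rewrite invr_ge0 sqr_ge0.
have r2 : rho ^+ 2 <= x ^+ 2.
  by rewrite -[x ^+ 2]real_normK ?num_real// lerXn2r// nnegrE ltW.
have rp : 0 < rho ^+ 2 by rewrite exprn_gt0.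
have xp : 0 < x ^+ 2 by exact: lt_le_trans r2.
have pp : pi != 0 :> R by rewrite gt_eqF ?pi_gt0.
rewrite mul1r /cauchy_pdf subr0 expr1n mulrACA divff// !mul1r.
have x1 : 0 < x ^+ 2 + 1 by rewrite addr_gt0.
rewrite ler_pdivlMr// mulrDr mulVf ?gt_eqF// mulr1 lerD2l.
by rewrite lef_pV2.
Qed.

Lemma integrable_outer_sqr rho : 0 < rho ->
  leb.-integrable setT (EFin \o (fun x => outer rho x * x ^- 2)).
Proof.
move=> rho0.
refine (@le_Rintegrable _ _ _ leb setT (fun x => outer rho x * x ^- 2)
  (fun x => (pi * (1 + rho ^- 2)) * cauchy_pdf 0 1 x) _ _ _ _) => //.
- apply: measurable_funM; first exact: measurable_outer.
  by apply: measurable_funV => //; exact: exprn_measurable.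
- exact: integrable_Zcauchy.
move=> x _; rewrite ger0_norm; first exact: outer_sqr_le.
by rewrite mulr_ge0 ?outer_ge0// invr_ge0 sqr_ge0.
Qed.

Lemma is_derive_inv_pow (j : nat) x : x != 0 ->
  is_derive x 1 (fun t : R => - (j.+1%:R^-1) * t ^- j.+1) (x ^- j.+2).
Proof.
move=> x0.
have h1 : is_derive x 1 (fun t : R => t ^+ j.+1) (j.+1%:R * x ^+ j).
  apply: DeriveDef; first exact: exprn_derivable.
  by rewrite exp_derive [LHS]mulr1.
have xj : x ^+ j.+1 != 0 by rewrite expf_neq0.
have h2 : is_derive x 1 (fun t : R => t ^- j.+1)
    (- (x ^+ j.+1) ^- 2 * (j.+1%:R * x ^+ j)).
  apply: DeriveDef; first by apply: derivableV => //; exact: ex_derive.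
  by rewrite deriveV//= derive_val.
have h3 := is_deriveZ (- (j.+1%:R^-1)) h2.
apply: is_derive_eq h3 _; rewrite /GRing.scale/=.
have jn : j.+1%:R != 0 :> R by rewrite pnatr_eq0.
have t0 : x ^+ j != 0 by rewrite expf_neq0.
rewrite !exprS; move: (x ^+ j) (j.+1%:R) t0 jn => t k t0 k0.
by field; rewrite k0 x0 t0.
Qed.

Lemma cvg_inv_pow (j : nat) : (fun n => (n%:R : R) ^- j.+1) @ \oo --> 0.
Proof.
apply: (@squeeze_cvgr _ _ _ _ (fun=> 0) (fun n => n%:R^-1)); last 2 first.
- exact: cvg_cst.
- by rewrite -cvg_shiftS; exact: cvg_harmonic.
exists 1%N => // n /= n1; rewrite invr_ge0 exprn_ge0//=.
rewrite lef_pV2 ?posrE ?exprn_gt0 ?ltr0n//.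
by rewrite exprS ler_peMr// exprn_ege1// ler1n.
Qed.

Lemma continuous_inv_pow (j : nat) x : x != 0 ->
  {for x, continuous (fun t : R => t ^- j)}.
Proof.
by move=> x0; apply: cvgV; [rewrite expf_neq0|exact: exprn_continuous].
Qed.

Lemma outer_inv_pow_le rho (j : nat) x : 0 < rho ->
  `|outer rho x * x ^- j.+2| <= rho ^- j * (outer rho x * x ^- 2).
Proof.
move=> rho0; rewrite /outer; case: ifPn => [rx|_]; last first.
  by rewrite !mul0r normr0 mulr0.
rewrite !mul1r normfV normrX -[x ^+ 2]real_normK ?num_real//.
have x0 : 0 < `|x| by exact: lt_le_trans rx.
rewrite -addn2 exprD invfM ler_wpM2r ?invr_ge0 ?sqr_ge0//.
by rewrite lef_pV2 ?posrE ?exprn_gt0// lerXn2r// nnegrE ltW.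
Qed.

Lemma integrable_outer_inv_pow rho (j : nat) : 0 < rho ->
  leb.-integrable setT (EFin \o (fun x => outer rho x * x ^- j.+2)).
Proof.
move=> rho0.
refine (@le_Rintegrable _ _ _ leb setT (fun x => outer rho x * x ^- j.+2)
  (fun x => rho ^- j * (outer rho x * x ^- 2)) _ _ _ _) => //.
- apply: measurable_funM; first exact: measurable_outer.
  by apply: measurable_funV => //; exact: exprn_measurable.
- by apply: RintegrableZl => //; exact: integrable_outer_sqr.
- by move=> x _; exact: outer_inv_pow_le.
Qed.

(** Under x -> -x the antiderivative is multiplied by (-1)^(j+1), whence the numerator. The same
    value is found below for the integral of z^(-j-2) over the arc. *)
Lemma Rintegral_outer_inv_pow rho (j : nat) : 0 < rho ->
  \int[leb]_x (outer rho x * x ^- j.+2) =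
  (1 - (-1) ^+ j.+1) / (j.+1%:R * rho ^+ j.+1).
Proof.
move=> rho0.
have x0 x : rho <= `|x| -> x != 0.
  by move=> rx; rewrite -normr_gt0 (lt_le_trans _ rx).
pose F x := - (j.+1%:R^-1) * x ^- j.+1 : R.
have FE x : F (- x) = F x * (-1) ^+ j.+1.
  by rewrite /F (exprNn x) invfM -signr_odd invr_sign signr_odd; ring.
have -> : \int[leb]_x (outer rho x * x ^- j.+2) = 0 + F (- rho) - F rho.
  apply: FTC_outer => //.
  - by move=> x /x0; exact: continuous_inv_pow.
  - by move=> x /x0; exact: is_derive_inv_pow.
  - exact: integrable_outer_inv_pow.
  rewrite (_ : 0 = - (j.+1%:R^-1) * 0 * (1 - (-1) ^+ j.+1)); last first.
    by rewrite mulr0 mul0r.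
  rewrite (_ : (fun _ => _) = (fun n : nat =>
    - (j.+1%:R^-1) * n%:R ^- j.+1 * (1 - (-1) ^+ j.+1))); last first.
    by apply/funext => n; rewrite FE /F; ring.
  apply: cvgM; last exact: cvg_cst.
  by apply: cvgM; [exact: cvg_cst|exact: cvg_inv_pow].
by rewrite FE /F invfM; ring.
Qed.

End outer_integrals.

(** * The principal value integral of 1 / x + 1 / (v - x) *)

Section principal_value.
Context {R : realType}.
Local Notation B := (measurableTypeR R).
Local Notation leb := (@lebesgue_measure R).
Implicit Types (rho x y u s : R) (v : R[i]).

Lemma sqr_cabs_resolvent v x : cabs (v - x%:C) ^+ 2 = (x - Re v) ^+ 2 + Im v ^+ 2.
Proof. by rewrite sqr_cabs cReD cReN Im_resolvent/= -sqrrN opprB. Qed.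

Lemma cauchy_pdf_resolvent v x : Im v < 0 ->
  cabs (v - x%:C) ^- 2 = pi / - Im v * cauchy_pdf (Re v) (- Im v) x.
Proof.
move=> v0; have p0 : pi != 0 :> R by rewrite gt_eqF ?pi_gt0.
have y0 : - Im v != 0 by rewrite oppr_eq0 lt_eqF.
rewrite sqr_cabs_resolvent /cauchy_pdf sqrrN.
by rewrite mulrACA divff// mul1r mulrA mulVf// mul1r.
Qed.

(** The inequality 2 p q <= s p^2 + q^2 / s separates |x|^-1 from the resolvent. Both squares have
    explicit integrals, the second of order 1 / |Im v|, and s remains free. *)
Lemma outer_AMGM rho x v s : 0 < s -> Im v < 0 ->
  outer rho x * (`|x|^-1 * (cabs (v - x%:C))^-1) <=
  2^-1 * (s * (outer rho x * x ^- 2) +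
          s^-1 * (pi / - Im v * cauchy_pdf (Re v) (- Im v) x)).
Proof.
move=> s0 v0; rewrite -cauchy_pdf_resolvent//.
set p := `|x|^-1; set q := (cabs _)^-1.
have -> : x ^- 2 = p ^+ 2 by rewrite /p exprVn real_normK ?num_real.
have -> : cabs (v - x%:C) ^- 2 = q ^+ 2 by rewrite /q exprVn.
rewrite /outer; case: ifPn => _; last first.
  rewrite !mul0r mulr0 add0r; apply: mulr_ge0 => //.
  by apply: mulr_ge0; [rewrite invr_ge0 ltW|exact: sqr_ge0].
rewrite !mul1r.
have h : 0 <= s^-1 * (s * p - q) ^+ 2.
  by rewrite mulr_ge0 ?sqr_ge0 ?invr_ge0 ?ltW.
have : s^-1 * (s * p - q) ^+ 2 = s * p ^+ 2 + s^-1 * q ^+ 2 - 2 * (p * q).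
  by field; rewrite gt_eqF.
lra.
Qed.

Lemma integrable_outer_AMGM rho v (c s : R) : 0 < rho -> Im v < 0 ->
  leb.-integrable setT (EFin \o (fun x => 2^-1 * (s * (outer rho x * x ^- 2) +
    c * (pi / - Im v * cauchy_pdf (Re v) (- Im v) x)))).
Proof.
move=> rho0 v0; have y0 : 0 < - Im v by rewrite oppr_gt0.
apply: RintegrableZl => //.
exact: (RintegrableD measurableT
  (RintegrableZl s measurableT (integrable_outer_sqr rho0))
  (RintegrableZl c measurableT (integrable_Zcauchy _ _ y0))).
Qed.

Lemma Rintegral_outer_AMGM rho v (c s : R) : 0 < rho -> Im v < 0 ->
  \int[leb]_x (2^-1 * (s * (outer rho x * x ^- 2) +
    c * (pi / - Im v * cauchy_pdf (Re v) (- Im v) x))) =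
  2^-1 * (s * \int[leb]_x (outer rho x * x ^- 2) + c * (pi / - Im v)).
Proof.
move=> rho0 v0; have y0 : 0 < - Im v by rewrite oppr_gt0.
have i1 := integrable_outer_sqr rho0.
have i2 := integrable_Zcauchy (pi / - Im v) (Re v) y0.
have i1' := RintegrableZl s measurableT i1.
have i2' := RintegrableZl c measurableT i2.
rewrite (RintegralZl _ _ (RintegrableD measurableT i1' i2'))//.
rewrite (RintegralD _ i1' i2')// (RintegralZl _ _ i1)// (RintegralZl _ _ i2)//.
by rewrite Rintegral_Zcauchy.
Qed.

(* v^2 / (x^2 (v - x)) = v / x^2 + 1 / x + 1 / (v - x), and only the sum of the last
   two terms is integrable at infinity. *)
Definition pv_kernel rho v (x : B) : R[i] :=
  (outer rho (x : R))%:C * (((x : R)%:C)^-1 + (v - (x : R)%:C)^-1).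

Lemma measurable_pv_kernel rho v : Cmeasurable setT (pv_kernel rho v).
Proof.
apply: CmeasurableM => //.
  by apply: Cmeasurable_real; exact: measurable_outer.
apply: CmeasurableD; last exact: Cmeasurable_resolvent.
by apply: CmeasurableV => //; apply: Cmeasurable_real; exact: measurable_id.
Qed.

Lemma cabs_pv_kernel rho v (x : R) : 0 < rho -> Im v < 0 ->
  cabs (pv_kernel rho v x) =
  cabs v * (outer rho x * (`|x|^-1 * (cabs (v - x%:C))^-1)).
Proof.
move=> rho0 v0; rewrite /pv_kernel cabsM cabsR (ger0_norm (outer_ge0 _ _)).
rewrite /outer; case: ifPn => rx; last by rewrite !mul0r mulr0.
have x0 : x%:C != 0 :> R[i] by rewrite -cabs_gt0 cabsR (lt_le_trans _ rx).
have vx := resolvent_neq0 x v0.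
have -> : x%:C^-1 + (v - x%:C)^-1 = v * (x%:C^-1 * (v - x%:C)^-1).
  by move: (x%:C) x0 vx => q q0 vq; field; rewrite q0 vq.
by rewrite !mul1r !cabsM !cabsV cabsR.
Qed.

Lemma Cintegrable_pv_kernel rho v : 0 < rho -> Im v < 0 ->
  Cintegrable leb setT (pv_kernel rho v).
Proof.
move=> rho0 v0.
have i := RintegrableZl (cabs v) measurableT
  (integrable_outer_AMGM 1^-1 1 rho0 v0).
refine (le_Cintegrable measurableT (measurable_pv_kernel rho v) i _).
move=> x _; rewrite cabs_pv_kernel// ler_wpM2l ?cabs_ge0//.
exact: outer_AMGM.
Qed.

(** From ln (1 + t) <= t; the factor symmetric in p and q serves both orders at once. *)
Lemma ln_dist_le (p q : R) : 0 < p -> 0 < q ->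
  `|ln p - ln q| <= `|p - q| * (p^-1 + q^-1).
Proof.
suff H (a b : R) : 0 < a -> 0 < b -> ln a - ln b <= `|a - b| * (a^-1 + b^-1).
  move=> p0 q0; rewrite ler_norml H// andbT lerNl opprB distrC [_^-1 + _]addrC.
  exact: H.
move=> a0 b0; rewrite -ln_div ?posrE//.
have -> : a / b = 1 + (a - b) / b by field; rewrite gt_eqF.
apply: le_trans (le_ln1Dx _) _.
  have -> : (a - b) / b = a / b - 1 by field; rewrite gt_eqF.
  by rewrite ltrBrDr addNr divr_gt0.
apply: (@le_trans _ _ (`|a - b| / b)).
  by rewrite ler_wpM2r ?ler_norm// invr_ge0 ltW.
by rewrite ler_wpM2l// lerDr invr_ge0 ltW.
Qed.

(** The arguments differ by 4 L u, and |u| <= |L - u| + L and |u| <= |L + u| + L let the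
    denominators absorb u. The bound is thus uniform in u, which will be Re v. *)
Lemma pv_log_le (L u y : R) : 0 < L -> 0 < y ->
  `|ln ((L - u) ^+ 2 + y ^+ 2) - ln ((L + u) ^+ 2 + y ^+ 2)| <=
  4 * L * (y^-1 + 2 * L / y ^+ 2).
Proof.
move=> L0 y0; have y20 : 0 < y ^+ 2 by rewrite exprn_gt0.
have dp (t : R) : 0 < t ^+ 2 + y ^+ 2 by rewrite ltr_wpDl ?sqr_ge0.
apply: le_trans (ln_dist_le (dp _) (dp _)) _.
have -> : (L - u) ^+ 2 + y ^+ 2 - ((L + u) ^+ 2 + y ^+ 2) = - (4 * L * u) by ring.
have L4 : 0 <= 4 * L by rewrite mulr_ge0// ltW.
rewrite normrN normrM (ger0_norm L4) -[leLHS]mulrA ler_wpM2l//.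
have H (t : R) : `|u| <= `|t| + L ->
    `|u| / (t ^+ 2 + y ^+ 2) <= (2 * y)^-1 + L / y ^+ 2.
  move=> ut; apply: (@le_trans _ _ ((`|t| + L) / (t ^+ 2 + y ^+ 2))).
    by rewrite ler_wpM2r// invr_ge0 ltW.
  rewrite mulrDl lerD//.
    rewrite ler_pdivrMr// mulrC ler_pdivlMr ?mulr_gt0//.
    rewrite -[t ^+ 2]real_normK ?num_real//.
    have := sqr_ge0 (`|t| - y); rewrite !expr2; lra.
  by rewrite ler_wpM2l ?(ltW L0)// lef_pV2 ?posrE// lerDr sqr_ge0.
rewrite mulrDr; have h1 : `|u| <= `|L - u| + L.
  by have := ler_normB L (L - u); rewrite opprB addrC subrK (gtr0_norm L0); lra.
have h2 : `|u| <= `|L + u| + L.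
  by have := ler_normB (L + u) L; rewrite addrC addKr (gtr0_norm L0); lra.
have := H _ h1; have := H _ h2.
have -> : y^-1 + 2 * L / y ^+ 2 =
  ((2 * y)^-1 + L / y ^+ 2) + ((2 * y)^-1 + L / y ^+ 2) by field; rewrite gt_eqF.
lra.
Qed.

Lemma pv_log_cvg u y : 0 < y ->
  (fun n => ln ((n%:R - u) ^+ 2 + y ^+ 2) - ln ((n%:R + u) ^+ 2 + y ^+ 2))
  @ \oo --> (0 : R).
Proof.
move=> y0; apply/cvgrPdist_le => e e0.
(* Beyond 2 |u| both n - u and n + u are at least n / 2, and the resulting bound is 32 |u| / n. *)
pose A := 2 * `|u| + 1 + 32 * `|u| / e.
exists (Num.trunc A).+1 => // n /= An.
have {}An : A <= n%:R by rewrite ltW// (lt_le_trans (truncnS_gt _))// ler_nat.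
have q0 : 0 <= 32 * `|u| / e by rewrite divr_ge0 ?mulr_ge0// ltW.
have u0 : 0 <= `|u| by exact: normr_ge0.
set L : R := n%:R in An *.
have L1 : 2 * `|u| + 1 <= L by rewrite /A in An; lra.
have L0 : 0 < L by lra.
have Le : 32 * `|u| <= e * L.
  by rewrite [e * L]mulrC -ler_pdivrMr//; rewrite /A in An; lra.
have dp (t : R) : L / 2 <= `|t| -> L ^+ 2 / 4 <= t ^+ 2 + y ^+ 2.
  move=> Lt; apply: (@le_trans _ _ (t ^+ 2)); last by rewrite lerDl sqr_ge0.
  have -> : L ^+ 2 / 4 = (L / 2) ^+ 2 by field.
  by rewrite -[t ^+ 2]real_normK ?num_real// lerXn2r// nnegrE; lra.
have Lp : 0 < L ^+ 2 / 4 by rewrite divr_gt0// exprn_gt0.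
have p1 : L ^+ 2 / 4 <= (L - u) ^+ 2 + y ^+ 2.
  by apply: dp; have := lerB_dist L u; rewrite (gtr0_norm L0); lra.
have p2 : L ^+ 2 / 4 <= (L + u) ^+ 2 + y ^+ 2.
  by apply: dp; have := lerB_dist L (- u); rewrite normrN opprK (gtr0_norm L0); lra.
rewrite sub0r normrN.
apply: le_trans (ln_dist_le (lt_le_trans Lp p1) (lt_le_trans Lp p2)) _.
have -> : (L - u) ^+ 2 + y ^+ 2 - ((L + u) ^+ 2 + y ^+ 2) = - (4 * L * u) by ring.
have L4 : 0 <= 4 * L by rewrite mulr_ge0// ltW.
rewrite normrN normrM (ger0_norm L4).
apply: (@le_trans _ _ (4 * L * `|u| * ((L ^+ 2 / 4)^-1 + (L ^+ 2 / 4)^-1))).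
  rewrite ler_wpM2l ?mulr_ge0 ?(ltW L0)//.
  by rewrite lerD// lef_pV2 ?posrE// (lt_le_trans Lp).
have -> : 4 * L * `|u| * ((L ^+ 2 / 4)^-1 + (L ^+ 2 / 4)^-1) = 32 * `|u| / L.
  by field; rewrite gt_eqF.
by rewrite ler_pdivrMr.
Qed.

Lemma is_derive_ln_sqr (a c x : R) : 0 < (x - a) ^+ 2 + c ->
  is_derive x 1 (fun t => ln ((t - a) ^+ 2 + c))
    (2 * (x - a) / ((x - a) ^+ 2 + c)).
Proof.
move=> p0.
have h0 : is_derive x 1 (fun t : R => t - a) (1 : R).
  by apply: is_derive_eq; rewrite oppr0 addr0.
have h1 : is_derive x 1 (fun t : R => (t - a) * (t - a) + c) (2 * (x - a)).
  apply: is_derive_eq (is_deriveD (is_deriveM h0 h0) (is_derive_cst c x 1)) _.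
  by rewrite /GRing.scale/=; ring.
have -> : (fun t => ln ((t - a) ^+ 2 + c)) =
  (@ln R) \o (fun t : R => (t - a) * (t - a) + c) by [].
have p1 : 0 < (x - a) * (x - a) + c by rewrite -expr2.
have := @is_derive1_comp R (@ln R) (fun t : R => (t - a) * (t - a) + c) x _ _
  (is_derive1_ln p1) h1.
by rewrite mulrC -expr2.
Qed.

Lemma pv_Re_integral rho u y : 0 < rho -> 0 < y ->
  leb.-integrable setT (EFin \o
    (fun x => outer rho x * (x^-1 - (x - u) / ((x - u) ^+ 2 + y ^+ 2)))) ->
  \int[leb]_x (outer rho x * (x^-1 - (x - u) / ((x - u) ^+ 2 + y ^+ 2))) =
  2^-1 * (ln ((rho - u) ^+ 2 + y ^+ 2) - ln ((rho + u) ^+ 2 + y ^+ 2)).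
Proof.
move=> rho0 y0 fi; have y20 : 0 < y ^+ 2 by rewrite exprn_gt0.
have dp (t : R) : 0 < (t - u) ^+ 2 + y ^+ 2 by rewrite ltr_wpDl ?sqr_ge0.
have x0 x : rho <= `|x| -> x != 0.
  by move=> rx; rewrite -normr_gt0 (lt_le_trans _ rx).
(* The null terms put ln t^2 in the form of [is_derive_ln_sqr]; this even part cancels in F t - F (-
   t). *)
pose F (t : R) := 2^-1 * (ln ((t - 0) ^+ 2 + 0) - ln ((t - u) ^+ 2 + y ^+ 2)).
have FE (t : R) : F t - F (- t) =
    - 2^-1 * (ln ((t - u) ^+ 2 + y ^+ 2) - ln ((t + u) ^+ 2 + y ^+ 2)).
  by rewrite /F !subr0 sqrrN -opprD sqrrN; ring.
transitivity (0 + F (- rho) - F rho).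
  apply: FTC_outer => //.
  - move=> x /x0 xn0; apply: cvgB; first exact: cvgV.
    have cx : (fun t : R => t - u) @ x --> x - u.
      by apply: cvgB; [exact: cvg_id|exact: cvg_cst].
    apply: cvgM => //; apply: cvgV; first by rewrite gt_eqF.
    by apply: cvgD; [exact: (cvg_comp _ _ cx (@exprn_continuous _ 2 _))|exact: cvg_cst].
  - move=> x /x0 xn0.
    have p0 : 0 < (x - 0) ^+ 2 + 0 by rewrite subr0 addr0 exprn_even_gt0.
    apply: is_derive_eq (is_deriveZ 2^-1 (is_deriveB (is_derive_ln_sqr p0)
      (is_derive_ln_sqr (dp x)))) _.
    have d0 := dp x.
    rewrite /GRing.scale/= subr0 addr0; field.
    by rewrite xn0 gt_eqF.
  under eq_fun do rewrite FE.
  rewrite (_ : 0 = - 2^-1 * 0); last by rewrite mulr0.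
  by apply: cvgM; [exact: cvg_cst|exact: pv_log_cvg].
by rewrite add0r -opprB FE mulNr opprK.
Qed.

(** The missing mass sits on |x| < rho, where the density is at most 1 / (pi y); this is dominated
    by (1 + rho^2) / y times the standard Cauchy density. *)
Lemma outer_cauchy_pdf_integral rho u y : 0 < rho -> 0 < y ->
  `|\int[leb]_x (outer rho x * (pi * cauchy_pdf u y x)) - pi| <=
  pi * ((1 + rho ^+ 2) / y).
Proof.
move=> rho0 y0; have p0 : 0 < pi :> R by exact: pi_gt0.
have m1 := measurable_outer rho.
have b1 x : `|outer rho x| <= 1.
  by rewrite ger0_norm ?outer_ge0// /outer; case: ifP.
have ip : leb.-integrable setT (EFin \o (fun x => outer rho x * cauchy_pdf u y x)).
  exact: integrable_bounded_cauchy b1.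
have -> : \int[leb]_x (outer rho x * (pi * cauchy_pdf u y x)) =
    pi * \int[leb]_x (outer rho x * cauchy_pdf u y x).
  by rewrite -(RintegralZl _ _ ip)//; apply: eq_Rintegral => x _; rewrite mulrCA.
have piE : pi = pi * \int[leb]_x cauchy_pdf u y x :> R.
  by rewrite Rintegral_cauchy_pdf// mulr1.
rewrite [X in _ - X]piE -mulrBr normrM gtr0_norm//.
have ic := integrable_cauchy_pdf u y0.
rewrite ler_pM2l// -(RintegralB _ ip ic)//.
have id := RintegrableB measurableT ip ic.
apply: le_trans (le_normr_Rintegral _ id) _ => //.
rewrite -[leRHS](Rintegral_Zcauchy _ 0 ltr01).
apply: le_Rintegral => //; [exact: Rintegrable_norm|exact: integrable_Zcauchy|].
move=> x _; rewrite /outer; case: ifPn => [_|]; rewrite ?mul1r ?subrr ?normr0.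
  apply: mulr_ge0; last exact: cauchy_pdf_ge0.
  by apply: divr_ge0; [rewrite addr_ge0 ?sqr_ge0|exact: ltW].
rewrite -ltNge => xr.
rewrite mul0r sub0r normrN ger0_norm ?cauchy_pdf_ge0//.
apply: le_trans (cauchy_pdf_le u x y0) _.
rewrite /cauchy_pdf subr0 expr1n mulrCA invfM ler_wpM2l ?invr_ge0 ?pi_ge0//.
rewrite mul1r mulrAC ler_peMl ?invr_ge0 ?(ltW y0)//.
rewrite ler_pdivlMr ?ltr_wpDl ?sqr_ge0// mul1r addrC lerD2l.
by rewrite -[x ^+ 2]real_normK ?num_real// lerXn2r// ?nnegrE// ltW.
Qed.

(** The real part is half a difference of logarithms and the imaginary part is pi times the Cauchy
    mass of |x| >= rho. Both errors vanish as Im v -> -oo, uniformly in Re v. *)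
Lemma pv_kernel_integral rho v : 0 < rho -> Im v < 0 ->
  cabs (Cintegral leb setT (pv_kernel rho v) - (0 +i* pi)) <=
  2 * rho * ((- Im v)^-1 + 2 * rho / (- Im v) ^+ 2) +
  pi * ((1 + rho ^+ 2) / - Im v).
Proof.
move=> rho0 v0; have y0 : 0 < - Im v by rewrite oppr_gt0.
have [i1 i2] := Cintegrable_pv_kernel rho0 v0.
have xV (x : R) : x%:C^-1 = (x^-1)%:C :> R[i] by rewrite fmorphV.
have ReE (x : R) : Re (pv_kernel rho v x) = outer rho x *
    (x^-1 - (x - Re v) / ((x - Re v) ^+ 2 + (- Im v) ^+ 2)).
  rewrite /pv_kernel cReM/= mul0r subr0 xV cReD/= cReV cReD cReN Im_resolvent/=.
  by rewrite sqrrN -[(x - Re v) ^+ 2]sqrrN !opprB -mulNr opprB.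
have ImE (x : R) : Im (pv_kernel rho v x) = outer rho x *
    (pi * cauchy_pdf (Re v) (- Im v) x).
  rewrite /pv_kernel cImM/= mul0r addr0 xV cImD/= add0r cImV cReD cReN Im_resolvent/=.
  have p0 : pi != 0 :> R by rewrite gt_eqF ?pi_gt0.
  by rewrite /cauchy_pdf mulVKf// sqrrN -[(x - Re v) ^+ 2]sqrrN opprB mulNr.
have RI : Re (Cintegral leb setT (pv_kernel rho v)) = 2^-1 *
    (ln ((rho - Re v) ^+ 2 + (- Im v) ^+ 2) -
     ln ((rho + Re v) ^+ 2 + (- Im v) ^+ 2)).
  rewrite -pv_Re_integral//; first by apply: eq_Rintegral => x _; rewrite ReE.
  by apply: eq_integrable i1 => // x _ /=; rewrite ReE.
have II : Im (Cintegral leb setT (pv_kernel rho v)) =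
    \int[leb]_x (outer rho x * (pi * cauchy_pdf (Re v) (- Im v) x)).
  by apply: eq_Rintegral => x _; rewrite ImE.
apply: le_trans (cabs_ReIm _) _; rewrite cReD cReN cImD cImN RI II.
apply: lerD; last exact: outer_cauchy_pdf_integral.
rewrite [Re (0 +i* pi)]/= subr0 normrM ger0_norm ?invr_ge0//.
rewrite ler_pdivrMl//; apply: le_trans (pv_log_le _ rho0 y0) _.
by rewrite !mulrA; lra.
Qed.

End principal_value.

(** * Series controlled by the tails of a majorant *)

Section series_tails.
Context {R : realType}.
Implicit Types (f A : nat -> R) (t e : R).

(** Cauchy's criterion for a majorant, stated with finite sums so that comparison is termwise. *)
Definition summable_tails A := forall e, 0 < e -> exists N0, forall N1 N2,
  (N0 <= N1)%N -> \sum_(N1 <= n < N2) A n <= e.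

Lemma cvg_summable_tails A k : (forall n, 0 <= A n) ->
  cvgn (fun N => \sum_(k <= n < N) A n) -> summable_tails A.
Proof.
move=> A0 cA e e0; have /cvgrPdist_le/(_ _ e0)[N0 _ N0P] := cA.
exists (maxn k N0) => N1 N2; rewrite geq_max => /andP[kN1 N01].
have [N12|N21] := leqP N1 N2; last by rewrite big_geq ?ltW// ltnW.
set L := limn _ in N0P.
have h1 := N0P _ N01.
have nd : nondecreasing_seq (fun N => \sum_(k <= n < N) A n).
  apply/nondecreasing_seqP => n.
  have [kn|nk] := leqP k n; first by rewrite big_nat_recr//= lerDl.
  by rewrite !big_geq// ltnW.
have h2 : \sum_(k <= n < N2) A n <= L := nondecreasing_cvgn_le nd cA N2.
move: h1 h2; rewrite /= (big_cat_nat kN1 N12)/= ler_norml => /andP[_ h1]; lra.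
Qed.

Lemma summable_tails_le A f : summable_tails A -> (forall n, f n <= A n) ->
  summable_tails f.
Proof.
move=> sA fA e /sA[N0 N0P]; exists N0 => N1 N2 /N0P; move=> /(_ N2).
by apply: le_trans; exact: ler_sum.
Qed.

Lemma series_tail f A k : (forall n, (k <= n)%N -> `|f n| <= A n) ->
  summable_tails A -> exists L,
  (fun N => \sum_(k <= n < N) f n) @ \oo --> L /\
  forall N t, (k <= N)%N -> (forall N', \sum_(N <= n < N') A n <= t) ->
    `|L - \sum_(k <= n < N) f n| <= t.
Proof.
move=> fA sA.
(* Terms below k are set to 0 so that the partial sums form a [series]. *)
pose u n := if (k <= n)%N then f n else 0.
have uE N1 N2 : (k <= N1)%N -> \sum_(N1 <= n < N2) u n = \sum_(N1 <= n < N2) f n.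
  move=> kN1; apply: eq_big_nat => n /andP[N1n _].
  by rewrite /u (leq_trans kN1).
have sE : (fun N => \sum_(k <= n < N) f n) = series u.
  apply/funext => N; rewrite /series/= (big_nat_widenl _ 0)//= big_mkcond/=.
  by apply: eq_bigr => i _; rewrite /u.
have tail N1 N2 : (k <= N1)%N ->
    `|\sum_(N1 <= n < N2) f n| <= \sum_(N1 <= n < N2) A n.
  move=> kN1; apply: le_trans (ler_norm_sum _ _ _) _.
  rewrite big_nat [leRHS]big_nat; apply: ler_sum => n /andP[N1n _].
  by apply: fA; exact: leq_trans N1n.
have cs : cvgn (series u).
  apply/cauchy_cvgP/cauchy_seriesP => e e0.
  have [N0 N0P] := sA (e / 2) ltac:(by rewrite divr_gt0).
  exists ([set n | (maxn k N0 <= n)%N], [set: nat]).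
    by split; [exists (maxn k N0)|exists 0%N].
  move=> [N1 N2] /= [+ _]; rewrite geq_max => /andP[kN1 N01].
  rewrite uE//; apply: le_lt_trans (tail _ _ kN1) _.
  by apply: le_lt_trans (N0P _ _ N01) _; rewrite ltr_pdivrMr// ltr_pMr// ltr1n.
exists (limn (series u)); rewrite sE; split=> // N t kN tP.
have cN : (fun N' => `|series u N' - \sum_(k <= n < N) f n|) @ \oo -->
    `|limn (series u) - \sum_(k <= n < N) f n|.
  by apply: cvg_norm; apply: cvgB => //; exact: cvg_cst.
apply: (cvgr_to_le cN); exists N => // N' /= NN'.
rewrite -(congr1 (fun g => g N') sE)/= (big_cat_nat kN NN')/= addrAC subrr add0r.
by apply: le_trans (tail _ _ kN) _.
Qed.

End series_tails.

(** * The inverse power series outside and on the circle of radius rho *)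

Section inverse_power_series.
Context {R : realType}.
Variables (r rho : R) (a : nat -> R).
Hypotheses (r0 : 0 < r) (rrho : r < rho).
Hypothesis ca : forall x : R, r < `|x| ->
  cvgn (fun N => \sum_(2 <= n < N) `|a n / x ^+ n|).

(** The common majorant of the real series on |x| >= rho and of the complex one on |z| = rho; it is
    summable because rho > r. *)
Definition coef_bound n : R := `|a n| / rho ^+ n.

Let rho0 : 0 < rho. Proof. exact: lt_trans rrho. Qed.

Lemma coef_bound_ge0 n : 0 <= coef_bound n.
Proof. by rewrite divr_ge0// exprn_ge0// ltW. Qed.

Lemma coef_bound_tails : summable_tails coef_bound.
Proof.
apply: (@cvg_summable_tails _ _ 2) coef_bound_ge0 _.
have := ca (x := rho); rewrite gtr0_norm// => /(_ rrho).
by under eq_fun do under eq_bigr do rewrite normrM normfV normrX (gtr0_norm rho0).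
Qed.

Definition tail_bound N (t : R) := forall N', \sum_(N <= n < N') coef_bound n <= t.

Lemma tail_bound_small e : 0 < e -> exists N, tail_bound N.+3 e.
Proof.
move=> /coef_bound_tails[N0 N0P]; exists N0 => N'.
by apply: N0P; rewrite -addn3 leq_addr.
Qed.

Lemma tail_bound_ex N : exists t, tail_bound N t.
Proof.
have [N0 N0P] := coef_bound_tails ltr01.
exists (\sum_(N <= n < maxn N N0) coef_bound n + 1) => N'.
have h : 0 <= \sum_(N <= n < maxn N N0) coef_bound n.
  by apply: sumr_ge0 => n _; exact: coef_bound_ge0.
have [h1|h1] := leqP (maxn N N0) N'.
  rewrite (big_cat_nat (leq_maxl N N0) h1)/= lerD2l.
  by apply: N0P; exact: leq_maxr.
have [NN'|N'N] := leqP N N'; last first.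
  by rewrite big_geq ?addr_ge0// ltnW.
rewrite (big_cat_nat NN' (ltnW h1))/= -addrA lerDl addr_ge0//.
by apply: sumr_ge0 => n _; exact: coef_bound_ge0.
Qed.

Lemma tail_bound_ge0 N t : tail_bound N t -> 0 <= t.
Proof. by move=> /(_ 0%N); rewrite big_geq. Qed.

(** A term of index n >= 3 is at most [coef_bound] n times (rho / |x|)^3. Keeping this cubic decay
    in the tail is what later makes x times the remainder integrable. *)
Lemma inv_pseries_cvg x : rho <= `|x| ->
  (fun N => \sum_(2 <= n < N) a n / x ^+ n) @ \oo --> inv_pseries a x /\
  forall N t, tail_bound N.+3 t ->
    `|inv_pseries a x - \sum_(2 <= n < N.+3) a n / x ^+ n| <= t * (rho / `|x|) ^+ 3.
Proof.
move=> rx; have x0 : 0 < `|x| by exact: lt_le_trans rx.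
have q1 : 0 <= rho / `|x| <= 1.
  by rewrite divr_ge0 ?(ltW rho0)//= ler_pdivrMr// mul1r.
have [q0 q1'] := andP q1.
pose A n := coef_bound n * (if (2 < n)%N then (rho / `|x|) ^+ 3 else 1).
have sA : summable_tails A.
  apply: summable_tails_le coef_bound_tails _ => n.
  rewrite /A ler_piMr ?coef_bound_ge0//; case: ifP => // _.
  exact: exprn_ile1.
have fA n : (2 <= n)%N -> `|a n / x ^+ n| <= A n.
  move=> n2; rewrite normrM normfV normrX.
  have -> : `|a n| / `|x| ^+ n = coef_bound n * (rho / `|x|) ^+ n.
    by rewrite /coef_bound exprMn exprVn -mulrA mulKf// expf_neq0// gt_eqF.
  rewrite /A ler_wpM2l ?coef_bound_ge0//; case: ifP => n3; last exact: exprn_ile1.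
  by rewrite ler_wiXn2l.
have [L [cL tL]] := series_tail fA sA.
have -> : inv_pseries a x = L by apply: (cvg_lim (@norm_hausdorff _ R^o) cL).
split=> // N t tP; apply: tL => // N'.
rewrite (eq_big_nat _ _ (F2 := fun n => coef_bound n * (rho / `|x|) ^+ 3)); last first.
  by move=> n /andP[Nn _]; rewrite /A (leq_trans _ Nn).
by rewrite -mulr_suml ler_wpM2r ?exprn_ge0.
Qed.

Lemma inv_pseriesC_cvg (z : R[i]) : cabs z = rho ->
  let s N := \sum_(2 <= n < N) (a n)%:C / z ^+ n in
  let P := inv_pseries (fun k => (a k)%:C) z in
  [/\ (fun N => Re (s N)) @ \oo --> Re P, (fun N => Im (s N)) @ \oo --> Im P &
   forall N t, tail_bound N.+3 t -> cabs (P - s N.+3) <= 2 * t].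
Proof.
move=> zr s P.
have fA n : cabs ((a n)%:C / z ^+ n) <= coef_bound n.
  by rewrite cabsM cabsV cabsX cabsR zr.
have [L1 [c1 t1]] := @series_tail _ (fun n => Re ((a n)%:C / z ^+ n)) _ 2
  (fun n _ => le_trans (cabs_Re _) (fA n)) coef_bound_tails.
have [L2 [c2 t2]] := @series_tail _ (fun n => Im ((a n)%:C / z ^+ n)) _ 2
  (fun n _ => le_trans (cabs_Im _) (fA n)) coef_bound_tails.
have ReS (N1 N2 : nat) (F : nat -> R[i]) :
    \sum_(N1 <= n < N2) Re (F n) = Re (\sum_(N1 <= n < N2) F n).
  elim/big_rec2: _ => [//|i x y _ ->]; by rewrite cReD.
have ImS (N1 N2 : nat) (F : nat -> R[i]) :
    \sum_(N1 <= n < N2) Im (F n) = Im (\sum_(N1 <= n < N2) F n).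
  elim/big_rec2: _ => [//|i x y _ ->]; by rewrite cImD.
have tL N t : tail_bound N.+3 t -> cabs ((L1 +i* L2) - s N.+3) <= 2 * t.
  move=> tP; apply: le_trans (cabs_ReIm _) _.
  rewrite cReD cReN cImD cImN/= -ReS -ImS mulr_natl mulr2n.
  by apply: lerD; [apply: t1|apply: t2].
have PE : P = L1 +i* L2.
  apply: (cvg_lim (@norm_hausdorff _ (R[i])^o)).
  apply/cvgrPdist_le => e e0.
  (* A positive element of R[i] is real. *)
  have [er ei] : 0 < Re e /\ Im e = 0.
    by move: e0; rewrite ltcE/= => /andP[/eqP -> ->].
  have [N0 N0P] := coef_bound_tails (divr_gt0 er (ltr0n _ 2)).
  exists N0.+3 => // N /= N0N.
  have -> : e = (Re e)%:C by apply: complex_eqP.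
  have tN : tail_bound (N - 3).+3 (Re e / 2).
    by move=> N'; apply: N0P; lia.
  have := tL _ _ tN; rewrite (_ : (N - 3).+3 = N)//; last by lia.
  rewrite mulrC divfK// => h.
  by rewrite -cabs_norm lecR.
rewrite PE; split=> //=.
  by under eq_fun do rewrite -ReS.
by under eq_fun do rewrite -ImS.
Qed.

End inverse_power_series.

(** * Integrals over the half-circle *)

Section arc.
Context {R : realType}.
Local Notation leb := (@lebesgue_measure R).
Implicit Types (rho t : R).

Definition arc_point rho t : R[i] := rho%:C * (cos t +i* sin t).

Lemma cabs_arc_point rho t : 0 <= rho -> cabs (arc_point rho t) = rho.
Proof.
move=> rho0; rewrite /arc_point cabsM cabsR ger0_norm//.
by rewrite /= cos2Dsin2 sqrtr1 mulr1.
Qed.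

Lemma de_moivre t k : (cos t +i* sin t) ^+ k = cos (k%:R * t) +i* sin (k%:R * t).
Proof.
elim: k => [|k ih]; first by rewrite expr0 mul0r cos0 sin0.
rewrite exprS ih -natr1 mulrDl mul1r addrC cosD sinD.
by apply: complex_eqP; rewrite ?cReM ?cImM/=; ring.
Qed.

Lemma arc_point_inv_pow rho t k : 0 < rho ->
  'i%C * (arc_point rho t) ^- k =
  (rho ^- k * sin (k%:R * t)) +i* (rho ^- k * cos (k%:R * t)).
Proof.
move=> rho0; rewrite /arc_point exprMn de_moivre invfM -rmorphXn -fmorphV/=.
rewrite [X in _ * (_ * X)](_ : _ = cos (k%:R * t) -i* sin (k%:R * t)); last first.
  apply: complex_eqP; rewrite ?cReV ?cImV/=.
    by rewrite cos2Dsin2 divr1.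
  by rewrite cos2Dsin2 divr1.
by apply: complex_eqP; rewrite !(cReM, cImM)/=; ring.
Qed.

(** As dz = i z dt, the integrand is z^(-j-2) dz. The power z^-1 is excluded: there the integrand is
    constant in t. *)
Lemma Cintegral_arc_inv_pow rho (j : nat) : 0 < rho ->
  Cintegrable leb `[0, pi] (fun t => 'i%C * (arc_point rho t) ^- j.+1) /\
  Cintegral leb `[0, pi] (fun t => 'i%C * (arc_point rho t) ^- j.+1) =
  ((1 - (-1) ^+ j.+1) / (j.+1%:R * rho ^+ j.+1))%:C.
Proof.
move=> rho0; set k := j.+1; have k0 : k%:R != 0 :> R by rewrite pnatr_eq0.
have rk0 : rho ^+ k != 0 by rewrite expf_neq0// gt_eqF.
have dk t : is_derive t 1 (fun t : R => k%:R * t) k%:R.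
  by apply: is_derive_eq (is_deriveZ k%:R (is_derive_id t 1)) _;
    rewrite /GRing.scale/= mulr1.
have dc t : is_derive t 1 (fun t : R => - (k%:R * rho ^+ k)^-1 * cos (k%:R * t))
    (rho ^- k * sin (k%:R * t)).
  have := is_derive1_comp (is_derive_cos (k%:R * t)) (dk t).
  move=> /(is_deriveZ (- (k%:R * rho ^+ k)^-1)) h.
  by apply: is_derive_eq h _; rewrite /GRing.scale/=; field; rewrite k0 rk0.
have ds t : is_derive t 1 (fun t : R => (k%:R * rho ^+ k)^-1 * sin (k%:R * t))
    (rho ^- k * cos (k%:R * t)).
  have := is_derive1_comp (is_derive_sin (k%:R * t)) (dk t).
  move=> /(is_deriveZ (k%:R * rho ^+ k)^-1) h.
  by apply: is_derive_eq h _; rewrite /GRing.scale/=; field; rewrite k0 rk0.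
have ck t : {for t, continuous (fun t : R => k%:R * t)}.
  by apply: cvgM; [exact: cvg_cst|exact: cvg_id].
have [i1 e1] := @continuous_FTC2_Rintegral R (fun t => rho ^- k * sin (k%:R * t)) _ 0 pi
  (pi_gt0 R)
  (fun t _ => cvgM (cvg_cst _) (continuous_comp (ck t) (@continuous_sin R _)))
  (fun t _ => dc t).
have [i2 e2] := @continuous_FTC2_Rintegral R (fun t => rho ^- k * cos (k%:R * t)) _ 0 pi
  (pi_gt0 R)
  (fun t _ => cvgM (cvg_cst _) (continuous_comp (ck t) (@continuous_cos R _)))
  (fun t _ => ds t).
have kpi : cos (k%:R * (pi : R)) = (-1) ^+ k /\ sin (k%:R * (pi : R)) = 0.
  have := de_moivre pi k; rewrite cospi sinpi.
  have -> : (-1 +i* 0) ^+ k = ((-1) ^+ k)%:C :> R[i].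
    by rewrite rmorphXn/=; congr (_ ^+ _); apply: complex_eqP => //=; rewrite oppr0.
  by move=> E; split; [exact: esym (congr1 Re E)|exact: esym (congr1 Im E)].
split.
  by split; [apply: eq_integrable i1 => //|apply: eq_integrable i2 => //];
    move=> t _ /=; rewrite arc_point_inv_pow.
apply: complex_eqP => /=.
  under eq_Rintegral do rewrite arc_point_inv_pow//=.
  rewrite e1 kpi.1 mulr0 cos0; field; rewrite k0 rk0//.
under eq_Rintegral do rewrite arc_point_inv_pow//=.
by rewrite e2 kpi.2 !mulr0 sin0 mulr0 subrr.
Qed.

(** For c = i a_2 this is the integral of a_2 / z, since dz / z = i dt; it is the source of i pi a_2
    in the first moment. *)
Lemma Cintegral_arc_cst (c : R[i]) :
  Cintegrable leb `[0, pi] (fun=> c) /\ Cintegral leb `[0, pi] (fun=> c) = pi%:C * c.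
Proof.
have mpi : leb `[0, pi] = (pi : R)%:E.
  by rewrite lebesgue_measure_itv/= lte_fin pi_gt0 oppr0 adde0.
split.
  have ic (s : R) : leb.-integrable `[0, pi] (EFin \o (fun=> s)).
    apply/integrableP; split; first exact/measurable_EFinP.
    by under eq_integral do rewrite /=; rewrite integral_cst//= mpi ltry.
  by split; exact: ic.
have cE (s : R) : \int[leb]_(x in `[0, pi]) s = s * pi.
  by rewrite Rintegral_cst// [X in fine X]mpi.
by apply: complex_eqP; rewrite ?cReM ?cImM /= cE; ring.
Qed.

End arc.

Lemma Rintegral_sum_ord d (T : measurableType d) (R : realType)
    (m : {measure set T -> \bar R}) D n (F : nat -> T -> R) : measurable D ->
  (forall i, m.-integrable D (EFin \o F i)) ->
  m.-integrable D (EFin \o (fun x => \sum_(i < n) F i x)) /\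
  \int[m]_(x in D) (\sum_(i < n) F i x) = \sum_(i < n) \int[m]_(x in D) F i x.
Proof.
move=> mD iF; elim: n => [|n [ih1 ih2]].
  have -> : (fun x => \sum_(i < 0) F i x) = (fun=> 0).
    by apply/funext => x; rewrite big_ord0.
  rewrite big_ord0; split; first exact: integrable0.
  by rewrite /Rintegral integral0_eq.
have -> : (fun x => \sum_(i < n.+1) F i x) = (fun x => \sum_(i < n) F i x + F n x).
  by apply/funext => x; rewrite big_ord_recr.
rewrite big_ord_recr/= -ih2; split; first exact: RintegrableD.
by rewrite RintegralD.
Qed.

(** * The density without its leading term, and the first complex moment *)

Section P2_density.
Context {R : realType}.
Local Notation B := (measurableTypeR R).
Local Notation leb := (@lebesgue_measure R).
Variables (r rho : R) (a : nat -> R).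
Hypotheses (r0 : 0 < r) (rrho : r < rho).
Hypothesis ca : forall x : R, r < `|x| ->
  cvgn (fun N => \sum_(2 <= n < N) `|a n / x ^+ n|).

Let rho0 : 0 < rho. Proof. exact: lt_trans rrho. Qed.
Let tail_ex := @tail_bound_ex R r rho a r0 rrho ca.

Definition outer_density (x : R) : R := outer rho x * inv_pseries a x.

(** What is left of the density without a_2 x^-2 is of order |x|^-3, so its product with x is
    integrable. *)
Definition outer_remainder (x : R) : R :=
  outer_density x - a 2 * (outer rho x * x ^- 2).

Lemma measurable_outer_density : measurable_fun setT outer_density.
Proof.
apply: (@measurable_fun_cvg _ _ _ _
  (fun N x => outer rho x * \sum_(2 <= n < N) a n / x ^+ n)).
  move=> N; apply: measurable_funM; first exact: measurable_outer.
  apply: measurable_sum => n; apply: measurable_funM => //.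
  by apply: measurable_funV => //; exact: exprn_measurable.
move=> x _; rewrite /outer_density /outer; case: ifPn => [rx|_].
  apply: cvgM; first exact: cvg_cst.
  exact: (inv_pseries_cvg r0 rrho ca rx).1.
under eq_fun do rewrite mul0r.
by rewrite mul0r; exact: cvg_cst.
Qed.

Lemma measurable_outer_remainder : measurable_fun setT outer_remainder.
Proof.
apply: measurable_funB; first exact: measurable_outer_density.
apply: measurable_funM => //; apply: measurable_funM; first exact: measurable_outer.
by apply: measurable_funV => //; exact: exprn_measurable.
Qed.

Lemma outer_remainder_tail N t x : tail_bound rho a N.+3 t ->
  `|outer_remainder x - \sum_(j < N) a j.+3 * (outer rho x * x ^- j.+3)| <=
  t * rho ^+ 3 * (outer rho x * `|x| ^- 3).
Proof.
move=> tP; rewrite /outer_remainder /outer_density /outer.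
case: ifPn => [rx|_]; last first.
  rewrite !mul0r mulr0 subr0 big1 ?subr0 ?normr0 ?mulr0// => j _.
  by rewrite mul0r mulr0.
have [_ /(_ N t tP)] := inv_pseries_cvg r0 rrho ca rx.
rewrite big_ltn// -[3%N]add0n big_addn !subSS subn0 big_mkord.
rewrite exprMn exprVn mulrA !mul1r.
under [X in _ - (_ + X)]eq_bigr do rewrite addn3.
under [X in _ -> `|_ - X| <= _]eq_bigr do rewrite mul1r.
by rewrite opprD addrA mulr1 -[t * _ / _]mulrA.
Qed.

Lemma outer_remainder_le : exists2 c, 0 <= c &
  forall x, `|outer_remainder x| <= c * (outer rho x * `|x| ^- 3).
Proof.
have [t tP] := tail_ex 3; exists (t * rho ^+ 3).
  by rewrite mulr_ge0 ?(tail_bound_ge0 tP)// exprn_ge0// ltW.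
by move=> x; have := outer_remainder_tail (N := 0) x tP; rewrite big_ord0 subr0.
Qed.

Lemma outer_cube_le x : outer rho x * `|x| ^- 3 <= rho^-1 * (outer rho x * x ^- 2).
Proof.
rewrite /outer; case: ifPn => [rx|_]; last by rewrite !mul0r mulr0.
have x0 : 0 < `|x| by exact: lt_le_trans rx.
rewrite !mul1r -[x ^+ 2]real_normK ?num_real// exprS invfM.
by rewrite ler_wpM2r ?invr_ge0 ?sqr_ge0// lef_pV2.
Qed.

Lemma outer_cube_mul x (c : R) : `|x| * (c * (outer rho x * `|x| ^- 3)) =
  c * (outer rho x * x ^- 2).
Proof.
rewrite /outer; case: ifPn => [rx|_]; last by rewrite !mul0r !mulr0.
have x0 : `|x| != 0 by rewrite gt_eqF// (lt_le_trans _ rx).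
by rewrite !mul1r -[x ^+ 2]real_normK ?num_real//; field.
Qed.

Lemma integrable_outer_remainder :
  leb.-integrable setT (EFin \o outer_remainder).
Proof.
have [c c0 cP] := outer_remainder_le.
refine (@le_Rintegrable _ _ _ leb setT outer_remainder
  (fun x => c * rho^-1 * (outer rho x * x ^- 2)) _ _ _ _) => //.
- exact: measurable_outer_remainder.
- by apply: RintegrableZl => //; exact: integrable_outer_sqr.
- move=> x _; apply: le_trans (cP x) _; rewrite -mulrA ler_wpM2l//.
  exact: outer_cube_le.
Qed.

Lemma integrable_mul_outer_remainder :
  leb.-integrable setT (EFin \o (fun x => x * outer_remainder x)).
Proof.
have [c c0 cP] := outer_remainder_le.
refine (@le_Rintegrable _ _ _ leb setT (fun x => x * outer_remainder x)
  (fun x => c * (outer rho x * x ^- 2)) _ _ _ _) => //.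
- by apply: measurable_funM => //; exact: measurable_outer_remainder.
- by apply: RintegrableZl => //; exact: integrable_outer_sqr.
- by move=> x _; rewrite normrM -outer_cube_mul ler_wpM2l.
Qed.

Lemma integrable_outer_density :
  leb.-integrable setT (EFin \o outer_density).
Proof.
have -> : outer_density =
    (fun x => outer_remainder x + a 2 * (outer rho x * x ^- 2)).
  by apply/funext => x; rewrite /outer_remainder subrK.
apply: RintegrableD => //; first exact: integrable_outer_remainder.
by apply: RintegrableZl => //; exact: integrable_outer_sqr.
Qed.

Let c2 := \int[leb]_x (outer rho x * x ^- 2).

Let c2_ge0 : 0 <= c2.
Proof.
by apply: Rintegral_ge0 => x _; rewrite mulr_ge0 ?outer_ge0// invr_ge0 sqr_ge0.
Qed.

Lemma mul_outer_remainder_tail N t : tail_bound rho a N.+3 t ->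
  `|\int[leb]_x (x * outer_remainder x) -
    \sum_(j < N) a j.+3 * \int[leb]_x (outer rho x * x ^- j.+2)|
  <= t * rho ^+ 3 * c2.
Proof.
move=> tP.
have iP j := RintegrableZl (a j.+3) measurableT (integrable_outer_inv_pow j rho0).
have [iS eS] := Rintegral_sum_ord N measurableT iP.
have -> : \sum_(j < N) a j.+3 * \int[leb]_x (outer rho x * x ^- j.+2) =
    \int[leb]_x (\sum_(j < N) a j.+3 * (outer rho x * x ^- j.+2)).
  rewrite eS; apply: eq_bigr => j _.
  by rewrite (RintegralZl _ _ (integrable_outer_inv_pow j rho0)).
have iR := integrable_mul_outer_remainder.
have i2 := integrable_outer_sqr rho0.
rewrite -(RintegralB _ iR iS)//.
have iB := RintegrableB measurableT iR iS.
apply: le_trans (le_normr_Rintegral _ iB) _ => //.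
rewrite -(RintegralZl _ _ i2)//.
apply: le_Rintegral => //; [exact: Rintegrable_norm|exact: RintegrableZl|].
move=> x _; rewrite -outer_cube_mul.
have -> : \sum_(j < N) a j.+3 * (outer rho x * x ^- j.+2) =
    x * \sum_(j < N) a j.+3 * (outer rho x * x ^- j.+3).
  rewrite mulr_sumr; apply: eq_bigr => j _; rewrite [RHS]mulrCA; congr (_ * _).
  rewrite /outer; case: ifPn => [rx|_]; last by rewrite !mul0r mulr0.
  have x0 : x != 0 by rewrite -normr_gt0 (lt_le_trans _ rx).
  by rewrite !mul1r [x ^+ j.+3]exprS [in RHS](invfM x) mulVKf.
by rewrite -mulrBr normrM ler_wpM2l// outer_remainder_tail.
Qed.

Let arc_terms N t := \sum_(2 <= n < N) (a n)%:C / arc_point rho t ^+ n.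

Let P t := inv_pseries (fun k => (a k)%:C) (arc_point rho t).

Let arc_integrand t := 'i%C * (arc_point rho t ^+ 2 * P t).

Let arc_cvg t := inv_pseriesC_cvg r0 rrho ca (cabs_arc_point t (ltW rho0)).

Let arc0 t : arc_point rho t != 0.
Proof. by rewrite -cabs_gt0 cabs_arc_point// ltW. Qed.

Let measurable_arc_point : Cmeasurable `[0, pi] (arc_point rho : B -> R[i]).
Proof.
apply: CmeasurableM => //; first exact: Cmeasurable_cst.
split; apply: measurable_funTS; apply: continuous_measurable_fun.
  exact: continuous_cos.
exact: continuous_sin.
Qed.

Let measurable_arc_terms N : Cmeasurable `[0, pi] (arc_terms N : B -> R[i]).
Proof.
elim: N => [|N ih].
  rewrite (_ : arc_terms 0 = fun=> 0); first exact: Cmeasurable_cst.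
  by apply/funext => t; rewrite /arc_terms big_geq.
have [N2|N2] := leqP 2 N; last first.
  rewrite (_ : arc_terms N.+1 = fun=> 0); first exact: Cmeasurable_cst.
  by apply/funext => t; rewrite /arc_terms big_geq.
rewrite (_ : arc_terms N.+1 =
    fun t => arc_terms N t + (a N)%:C * (arc_point rho t ^+ N)^-1).
  apply: CmeasurableD => //; apply: CmeasurableM => //; first exact: Cmeasurable_cst.
  by apply: CmeasurableV => //; apply: CmeasurableX.
by apply/funext => t; rewrite /arc_terms big_nat_recr.
Qed.

Let measurable_P : Cmeasurable `[0, pi] (P : B -> R[i]).
Proof.
split.
  apply: (@measurable_fun_cvg _ _ _ _ (fun N t => Re (arc_terms N t))).
    by move=> N; exact: (measurable_arc_terms N).1.
  by move=> t _; have [] := arc_cvg t.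
apply: (@measurable_fun_cvg _ _ _ _ (fun N t => Im (arc_terms N t))).
  by move=> N; exact: (measurable_arc_terms N).2.
by move=> t _; have [] := arc_cvg t.
Qed.

Lemma complex_momentE : complex_moment rho a 1 =
  Cintegral leb `[0, pi] arc_integrand.
Proof.
rewrite /complex_moment /arc_integral; congr (_ +i* _); apply: eq_Rintegral => t _;
  rewrite /arc_integrand /P /arc_point expr1; congr (complex.Re _) || congr (complex.Im _);
  set e := cos t +i* sin t; set p := inv_pseries _ _; rewrite expr2; ring.
Qed.

(** The first terms are integrated exactly. In the error, rho^2 comes from z dz = i z^2 dt, pi from
    the length of the parameter interval, and 4 from separating real and imaginary parts both in the
    series and in the integral. *)
Lemma complex_moment_tail N t : tail_bound rho a N.+3 t ->
  cabs (complex_moment rho a 1 - ((pi * a 2)%:C * 'i%C +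
    (\sum_(j < N) a j.+3 * \int[leb]_x (outer rho x * x ^- j.+2))%:C)) <=
  4 * pi * rho ^+ 2 * t.
Proof.
move=> tP; have t0 := tail_bound_ge0 tP.
pose g s : R[i] := (a 2)%:C * 'i%C +
  \sum_(j < N) (a j.+3)%:C * ('i%C * arc_point rho s ^- j.+1).
have [ic ec] := Cintegral_arc_cst ((a 2)%:C * 'i%C : R[i]).
have mI : measurable (`[0, pi]%classic : set B) by exact: measurable_itv.
have ij (j : 'I_N) := CintegrableZl (a j.+3)%:C mI
  (Cintegral_arc_inv_pow j rho0).1.
have iS : Cintegrable leb `[0, pi] (fun s =>
    \sum_(j < N) (a j.+3)%:C * ('i%C * arc_point rho s ^- j.+1)).
  exact: (@Cintegrable_sum _ _ _ leb _ _ (index_enum 'I_N)).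
have eg : Cintegral leb `[0, pi] g = (pi * a 2)%:C * 'i%C +
    (\sum_(j < N) a j.+3 * \int[leb]_x (outer rho x * x ^- j.+2))%:C.
  rewrite /g CintegralD// ec rmorphM/= mulrA; congr (_ + _).
  rewrite (@Cintegral_sum _ _ _ leb _ _ (index_enum 'I_N))// rmorph_sum/=.
  apply: eq_bigr => j _; rewrite (CintegralZl _ mI (Cintegral_arc_inv_pow j rho0).1).
  by rewrite (Cintegral_arc_inv_pow j rho0).2 Rintegral_outer_inv_pow// [RHS]rmorphM.
have gE s : g s = 'i%C * (arc_point rho s ^+ 2 * arc_terms N.+3 s).
  rewrite /g /arc_terms big_ltn// -[3%N]add0n big_addn !subSS subn0 big_mkord.
  rewrite !mulrDr; congr (_ + _).
    by rewrite [(a 2)%:C / _]mulrC mulVKf ?expf_neq0// mulrC.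
  rewrite !mulr_sumr; apply: eq_bigr => j _; rewrite addn3.
  rewrite [arc_point rho s ^+ j.+3](exprD _ 2 j.+1) invfM.
  rewrite [(a _)%:C * (_ * _)]mulrCA; congr (_ * _).
  by rewrite mulrCA [_ ^+ 2 * _]mulrA mulfV ?expf_neq0// mul1r.
have ig : Cintegrable leb `[0, pi] g by exact: CintegrableD.
have mg : Cmeasurable `[0, pi] g.
  by split; apply/measurable_EFinP; [exact: measurable_int ig.1|exact: measurable_int ig.2].
have mh : Cmeasurable `[0, pi] arc_integrand.
  apply: CmeasurableM => //; first exact: Cmeasurable_cst.
  by apply: CmeasurableM => //; exact: CmeasurableX.
have icst (s : R) : leb.-integrable `[0, pi] (EFin \o (fun=> s)).
  by have [] := (Cintegral_arc_cst s%:C).1.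
have le s : cabs (arc_integrand s - g s) <= rho ^+ 2 * (2 * t).
  rewrite gE /arc_integrand -!mulrBr (cabsM 'i%C) (cabsM (_ ^+ 2)) cabsX.
  rewrite cabs_arc_point ?(ltW rho0)//.
  have -> : cabs ('i%C : R[i]) = 1 by rewrite /= expr0n/= add0r expr1n sqrtr1.
  rewrite mul1r ler_wpM2l ?sqr_ge0//.
  by have [_ _] := arc_cvg s; apply.
have ih : Cintegrable leb `[0, pi] arc_integrand.
  rewrite (_ : arc_integrand = fun s => (arc_integrand s - g s) + g s); last first.
    by apply/funext => s; rewrite subrK.
  apply: CintegrableD => //.
  apply: le_Cintegrable (icst (rho ^+ 2 * (2 * t))) _ => //.
  exact: CmeasurableB.
rewrite -eg complex_momentE -CintegralB//.
apply: le_trans (cabs_Cintegral_le mI (CmeasurableB mI mh mg)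
  (icst (rho ^+ 2 * (2 * t))) (fun s _ => le s)) _.
have -> : \int[leb]_(x in `[0, pi]) (rho ^+ 2 * (2 * t)) = pi * (rho ^+ 2 * (2 * t)).
  have := congr1 Re (Cintegral_arc_cst (rho ^+ 2 * (2 * t))%:C).2.
  by rewrite cReM/= mulr0 subr0.
by rewrite le_eqVlt; apply/orP; left; apply/eqP; ring.
Qed.

(* Instead of deforming the contour, compare termwise: z^-k with k >= 2 has the same
   integral over the arc as over |x| >= rho, and z^-1 contributes i pi. *)
Lemma complex_moment_eq : complex_moment rho a 1 =
  (pi * a 2)%:C * 'i%C + (\int[leb]_x (x * outer_remainder x))%:C.
Proof.
apply/eqP; rewrite -subr_eq0 -cabs_eq0 eq_le cabs_ge0 andbT.
apply/ler_addgt0Pr => e e0; rewrite add0r.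
pose c := 4 * pi * rho ^+ 2 + rho ^+ 3 * c2 + 1.
have r2 : 0 <= 4 * pi * rho ^+ 2 by rewrite !mulr_ge0 ?pi_ge0// ltW.
have r3 : 0 <= rho ^+ 3 * c2 by rewrite mulr_ge0// exprn_ge0// ltW.
have c0 : 0 < c by rewrite /c; lra.
have [N tP] := tail_bound_small r0 rrho ca (divr_gt0 e0 c0).
set t := e / c in tP.
have t0 := tail_bound_ge0 tP.
have h1 := complex_moment_tail tP; have h2 := mul_outer_remainder_tail tP.
set S := \sum_(j < N) _ in h1 h2.
set I := \int[leb]_x _ in h2 *.
have -> : complex_moment rho a 1 - ((pi * a 2)%:C * 'i%C + I%:C) =
    (complex_moment rho a 1 - ((pi * a 2)%:C * 'i%C + S%:C)) - (I - S)%:C.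
  by rewrite rmorphB/=; ring.
apply: le_trans (cabsB _ _) _; rewrite cabsR.
apply: le_trans (lerD h1 h2) _.
have -> : e = c * t by rewrite /t mulrC divfK// gt_eqF.
rewrite /c; lra.
Qed.

End P2_density.

(** * Integrals against a sum of finite measures *)

Section sum_of_measures.
Context d (T : measurableType d) (R : realType).
Implicit Types m : {measure set T -> \bar R}.

Lemma finite_mass_integrable_cst m (s : R) : (m setT < +oo)%E ->
  m.-integrable setT (EFin \o (fun=> s)).
Proof.
move=> mT; apply/integrableP; split; first exact/measurable_EFinP.
under eq_integral do rewrite /=.
by rewrite integral_cst//= lte_mul_pinfty ?lee_fin.
Qed.

Lemma finite_mass_Cintegrable m (f : T -> R[i]) (M : R) : (m setT < +oo)%E ->
  Cmeasurable setT f -> (forall x, cabs (f x) <= M) -> Cintegrable m setT f.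
Proof.
move=> mT mf fM; apply: le_Cintegrable (finite_mass_integrable_cst M mT) _ => //.
Qed.

Lemma Rintegral_add_measure m m1 m2 (f : T -> R) :
  (forall A, measurable A -> m A = (m1 A + m2 A)%E) -> measurable_fun setT f ->
  m1.-integrable setT (EFin \o f) -> m2.-integrable setT (EFin \o f) ->
  \int[m]_x f x = \int[m1]_x f x + \int[m2]_x f x.
Proof.
move=> mE mf i1 i2; rewrite /Rintegral.
rewrite (eq_measure_integral (measure_add m1 m2)); last first.
  by move=> A mA _; rewrite mE// [RHS]measure_addE.
rewrite integral_measure_add//.
by rewrite fineD//; exact: integrable_fin_num.
Qed.

Lemma Cintegral_add_measure m m1 m2 (f : T -> R[i]) :
  (forall A, measurable A -> m A = (m1 A + m2 A)%E) -> Cmeasurable setT f ->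
  Cintegrable m1 setT f -> Cintegrable m2 setT f ->
  Cintegral m setT f = Cintegral m1 setT f + Cintegral m2 setT f.
Proof.
move=> mE [f1 f2] [i1 i2] [j1 j2]; apply: complex_eqP.
  by rewrite cReD /=; exact: (@Rintegral_add_measure m m1 m2 (Re \o f)).
by rewrite cImD /=; exact: (@Rintegral_add_measure m m1 m2 (Im \o f)).
Qed.

Lemma Cintegral_density (mu m : {measure set T -> \bar R}) (p : T -> R)
    (f : T -> R[i]) : measurable_fun setT p -> (forall x, 0 <= p x) ->
  (forall A, measurable A -> m A = (\int[mu]_(x in A) (p x)%:E)%E) ->
  Cmeasurable setT f -> Cintegrable mu setT (fun x => f x * (p x)%:C) ->
  Cintegral m setT f = Cintegral mu setT (fun x => f x * (p x)%:C).
Proof.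
move=> mp p0 mE [f1 f2] [i1 i2].
have ReE x : Re (f x * (p x)%:C) = Re (f x) * p x.
  by rewrite cReM/= mulr0 subr0.
have ImE x : Im (f x * (p x)%:C) = Im (f x) * p x.
  by rewrite cImM/= mulr0 add0r.
apply: complex_eqP => /=.
  under [RHS]eq_Rintegral do rewrite ReE.
  apply: (Rintegral_density mp p0 mE f1).
  by apply: eq_integrable i1 => // x _ /=; rewrite ReE.
under [RHS]eq_Rintegral do rewrite ImE.
apply: (Rintegral_density mp p0 mE f2).
by apply: eq_integrable i2 => // x _ /=; rewrite ImE.
Qed.

Lemma Cintegrable_real m (h : T -> R) : m.-integrable setT (EFin \o h) ->
  Cintegrable m setT (fun x => (h x)%:C).
Proof. by move=> ih; split => //; exact: integrable0. Qed.

Lemma Cintegral_real m (h : T -> R) :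
  Cintegral m setT (fun x => (h x)%:C) = (\int[m]_x h x)%:C.
Proof.
by apply: complex_eqP => //=; rewrite /Rintegral integral0_eq.
Qed.

End sum_of_measures.

(** * The expansion of G for a decomposition nu + lambda *)

Section P2_expansion.
Context {R : realType}.
Local Notation B := (measurableTypeR R).
Local Notation leb := (@lebesgue_measure R).
Variables (mu : borel_probability R) (nu lam : borel_measure R) (r rho : R).
Variable a : nat -> R.
Hypothesis dec : P2_decomposition mu nu lam r rho a.

Let r0 : 0 < r. Proof. by case: dec => _ [] /andP[]. Qed.
Let rrho : r < rho. Proof. by case: dec => _ [] /andP[]. Qed.
Let rho0 : 0 < rho. Proof. exact: lt_trans rrho. Qed.
Let ca : forall x : R, r < `|x| ->
  cvgn (fun N => \sum_(2 <= n < N) `|a n / x ^+ n|).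
Proof. by case: dec => _ []. Qed.
Let muE A : measurable A -> mu A = (nu A + lam A)%E.
Proof. by case: dec => _ _; exact. Qed.

Local Notation px := (outer_density rho a).
Local Notation qx := (outer_remainder rho a).

Let px_ge0 x : 0 <= px x.
Proof.
rewrite /outer_density /outer; case: ifPn => [rx|_]; last by rewrite mul0r.
by rewrite mul1r; case: dec => _ [_ _ + _] _; apply.
Qed.

Let lamE A : measurable A -> lam A = (\int[leb]_(x in A) (px x)%:E)%E.
Proof.
move=> mA; case: dec => _ [_ _ _ /(_ A mA) ->] _.
rewrite integral_mkcondr; apply: eq_integral => x _.
rewrite patchE /outer_density /outer.
have -> : (x \in [set x : R | rho <= `|x|]) = (rho <= `|x : R|) by apply: asboolb.
by case: ifP => _; rewrite ?mul1r ?mul0r.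
Qed.

Let nu_fin : (nu setT < +oo)%E.
Proof.
apply: (@le_lt_trans _ _ (mu setT)); last by rewrite probability_setT ltry.
by rewrite muE// leeDl.
Qed.

Let lam_fin : (lam setT < +oo)%E.
Proof.
apply: (@le_lt_trans _ _ (mu setT)); last by rewrite probability_setT ltry.
by rewrite muE// leeDr.
Qed.

Let nu_sqr : nu.-integrable setT (EFin \o (fun x : B => (x : R) ^+ 2)).
Proof.
apply/integrableP; split; first by apply/measurable_EFinP; exact: exprn_measurable.
case: dec => + _ _; under eq_integral do rewrite /= -{1}(ger0_norm (sqr_ge0 _)).
by [].
Qed.

Let nu_id : nu.-integrable setT (EFin \o (fun x : B => (x : R))).
Proof.
apply: (@le_Rintegrable _ _ _ nu setT _ (fun x : B => 1 + (x : R) ^+ 2)) => //.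
  by apply: RintegrableD => //; exact: finite_mass_integrable_cst.
move=> x _; rewrite -[(x : R) ^+ 2]real_normK ?num_real//.
move: (`|x : R|) => w; have := sqr_ge0 (w - 1); have := sqr_ge0 w.
by rewrite sqrrB1; lra.
Qed.

(** Total mass 1 is what cancels the terms of order v in the expansion. *)
Let mass : \int[nu]_x (1 : R) + \int[leb]_x px x = 1.
Proof.
have ic (m : borel_measure R) := @finite_mass_integrable_cst _ _ _ m 1.
rewrite -[RHS](Rintegral_prob_cst mu).
rewrite (Rintegral_add_measure muE _ (ic _ nu_fin) (ic _ lam_fin))//.
congr (_ + _); rewrite [RHS]Rintegral_cst// mul1r /Rintegral.
by rewrite lamE.
Qed.

(** The remainder is at most c |x|^-3, so a negative a_2 would make the density negative as soon as
    - a_2 x > c. *)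
Lemma a2_ge0 : 0 <= a 2.
Proof.
rewrite leNgt; apply/negP => a2.
have [c c0 cP] := outer_remainder_le r0 rrho ca.
pose x := rho + c / - a 2 + 1.
have q0 : 0 <= c / - a 2 by rewrite divr_ge0// lerNr oppr0 ltW.
have x0 : 0 < x by rewrite /x; have := rho0; lra.
have rx : rho <= `|x| by rewrite gtr0_norm// /x; lra.
have := px_ge0 x; have := cP x.
rewrite /outer_remainder; set p := px x.
rewrite /outer rx !mul1r (gtr0_norm x0) => h p0.
have := le_trans (ler_norm _) h => h1.
have h2 : - a 2 * x ^- 2 <= c * x ^- 3 by lra.
have : - a 2 * x <= c.
  move: h2; rewrite -ler_pdivrMr ?invr_gt0 ?exprn_gt0// invrK.
  suff -> : - a 2 * x ^- 2 * x ^+ 3 = - a 2 * x by [].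
  by field; rewrite gt_eqF.
rewrite mulrC -ler_pdivlMr ?oppr_gt0// /x; have := rho0; lra.
Qed.

Let remE v (x : R) : Im v < 0 ->
  cabs ((qx x)%:C * x%:C ^+ 2 * (v - x%:C)^-1) =
  `|x| * (`|x| * (`|qx x| * (cabs (v - x%:C))^-1)).
Proof.
by move=> v0; rewrite !cabsM cabsV !cabsR; ring.
Qed.

(** In v^2 G(v) the coefficients of v add up to the total mass, and the constant terms, with i pi
    a_2 from the principal value, add up to the first moment. Three errors remain: [e1] from the
    finite-variance part, a_2 (pv - i pi), and [e3] from the remainder density. *)
Lemma P2_Gtransform_expansion : Gtransform_expansion mu
  ((\int[nu]_x (x : R))%:C + complex_moment rho a 1).
Proof.
move=> e e0.
have [c c0 cP] := outer_remainder_le r0 rrho ca.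
pose X2 := \int[nu]_x ((x : R) ^+ 2).
have X20 : 0 <= X2 by apply: Rintegral_ge0 => x _; exact: sqr_ge0.
pose c2 := \int[leb]_x (outer rho x * x ^- 2).
have c20 : 0 <= c2.
  by apply: Rintegral_ge0 => x _; rewrite mulr_ge0 ?outer_ge0// invr_ge0 sqr_ge0.
(* With this s the part of the bound on [e3] that does not decay in v is at most e / 2; everything
   else is of order 1 / |Im v| and is collected in [D]. *)
pose s := e / (2 * (c * c2 + 1)).
have cc2 : 0 <= c * c2 by rewrite mulr_ge0.
have s0 : 0 < s by rewrite divr_gt0// mulr_gt0// ltr_wpDl.
have p0 : 0 < pi :> R by exact: pi_gt0.
pose D1 := `|a 2| * (2 * rho * (1 + 2 * rho) + pi * (1 + rho ^+ 2)).
pose D := 2 * X2 + D1 + c * (s^-1 * pi).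
have D10 : 0 <= D1.
  have rho2 : 0 <= 2 * rho by rewrite mulr_ge0// ltW.
  apply: mulr_ge0 => //; apply: addr_ge0; first by rewrite mulr_ge0 ?addr_ge0.
  by rewrite mulr_ge0 ?(ltW p0)// addr_ge0 ?sqr_ge0.
have D0 : 0 <= D.
  apply: addr_ge0; first by apply: addr_ge0 => //; apply: mulr_ge0.
  by rewrite !mulr_ge0 ?invr_ge0 ?(ltW s0) ?(ltW p0).
(* 2 D / e makes D / |Im v| at most e / 2; the summand 1 gives |Im v| >= 1, so that |Im v|^-2 is at
   most |Im v|^-1. *)
exists (1 + 2 * D / e); first by rewrite ltr_pwDl// divr_ge0 ?mulr_ge0// ltW.
move=> v vK; pose y := - Im v.
have y1 : 1 + 2 * D / e <= y by rewrite /y; lra.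
have De : 0 <= 2 * D / e by rewrite divr_ge0 ?mulr_ge0// ltW.
have y0 : 0 < y by lra.
have v0 : Im v < 0 by rewrite -oppr_gt0.
have yD : D / y <= e / 2.
  rewrite ler_pdivrMr//; have : 2 * D / e <= y by lra.
  by rewrite ler_pdivrMr//; lra.
pose res (x : B) : R[i] := (v - (x : R)%:C)^-1.
have mres : Cmeasurable setT res by exact: Cmeasurable_resolvent.
have resM x : cabs (res x) <= `|Im v|^-1 by exact: cabs_resolvent_le.
have nures := finite_mass_Cintegrable nu_fin mres resM.
have lamres := finite_mass_Cintegrable lam_fin mres resM.
have mid : Cmeasurable setT (fun x : B => (x : R)%:C).
  by apply: Cmeasurable_real; exact: measurable_id.
(* v^2 / (v - x) = v + x + x^2 / (v - x) on the finite-variance part *)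
pose e1 := Cintegral nu setT (fun x : B => ((x : R) ^+ 2)%:C * res x).
have m1 : Cmeasurable setT (fun x : B => ((x : R) ^+ 2)%:C * res x).
  apply: CmeasurableM => //; apply: Cmeasurable_real; exact: exprn_measurable.
have b1 (x : B) : cabs (((x : R) ^+ 2)%:C * res x) <= y^-1 * (x : R) ^+ 2.
  rewrite cabsM cabsR ger0_norm ?sqr_ge0// mulrC ler_wpM2r ?sqr_ge0//.
  by apply: le_trans (resM x) _; rewrite ltr0_norm.
have k1 := RintegrableZl y^-1 measurableT nu_sqr.
have i1 := le_Cintegrable measurableT m1 k1 (fun x _ => b1 x).
have e1b : cabs e1 <= 2 * X2 / y.
  apply: le_trans (cabs_Cintegral_le measurableT m1 k1 (fun x _ => b1 x)) _.
  by rewrite (RintegralZl _ _ nu_sqr)// mulrA mulrAC.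
have nuE : v ^+ 2 * Cintegral nu setT res =
    v * (\int[nu]_x (1 : R))%:C + (\int[nu]_x (x : R))%:C + e1.
  have ic := Cintegrable_real (finite_mass_integrable_cst 1 nu_fin).
  have ii := Cintegrable_real nu_id.
  have iv := CintegrableZl v measurableT ic.
  rewrite -CintegralZl// -!Cintegral_real -CintegralZl// -CintegralD//.
  rewrite -CintegralD//; last exact: CintegrableD.
  apply: eq_Cintegral => x _; have h := resolvent_neq0 x v0.
  by rewrite /res rmorph1 rmorphXn/=; move: (x%:C) h => q h; field.
(* the same on the remainder density, and the principal value kernel on x^-2 *)
pose rem (x : B) := (qx x)%:C * (x : R)%:C ^+ 2 * res x.
pose e3 := Cintegral leb setT rem.
have iq := integrable_outer_remainder r0 rrho ca.
have ixq := integrable_mul_outer_remainder r0 rrho ca.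
have i2 := integrable_outer_sqr rho0.
have m3 : Cmeasurable setT rem.
  apply: CmeasurableM => //; apply: CmeasurableM => //.
    by apply: Cmeasurable_real; exact: (measurable_outer_remainder r0 rrho ca).
  exact: CmeasurableX.
have k3 := RintegrableZl c measurableT (integrable_outer_AMGM s^-1 s rho0 v0).
have b3 (x : B) : cabs (rem x) <= c * (2^-1 * (s * (outer rho x * (x : R) ^- 2) +
    s^-1 * (pi / - Im v * cauchy_pdf (Re v) (- Im v) x))).
  apply: le_trans (_ : c * (outer rho x * (`|x : R|^-1 * (cabs (v - x%:C))^-1)) <= _);
    last by rewrite ler_wpM2l// outer_AMGM.
  rewrite remE//.
  apply: le_trans (_ : `|x : R| * (`|x : R| * ((c * (outer rho x * `|x : R| ^- 3)) *
      (cabs (v - x%:C))^-1)) <= _).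
    do 2!rewrite ler_wpM2l//.
    by rewrite ler_wpM2r ?invr_ge0 ?cabs_ge0.
  rewrite le_eqVlt; apply/orP; left; apply/eqP.
  rewrite /outer; case: ifPn => [rx|_]; last by rewrite !mul0r !(mulr0, mul0r).
  have x0 : `|x : R| != 0 by rewrite gt_eqF// (lt_le_trans _ rx).
  by rewrite !mul1r; move: (cabs (v - _))^-1 `|x : R| x0 => u w w0; field.
have i3 := le_Cintegrable measurableT m3 k3 (fun x _ => b3 x).
have e3b : cabs e3 <= c * (s * c2) + c * (s^-1 * pi) / y.
  apply: le_trans (cabs_Cintegral_le measurableT m3 k3 (fun x _ => b3 x)) _.
  rewrite (RintegralZl _ _ (integrable_outer_AMGM s^-1 s rho0 v0))//.
  rewrite Rintegral_outer_AMGM// -/c2 -/y le_eqVlt; apply/orP; left; apply/eqP.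
  by field; rewrite !gt_eqF.
pose pv := Cintegral leb setT (pv_kernel rho v).
have lamG : v ^+ 2 * Cintegral lam setT res =
    (a 2)%:C * (v * c2%:C + pv) + v * (\int[leb]_x qx x)%:C +
    (\int[leb]_x (x * qx x))%:C + e3.
  have ipv := Cintegrable_pv_kernel rho0 v0.
  have j2 := Cintegrable_real i2; have jq := Cintegrable_real iq.
  have jxq := Cintegrable_real ixq.
  have vj2 := CintegrableZl v measurableT j2.
  have vjq := CintegrableZl v measurableT jq.
  have t1 := CintegrableD measurableT vj2 ipv.
  have t2 := CintegrableZl (a 2)%:C measurableT t1.
  have t3 := CintegrableD measurableT t2 vjq.
  have t4 := CintegrableD measurableT t3 jxq.
  have t5 := CintegrableD measurableT t4 i3.
  have ip := integrable_outer_density r0 rrho ca.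
  have idens : Cintegrable leb setT (fun x => res x * (px x)%:C).
    apply: le_Cintegrable (RintegrableZl `|Im v|^-1 measurableT ip) _ => //.
      apply: CmeasurableM => //; apply: Cmeasurable_real.
      exact: (measurable_outer_density r0 rrho ca).
    move=> x _; rewrite cabsM cabsR ger0_norm ?px_ge0// ler_wpM2r ?px_ge0//.
  have -> : Cintegral lam setT res = Cintegral leb setT (fun x => res x * (px x)%:C).
    refine (@Cintegral_density _ B R leb lam px res _ px_ge0 lamE mres idens).
    exact: (measurable_outer_density r0 rrho ca).
  rewrite -CintegralZl// -!Cintegral_real -(CintegralZl v measurableT j2).
  rewrite -(CintegralD measurableT vj2 ipv) -(CintegralZl _ measurableT t1).
  rewrite -(CintegralZl v measurableT jq) -(CintegralD measurableT t2 vjq).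
  rewrite -(CintegralD measurableT t3 jxq) -(CintegralD measurableT t4 i3).
  apply: eq_Cintegral => x _; have h := resolvent_neq0 x v0.
  have -> : px x = qx x + a 2 * (outer rho x * x ^- 2).
    by rewrite /outer_remainder subrK.
  rewrite /rem /pv_kernel /res rmorphD rmorphM/=.
  have -> : (x * qx x)%:C = x%:C * (qx x)%:C by rewrite rmorphM.
  move: (qx x)%:C => q.
  have outE : v ^+ 2 * ((v - x%:C)^-1 * (outer rho x * x ^- 2)%:C) =
      v * (outer rho x * x ^- 2)%:C +
      (outer rho x)%:C * (x%:C^-1 + (v - x%:C)^-1).
    rewrite /outer; case: ifPn => [rx|_]; last by rewrite !mul0r rmorph0 !mulr0 addr0.
    have x0 : x%:C != 0 :> R[i] by rewrite -cabs_gt0 cabsR (lt_le_trans _ rx).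
    rewrite !mul1r fmorphV rmorphXn/=; move: (x%:C) x0 h => w w0 h.
    by field; rewrite w0 h.
  rewrite mulrDr mulrDr [_ * ((a 2)%:C * _)]mulrCA [_ * ((a 2)%:C * _)]mulrCA outE.
  move: ((a 2)%:C * (v * _ + _)) => K; move: (x%:C) h => w h.
  by field.
have pvb := pv_kernel_integral rho0 v0; rewrite -/pv -/y in pvb.
have massC : (\int[nu]_x (1 : R))%:C + ((\int[leb]_x qx x)%:C + (a 2)%:C * c2%:C) =
    1 :> R[i].
  rewrite -rmorphM -!rmorphD/=; congr (_%:C); apply: etrans mass; congr (_ + _).
  have i2a := RintegrableZl (a 2) measurableT i2.
  rewrite /c2 -(RintegralZl _ _ i2)// -(RintegralD _ iq i2a)//.
  by apply: eq_Rintegral => x _; rewrite /outer_remainder subrK.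
have GE : v ^+ 2 * Gtransform mu v - v -
    ((\int[nu]_x (x : R))%:C + complex_moment rho a 1) =
    e1 + (a 2)%:C * (pv - (0 +i* pi)) + e3.
  rewrite /Gtransform (Cintegral_add_measure muE mres nures lamres) mulrDr nuE lamG.
  rewrite (complex_moment_eq r0 rrho ca) rmorphM/=.
  have -> : 0 +i* pi = (pi : R)%:C * 'i%C :> R[i].
    by apply: complex_eqP; rewrite ?cReM ?cImM/=; ring.
  rewrite -[v in X in _ - X - _](mulr1) -massC; ring.
rewrite GE; apply: le_trans (cabsD _ _) _.
apply: le_trans (lerD (le_trans (cabsD _ _) (lerD e1b (lexx _))) e3b) _.
rewrite cabsM cabsR.
have pvb' : cabs (pv - (0 +i* pi)) <=
    (2 * rho * (1 + 2 * rho) + pi * (1 + rho ^+ 2)) / y.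
  apply: le_trans pvb _.
  rewrite [leRHS]mulrDl -[pi * (1 + _) / _]mulrA lerD2r -[leRHS]mulrA.
  rewrite ler_wpM2l ?mulr_ge0 ?(ltW rho0)// [leRHS]mulrDl mul1r lerD2l.
  rewrite ler_wpM2l ?mulr_ge0 ?(ltW rho0)// lef_pV2 ?posrE ?exprn_gt0//.
  by rewrite expr2 ler_peMr ?(ltW y0)//; lra.
have h2 : `|a 2| * cabs (pv - (0 +i* pi)) <= D1 / y.
  by rewrite /D1 -mulrA ler_wpM2l.
have h3 : c * (s * c2) <= e / 2.
  have -> : c * (s * c2) = e / 2 * (c * c2 / (c * c2 + 1)).
    by rewrite /s; field; rewrite gt_eqF// ltr_wpDl.
  rewrite ler_piMr ?divr_ge0 ?(ltW e0)// ler_pdivrMr ?ltr_wpDl// mul1r.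
  by rewrite lerDl.
have DE : D / y = 2 * X2 / y + D1 / y + c * (s^-1 * pi) / y.
  by rewrite /D !mulrDl.
lra.
Qed.

(** Apart from i pi a_2 every contribution to the moment is real. *)
Lemma Im_first_moment_ge0 :
  0 <= Im ((\int[nu]_x (x : R))%:C + complex_moment rho a 1).
Proof.
rewrite (complex_moment_eq r0 rrho ca) cImD cImD cImM/=.
by rewrite mulr1 mulr0 !addr0 add0r mulr_ge0 ?pi_ge0 ?a2_ge0.
Qed.

End P2_expansion.

Theorem theorem3p1 (R : realType) (mu : borel_probability R) (m1 : R[i]) :
  in_P2 mu -> first_complex_moment mu m1 ->
  let a := complex.Re m1 in
  let b := complex.Im m1 in
  [/\ weak_cvg (fun N => tensor_power (dilation N%:R^-1 mu) N)
        (cauchy_prob a b),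
      forall muF : nat -> borel_probability R,
        (forall N, (0 < N)%N -> free_power (dilation N%:R^-1 mu) N (muF N)) ->
        weak_cvg muF (cauchy_prob a b) &
      forall muB : nat -> borel_probability R,
        (forall N, (0 < N)%N ->
           boolean_power (dilation N%:R^-1 mu) N (muB N)) ->
        weak_cvg muB (cauchy_prob a b)].
Proof.
move=> _ [nu [lam [r [rho [c [dec ->]]]]]] a b.
have E := P2_Gtransform_expansion dec.
have b0 := Im_first_moment_ge0 dec.
split.
- by apply: weak_cvg_Gtransform => //; exact: tensor_Gtransform_cvg.
- move=> muF hF; apply: weak_cvg_Gtransform => //.
  exact: free_Gtransform_cvg hF.
- move=> muB hB; apply: weak_cvg_Gtransform => //.
  exact: boolean_Gtransform_cvg hB.
Qed.
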